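(* Let $(A,\Delta)$ be a reduced compact quantum group, $\alpha\colon B\to A\otimes B$ a non-degenerate left coaction on a unital C$^*$-algebra $B$, and $\mathcal B=B\triangleleft\hat{\mathcal A}$. Let $(\pi,H,F,\gamma,U)$ be an $\alpha$-equivariant even Fredholm module over $\mathcal B$ which is $(2n+1)$-summable. Then the functional on $\hat{\mathcal A}\otimes\mathcal B^{\otimes(2n+1)}$ given by $$\phi_F(\omega\otimes b_0\otimes\dots\otimes b_{2n})=\frac{(-1)^n}{2}\mathrm{Tr}\big(\gamma\,\pi_U(\omega)F[F,\pi(b_0)]\cdots[F,\pi(b_{2n})]\big)$$ is a cyclic cocycle in $C^{2n}_{\hat{\mathcal A}}(\mathcal B)$ (that is, $\phi_F\in C^{2n}_{\hat{\mathcal A}}(\mathcal B)$, $t_{2n}\phi_F=\phi_F$ and $b\phi_F=0$), and thus defines an element of $HC^{2n}_{\hat{\mathcal A}}(\mathcal B)$.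
   Context: Compact quantum group (Woronowicz): a unital C$^*$-algebra $A$ with coassociative unital $*$-homomorphism $\Delta\colon A\to A\otimes A$ such that $\Delta(A)(A\otimes1)$ and $\Delta(A)(1\otimes A)$ are dense in $A\otimes A$; $\varphi$ is its Haar state; reduced means $\varphi$ is faithful. $\mathcal A\subset A$ is the dense Hopf $*$-algebra of matrix coefficients of irreducible unitary corepresentations, with antipode $S$. A unitary corepresentation on $H$ is a unitary $U\in M(A\otimes K(H))$ with $(\Delta\otimes\iota)(U)=U_{13}U_{23}$. $\hat{\mathcal A}$ is the algebra of bounded functionals on $A$ of the form $\varphi(a\,\cdot)$, $a\in\mathcal A$, with product $\omega\eta=(\omega\otimes\eta)\Delta$; it is isomorphic to the algebraic direct sum $\bigoplus_{s}B(H_s)$ over classes of irreducible unitary corepresentations. It has comultiplication $\hat\Delta\colon\hat{\mathcal A}\to M(\hat{\mathcal A}\otimes\hat{\mathcal A})=\prod_{s,t}B(H_s)\otimes B(H_t)$, $\hat\Delta(\omega)(a\otimes b)=\omega(ab)$, counit $\hat\varepsilon(\omega)=\omega(1)$, antipode $\hat S(\omega)=\omega\circ S$. Sweedler notation starts at $0$: $\omega_{(0)}\otimes\omega_{(1)}\otimes\cdots$; the Sweedler expressions below make sense as finite sums since $\mathcal B\triangleleft\hat{\mathcal A}=\mathcal B$. Coaction: a unital $*$-homomorphism $\alpha$ with $(\Delta\otimes\iota)\alpha=(\iota\otimes\alpha)\alpha$; non-degenerate: $(A\otimes1)\alpha(B)$ is dense in $A\otimes B$. $\hat{\mathcal A}$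 acts on $B$ from the right by $b\triangleleft\omega=(\omega\otimes\iota)\alpha(b)$; $\mathcal B=B\triangleleft\hat{\mathcal A}$ is a dense unital $*$-subalgebra with $\alpha(\mathcal B)\subset\mathcal A\otimes\mathcal B$ (algebraic tensor product). $\alpha$-equivariant even Fredholm module over $\mathcal B$: $\pi$ is a bounded $*$-representation of $\mathcal B$ on a graded Hilbert space $H=H_-\oplus H_+$; $F=F^*$, $F^2=1$; $\gamma=\begin{pmatrix}-1&0\\0&1\end{pmatrix}$ is the grading operator, $F$ is odd and all $\pi(b)$ are even; $[F,\pi(b)]$ is compact for all $b\in\mathcal B$; $U\in M(A\otimes K(H))$ is a unitary corepresentation of $(A,\Delta)$ commuting with $1\otimes F$ and $1\otimes\gamma$ and satisfying $U(\iota\otimes\pi)\alpha(b)=(1\otimes\pi(b))U$ for $b\in\mathcal B$. $\pi_U(\omega)=(\omega\otimes\iota)(U)$. It is $(2n+1)$-summable if $[F,\pi(b)]$ is in the Schatten class $\mathcal L^{2n+1}(H)$ for all $b\in\mathcal B$. $C^m_{\hat{\mathcal A}}(\mathcal B)$ is the space of linear functionals $f$ on $\hat{\mathcal A}\otimes\mathcal B^{\otimes(m+1)}$ with $f(\hat S^{-1}(\omega_{(0)})\eta\omega_{(1)}\otimes b_0\triangleleft\omega_{(2)}\otimes\dots\otimes b_m\triangleleft\omega_{(m+2)})=\hat\varepsilon(\omega)f(\eta\otimes b_0\otimes\dots\otimes b_m)$. Put $(t_mf)(\omega\otimes b_0\otimes\dots\otimes b_m)=f(\omega_{(0)}\otimes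 b_m\triangleleft\omega_{(1)}\otimes b_0\otimes\dots\otimes b_{m-1})$; $(d_i^mf)(\omega\otimes b_0\otimes\dots\otimes b_m)=f(\omega\otimes b_0\otimes\dots\otimes b_ib_{i+1}\otimes\dots\otimes b_m)$ for $0\le i<m$; $d_m^m=t_md_0^m$; $b=\sum_{i=0}^m(-1)^id_i^m\colon C^{m-1}_{\hat{\mathcal A}}(\mathcal B)\to C^m_{\hat{\mathcal A}}(\mathcal B)$; $\lambda_m=(-1)^mt_m$. $HC^\bullet_{\hat{\mathcal A}}(\mathcal B)$ is the cohomology of $(\mathrm{Ker}(\iota-\lambda),b)$. *)

(* Defs.v *)
From HB Require Import structures.
From mathcomp Require Import all_boot all_order all_algebra.
From mathcomp Require Import complex.
From mathcomp Require Import all_classical all_reals all_analysis.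

Set Implicit Arguments.
Unset Strict Implicit.
Unset Printing Implicit Defensive.

Import Order.TTheory GRing.Theory Num.Theory.
Import numFieldNormedType.Exports.
Local Open Scope classical_set_scope.
Local Open Scope ring_scope.
Local Open Scope complex_scope.

(* Unital C*-algebras, with 1 != 0. *)
HB.mixin Record isCStar (R : realType) A of GRing.Algebra R[i] A := {
  star : A -> A ;
  cnorm : A -> R ;
  starK : forall a, star (star a) = a ;
  star_antilinear : forall (c : R[i]) a b,
    star (c *: a + b) = Num.conj c *: star a + star b ;
  starM : forall a b, star (a * b) = star b * star a ;
  cnorm_ge0 : forall a, 0 <= cnorm a ;
  cnorm_eq0 : forall a, cnorm a = 0 -> a = 0 ;
  cnormD : forall a b, cnorm (a + b) <= cnorm a + cnorm b ;
  cnormZ : forall (c : R[i]) a, (cnorm (c *: a))%:C = `|c| * (cnorm a)%:C ;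
  cnormM : forall a b, cnorm (a * b) <= cnorm a * cnorm b ;
  cstar_identity : forall a, cnorm (star a * a) = cnorm a ^+ 2 ;
  cnorm_complete : forall u : nat -> A,
    (forall e : R, 0 < e -> exists N, forall p q, (N <= p)%N -> (N <= q)%N ->
       cnorm (u p - u q) <= e) ->
    exists a, forall e : R, 0 < e -> exists N, forall p, (N <= p)%N ->
      cnorm (u p - a) <= e
}.

#[short(type="cstarAlgType")]
HB.structure Definition CStarAlgebra (R : realType) :=
  {A of isCStar R A & GRing.Algebra R[i] A}.

(* The norm of a normed module over R[i] is R[i]-valued, and 0 <= z in R[i]
   says that z is real and nonnegative. *)
HB.mixin Record isHilbert (R : realType) H of CompleteNormedModule R[i] H := {
  inner : H -> H -> R[i] ;
  inner_linear : forall (c : R[i]) x y z,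
    inner (c *: x + y) z = c * inner x z + inner y z ;
  inner_conj : forall x y, inner y x = Num.conj (inner x y) ;
  inner_norm : forall x : H, inner x x = `|x| ^+ 2
}.

#[short(type="hilbertType")]
HB.structure Definition Hilbert (R : realType) :=
  {H of isHilbert R H & CompleteNormedModule R[i] H}.

Notation "[< x , y >]" := (inner x y) (x at level 60, y at level 60).

Definition lspan (R : realType) (V : lmodType R[i]) (X : set V) : set V :=
  [set v | exists (N : nat) (c : 'I_N -> R[i]) (x : 'I_N -> V),
     (forall j, X (x j)) /\ v = \sum_(j < N) c j *: x j].

(* Operators are functions; composition is [\o] and linear combinations are
   pointwise. *)
Section Operators.
Variables (R : realType) (K : hilbertType R).
Implicit Types T S : K -> K.

Definition bounded_op T :=
  linear T /\ exists M : R[i], forall x, `|T x| <= M * `|x|.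

Definition adjoint T S := forall x y, [<T x, y>] = [<x, S y>].

Definition unitary T := bounded_op T /\
  exists S, [/\ bounded_op S, adjoint T S, T \o S = idfun & S \o T = idfun].

Definition compact_op T :=
  bounded_op T /\ compact (closure (T @` [set x : K | `|x| <= 1])).

Definition op_near T S (e : R[i]) := forall x, `|T x - S x| <= e * `|x|.

Definition op_closure (X : set (K -> K)) : set (K -> K) :=
  [set T | bounded_op T /\
     forall e : R[i], 0 < e -> exists2 S, X S & op_near T S e].

(* Multipliers of an algebra D of operators acting non-degenerately. *)
Definition multipliers (D : set (K -> K)) : set (K -> K) :=
  [set T | bounded_op T /\ forall X, D X -> D (T \o X) /\ D (X \o T)].

Definition commutator T S : K -> K := (T \o S) - (S \o T).

Definition orthonormal_basis (E : set K) :=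
  (forall x y, E x -> E y -> [<x, y>] = (x == y)%:R) /\
  (forall x, (forall e, E e -> [<x, e>] = 0) -> x = 0).

(* Unordered sum over a possibly uncountable set. *)
Definition has_sum (E : set K) (f : K -> R[i]) (t : R[i]) :=
  forall e : R[i], 0 < e ->
    exists F0, [/\ finite_set F0, F0 `<=` E &
      forall F, finite_set F -> F0 `<=` F -> F `<=` E ->
        `|\sum_(x \in F) f x - t| <= e].

Definition has_trace T (t : R[i]) :=
  forall E, orthonormal_basis E -> has_sum E (fun x => [<T x, x>]) t.

Definition Tr T : R[i] := xget 0 [set t | has_trace T t].

(* P = |T|, the positive square root of T^* T *)
Definition is_abs T P := [/\ bounded_op P, (forall x, 0 <= [<P x, x>]) &
  forall x y, [<P (P x), y>] = [<T x, T y>]].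

(* |T|^p has finite trace *)
Definition schatten (p : nat) T := bounded_op T /\
  exists2 P, is_abs T P & exists t, has_trace (iter p (comp P) idfun) t.

End Operators.

(* The Hilbert space tensor product of K and L. *)
Record hilbertTensor (R : realType) (K L : hilbertType R) := HilbertTensor {
  ht_space :> hilbertType R ;
  tens : K -> L -> ht_space ;
  tens_linearl : forall l, linear (fun k => tens k l) ;
  tens_linearr : forall k, linear (tens k) ;
  tens_inner : forall k l k' l',
    [<tens k l, tens k' l'>] = [<k, k'>] * [<l, l'>] ;
  tens_dense : dense (lspan [set z | exists k l, z = tens k l])
}.

(* A unital C*-algebra together with a faithful unital *-representation on a
   Hilbert space, used to form the minimal tensor products. *)
Record repCStar (R : realType) := RepCStar {
  rc_alg :> cstarAlgType R ;
  rc_space : hilbertType R ;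
  rep : rc_alg -> rc_space -> rc_space ;
  rep_bounded : forall a, bounded_op (rep a) ;
  rep_linear : linear rep ;
  rep1 : rep 1 = idfun ;
  repM : forall a b, rep (a * b) = rep a \o rep b ;
  rep_star : forall a, adjoint (rep a) (rep (star a)) ;
  rep_inj : injective rep
}.
Arguments rep {R r} _ _.

Section Tensor.
Variables (R : realType) (K L : hilbertType R) (KL : hilbertTensor K L).

(* T (x) S *)
Definition op_tens (T : K -> K) (S : L -> L) : KL -> KL :=
  xget (fun=> 0) [set V : KL -> KL | bounded_op V /\
    forall k l, V (tens KL k l) = tens KL (T k) (S l)].

(* Spatial tensor product of two norm closed algebras of operators. *)
Definition spatial (X : set (K -> K)) (Y : set (L -> L)) : set (KL -> KL) :=
  op_closure (lspan [set V : KL -> KL | exists T S,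
    [/\ X T, Y S & V = op_tens T S]]).

End Tensor.
Arguments op_tens {R K L} KL T S.
Arguments spatial {R K L} KL X Y.

Section Legs.
Variables (R : realType) (K1 K2 L : hilbertType R).
Variables (KK : hilbertTensor K1 K2) (KKL : hilbertTensor KK L).

(* T (x) V on K1 (x) K2 (x) L, for V acting on K2 (x) L. *)
Definition leg1_23 (K2L : hilbertTensor K2 L) (T : K1 -> K1) (V : K2L -> K2L) :
    KKL -> KKL :=
  xget (fun=> 0) [set W : KKL -> KKL | bounded_op W /\
    forall k1 k2 l k1' k2' l',
      [<W (tens KKL (tens KK k1 k2) l), tens KKL (tens KK k1' k2') l'>] =
      [<T k1, k1'>] * [<V (tens K2L k2 l), tens K2L k2' l'>]].

(* V_13 on K1 (x) K2 (x) L, for V acting on K1 (x) L. *)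
Definition leg13 (K1L : hilbertTensor K1 L) (V : K1L -> K1L) : KKL -> KKL :=
  xget (fun=> 0) [set W : KKL -> KKL | bounded_op W /\
    forall k1 k2 l k1' k2' l',
      [<W (tens KKL (tens KK k1 k2) l), tens KKL (tens KK k1' k2') l'>] =
      [<V (tens K1L k1 l), tens K1L k1' l'>] * [<k2, k2'>]].

End Legs.
Arguments leg1_23 {R K1 K2 L KK} KKL {K2L} T V.
Arguments leg13 {R K1 K2 L KK} KKL {K1L} V.

(* Slices. In [<(iota (x) w_(l,l')) T k, k'>] = [<T (k (x) l), k' (x) l'>] the
   left-hand side lies in A when T is in A (x) B or in M(A (x) K(H)). *)
Section Slices.
Variables (R : realType) (A : repCStar R) (L : hilbertType R).
Variable (AL : hilbertTensor (rc_space A) L).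

Definition coef (T : AL -> AL) (l l' : L) : A :=
  xget 0 [set a : A | forall k k',
    [<rep a k, k'>] = [<T (tens AL k l), tens AL k' l'>]].

(* (w (x) iota)(T) *)
Definition slice (w : A -> R[i]) (T : AL -> AL) : L -> L :=
  xget (fun=> 0) [set S : L -> L | bounded_op S /\
    forall l l', [<S l, l'>] = w (coef T l l')].

End Slices.

Section RightSlice.
Variables (R : realType) (K : hilbertType R) (A : repCStar R).
Variable (KA : hilbertTensor K (rc_space A)).

Definition coefr (T : KA -> KA) (k k' : K) : A :=
  xget 0 [set a : A | forall l l',
    [<rep a l, l'>] = [<T (tens KA k l), tens KA k' l'>]].

(* (iota (x) w)(T) *)
Definition slicer (w : A -> R[i]) (T : KA -> KA) : K -> K :=
  xget (fun=> 0) [set S : K -> K | bounded_op S /\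
    forall k k', [<S k, k'>] = w (coefr T k k')].

End RightSlice.

Definition rep_range (R : realType) (A : repCStar R) :
  set (rc_space A -> rc_space A) := range (@rep R A).

Notation tensC A B := (hilbertTensor (rc_space A) (rc_space B)).

Section Algebra.
Variables (R : realType) (A B : repCStar R) (AB : tensC A B).

(* s is a decomposition of T as a finite sum of x (x) y, x in P, y in Q *)
Definition decomposes (P : set A) (Q : set B) (T : AB -> AB) (s : seq (A * B)) :=
  (forall p, p \in s -> P p.1 /\ Q p.2) /\
  T = \sum_(p <- s) op_tens AB (rep p.1) (rep p.2).

Definition unital_star_hom (d : B -> AB -> AB) :=
  [/\ forall b, spatial AB (@rep_range R A) (@rep_range R B) (d b),
      linear d, d 1 = idfun, (forall b c, d (b * c) = d b \o d c) &
      forall b, adjoint (d b) (d (star b))].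

End Algebra.

Section Coactions.
Variables (R : realType) (A : repCStar R) (AA : tensC A A).
Variable (Delta : A -> AA -> AA).

(* T' = (Delta (x) iota)(T), by continuous extension; the second legs range
   over Y. *)
Definition Delta_iota (L : hilbertType R) (AL : hilbertTensor (rc_space A) L)
    (AAL : hilbertTensor AA L) (Y : set (L -> L))
    (T : AL -> AL) (T' : AAL -> AAL) :=
  bounded_op T' /\
  forall e : R[i], 0 < e -> exists s : seq (A * (L -> L)),
    [/\ forall p, p \in s -> Y p.2,
        op_near T (\sum_(p <- s) op_tens AL (rep p.1) p.2) e &
        op_near T' (\sum_(p <- s) op_tens AAL (Delta p.1) p.2) e].

(* T' = (iota (x) alpha)(T) *)
Definition iota_alpha (B : repCStar R) (AB : tensC A B)
    (AAB : hilbertTensor AA (rc_space B)) (alpha : B -> AB -> AB)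
    (T : AB -> AB) (T' : AAB -> AAB) :=
  bounded_op T' /\
  forall e : R[i], 0 < e -> exists s : seq (A * B),
    op_near T (\sum_(p <- s) op_tens AB (rep p.1) (rep p.2)) e /\
    op_near T' (\sum_(p <- s) leg1_23 AAB (rep p.1) (alpha p.2)) e.

Definition coaction (B : repCStar R) (AB : tensC A B)
    (AAB : hilbertTensor AA (rc_space B)) (alpha : B -> AB -> AB) :=
  unital_star_hom alpha /\
  forall b, exists T : AAB -> AAB,
    Delta_iota (@rep_range R B) (alpha b) T /\ iota_alpha alpha (alpha b) T.

(* (A (x) 1) alpha(B) is dense in A (x) B *)
Definition nondegenerate_coaction (B : repCStar R) (AB : tensC A B)
    (alpha : B -> AB -> AB) :=
  op_closure (lspan [set T : AB -> AB | exists a b,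
    T = op_tens AB (rep a) idfun \o alpha b]) =
  spatial AB (@rep_range R A) (@rep_range R B).

Definition compact_quantum_group (AAA : hilbertTensor AA (rc_space A)) :=
  [/\ coaction AAA Delta,
      op_closure (lspan [set T : AA -> AA | exists a b,
        T = Delta a \o op_tens AA (rep b) idfun]) =
      spatial AA (@rep_range R A) (@rep_range R A) &
      op_closure (lspan [set T : AA -> AA | exists a b,
        T = Delta a \o op_tens AA idfun (rep b)]) =
      spatial AA (@rep_range R A) (@rep_range R A)].

Definition haar_state (phi : A -> R[i]) :=
  [/\ scalar phi, (forall a, 0 <= phi (star a * a)), phi 1 = 1,
      (forall a, slice phi (Delta a) = phi a *: idfun) &
      forall a, slicer phi (Delta a) = phi a *: idfun].

Definition faithful_state (phi : A -> R[i]) :=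
  forall a, phi (star a * a) = 0 -> a = 0.

(* Irreducible unitary corepresentations on C^n, n > 0, as matrices over A. *)
Definition irr_corep (n : nat) (u : 'M[A]_n) :=
  [/\ (0 < n)%N,
      (forall i j, \sum_k u i k * star (u j k) = (i == j)%:R),
      (forall i j, \sum_k star (u k i) * u k j = (i == j)%:R),
      (forall i j, Delta (u i j) =
         \sum_k op_tens AA (rep (u i k)) (rep (u k j))) &
      forall T : 'M[R[i]]_n,
        (forall i j, \sum_k T i k *: u k j = \sum_k T k j *: u i k) ->
        is_scalar_mx T].

Definition matA : set A :=
  lspan [set a | exists n (u : 'M[A]_n) i j, irr_corep u /\ a = u i j].

Definition counit (eps : A -> R[i]) :=
  (forall c a b, matA a -> matA b -> eps (c *: a + b) = c * eps a + eps b) /\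
  forall a s, matA a -> decomposes matA matA (Delta a) s ->
    \sum_(p <- s) eps p.1 *: p.2 = a /\ \sum_(p <- s) eps p.2 *: p.1 = a.

Definition antipode (S : A -> A) :=
  [/\ (forall a, matA a -> matA (S a)),
      (forall c a b, matA a -> matA b -> S (c *: a + b) = c *: S a + S b) &
      exists2 eps, counit eps &
        forall a s, matA a -> decomposes matA matA (Delta a) s ->
          \sum_(p <- s) S p.1 * p.2 = eps a *: 1 /\
          \sum_(p <- s) p.1 * S p.2 = eps a *: 1].

Definition antipode_inv (S : A -> A) (a : A) : A :=
  xget 0 [set c | matA c /\ S c = a].

Definition hatA (phi : A -> R[i]) : set (A -> R[i]) :=
  [set w | exists2 a, matA a & forall x, w x = phi (a * x)].

(* A (x) K(H) *)
Definition A_compacts (H : hilbertType R) (AH : hilbertTensor (rc_space A) H) :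
  set (AH -> AH) := spatial AH (@rep_range R A) (@compact_op R H).

Arguments A_compacts {H} AH _.

(* (Delta (x) iota)(U) is the multiplier with
   (Delta (x) iota)(U) (Delta (x) iota)(X) = (Delta (x) iota)(U X)
   for all X in A (x) K(H). *)
Definition unitary_corep (H : hilbertType R)
    (AH : hilbertTensor (rc_space A) H) (AAH : hilbertTensor AA H)
    (U : AH -> AH) :=
  [/\ unitary U, multipliers (A_compacts AH) U &
      forall X X' Y', A_compacts AH X ->
        Delta_iota (@compact_op R H) X X' ->
        Delta_iota (@compact_op R H) (U \o X) Y' ->
        Y' = leg13 AAH U \o leg1_23 AAH idfun U \o X' :> (AAH -> AAH)].

End Coactions.


Section Cochains.
Variables (R : realType) (A B : repCStar R) (AA : tensC A A) (AB : tensC A B).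
Variables (Delta : A -> AA -> AA) (phi : A -> R[i]) (S : A -> A).
Variable (alpha : B -> AB -> AB).

Local Notation hatA := (hatA Delta phi).
Local Notation matA := (matA Delta).

(* b <| w = (w (x) iota) alpha(b) *)
Definition act (b : B) (w : A -> R[i]) : B :=
  xget 0 [set c : B | rep c = slice w (alpha b)].

Definition calB : set B := lspan [set c | exists b w, hatA w /\ c = act b w].

(* A chosen decomposition of alpha(b), for b in calB, in the algebraic tensor
   product of matA and calB. The multilinear expressions below do not depend
   on the choice. *)
Definition coact_dec (b : B) : seq (A * B) :=
  xget [::] [set s | decomposes matA calB (alpha b) s].

(* The Sweedler expressions are evaluated through
     hatDelta(w)(x (x) y) = w(xy),  hatS(w) = w o S,
     w eta = (w (x) eta) Delta,  b <| w = (w (x) iota) alpha(b).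
   If alpha(b_i) is the sum of x_i (x) y_i, then
     hatS^-1(w_0) eta w_1 (x) b_0 <| w_2 (x) ... (x) b_m <| w_(m+2)
   is the sum of [ad_dual w eta (x_0 ... x_m)] (x) y_0 (x) ... (x) y_m, where
   ad_dual w eta x is hatS^-1(w_0) eta w_1 w_2(x), that is the functional
     c |-> w (S^-1(c_0) c_2 x) eta(c_1). *)
Definition ad_dual (w eta : A -> R[i]) (x : A) : A -> R[i] :=
  xget (fun=> 0) [set g | hatA g /\
    forall c (s : seq (A * A)) (r : A * A -> seq (A * A)),
      matA c -> decomposes matA matA (Delta c) s ->
      (forall p, p \in s -> decomposes matA matA (Delta p.1) (r p)) ->
      g c = \sum_(p <- s) \sum_(q <- r p)
              w (antipode_inv Delta S q.1 * p.2 * x) * eta q.2].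

(* Functionals on hatA (x) calB^(m+1) are the maps that are multilinear on
   hatA and calB; values at other arguments are irrelevant. *)
Definition cochain (m : nat) := (A -> R[i]) -> ('I_m.+1 -> B) -> R[i].

Definition cochain_eq m (f g : cochain m) :=
  forall w b, hatA w -> (forall i, calB (b i)) -> f w b = g w b.

Definition multilinear m (f : cochain m) :=
  (forall (c : R[i]) w eta b, hatA w -> hatA eta -> (forall i, calB (b i)) ->
     f (fun x => c * w x + eta x) b = c * f w b + f eta b) /\
  (forall (c : R[i]) w b i u v, hatA w -> (forall j, calB (b j)) ->
     calB u -> calB v ->
     f w [eta b with i |-> c *: u + v] =
     c * f w [eta b with i |-> u] + f w [eta b with i |-> v]).

(* C^m_hatA(calB) *)
Definition invariant_cochain m (f : cochain m) :=
  multilinear f /\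
  forall w eta b, hatA w -> hatA eta -> (forall i, calB (b i)) ->
    \sum_(J : {dffun forall i : 'I_m.+1, 'I_(size (coact_dec (b i)))})
      (let p i := tnth (in_tuple (coact_dec (b i))) (J i) in
       f (ad_dual w eta (\prod_i (p i).1)) (fun i => (p i).2)) =
    w 1 * f eta b.

(* w_0 w_1(x) is the functional c |-> w(c x) *)
Definition t_op m (f : cochain m) : cochain m := fun w b =>
  \sum_(p <- coact_dec (b ord_max))
    f (fun c => w (c * p.1))
      (fun i => if i == ord0 then p.2 else b (inord i.-1)).

Definition face m (i : nat) (f : cochain m) : cochain m.+1 := fun w b =>
  f w (fun j : 'I_m.+1 =>
    if (j < i)%N then b (inord j)
    else if j == i :> nat then b (inord j) * b (inord j.+1)
    else b (inord j.+1)).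

Definition b_op m (f : cochain m) : cochain m.+1 := fun w b =>
  \sum_(i < m.+1) (-1) ^+ i * face i f w b
  + (-1) ^+ m.+1 * t_op (face 0 f) w b.

Definition lambda_op m (f : cochain m) : cochain m := fun w b =>
  (-1) ^+ m * t_op f w b.

Definition cyclic_cochain m (f : cochain m) :=
  invariant_cochain f /\ cochain_eq (lambda_op f) f.

Definition cyclic_cocycle m (f : cochain m) :=
  cyclic_cochain f /\ cochain_eq (b_op f) (fun _ _ => 0).

Definition cyclic_coboundary m : cochain m -> Prop :=
  match m return cochain m -> Prop with
  | 0 => fun f => cochain_eq f (fun _ _ => 0)
  | m'.+1 => fun f => exists2 g : cochain m', cyclic_cochain g &
               cochain_eq f (b_op g)
  end.

Definition HC_class m (f : cochain m) : set (cochain m) :=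
  [set g | cyclic_cocycle g /\
           cyclic_coboundary (fun w b => g w b - f w b)].

Definition HC m : set (set (cochain m)) :=
  [set X | exists2 f, cyclic_cocycle f & X = HC_class f].

Section Fredholm.
Variables (H : hilbertType R) (AH : hilbertTensor (rc_space A) H).
Variable (AAH : hilbertTensor AA H).
Variables (rho : B -> H -> H) (F gamma : H -> H) (U : AH -> AH).

Definition star_representation :=
  [/\ forall b, calB b -> bounded_op (rho b),
      (forall (c : R[i]) a b, calB a -> calB b ->
         rho (c *: a + b) = c *: rho a + rho b),
      (forall a b, calB a -> calB b -> rho (a * b) = rho a \o rho b) &
      forall b, calB b -> adjoint (rho b) (rho (star b))].

(* H_- and H_+ are the eigenspaces of gamma for -1 and 1. *)
Definition even_fredholm_module :=
  [/\ star_representation,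
      [/\ bounded_op gamma, adjoint gamma gamma & gamma \o gamma = idfun],
      [/\ bounded_op F, adjoint F F & F \o F = idfun],
      F \o gamma = - (gamma \o F) &
      forall b, calB b ->
        rho b \o gamma = gamma \o rho b /\ compact_op (commutator F (rho b))].

Definition equivariant_even_fredholm_module :=
  [/\ even_fredholm_module,
      unitary_corep Delta AAH U,
      U \o op_tens AH idfun F = op_tens AH idfun F \o U,
      U \o op_tens AH idfun gamma = op_tens AH idfun gamma \o U &
      forall b s, calB b -> decomposes matA calB (alpha b) s ->
        U \o (\sum_(p <- s) op_tens AH (rep p.1) (rho p.2)) =
        op_tens AH idfun (rho b) \o U].

Definition schatten_summable (p : nat) :=
  forall b, calB b -> schatten p (commutator F (rho b)).

(* gamma pi_U(w) F [F, rho(b_0)] ... [F, rho(b_m)] *)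
Definition chern_op m (w : A -> R[i]) (b : 'I_m.+1 -> B) : H -> H :=
  gamma \o slice w U \o F \o
  \big[comp/idfun]_(i < m.+1) commutator F (rho (b i)).

Definition phi_F (n : nat) : cochain n.*2 := fun w b =>
  (-1) ^+ n / 2 * Tr (chern_op w b).

End Fredholm.
End Cochains.

Arguments phi_F {R A B H AH} rho F gamma U n _ _.

(* Main.v *)
(* Writing [p = 2n + 1], each commutator [F, rho(b)] lies in the Schatten class
   of exponent p, so that a product of p of them, times bounded operators, is of
   trace class and its trace is cyclic. To have this without the theory of the
   Schatten ideals, operators are expanded into telescoping series of finite rank
   pieces whose norms are controlled by products of p-summable sequences; these
   expansions multiply, and the generalized Hoelder inequality makes a product of
   p of them absolutely summable.

   The Haar state being invariant, the slices of [Delta(c)] by [phi(u_ij .)] are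
   explicit, u irreducible. Applied to the coefficients of the corepresentation U
   this gives U (1 (x) Pi_ij) = sum_k u_ki^* (x) Pi_kj and
   (1 (x) Pi_ij) U = sum_k z_kj (x) Pi_ik, where Pi_ij is the operator of
   [phi(u_ij .)] and z_kj = S^-1(u_kj). Equivariance of U under alpha and these
   two formulas reduce the invariance of the cochain to the cyclicity of the
   trace; the cyclicity of the cochain and the vanishing of its coboundary are
   Connes' computation, with U accounting for the twist in the last face. *)
Require Import Defs.
From HB Require Import structures.
From mathcomp Require Import all_boot all_order all_algebra.
From mathcomp Require Import complex ring lra.
From mathcomp Require Import all_classical all_reals all_analysis.

Set Implicit Arguments.
Unset Strict Implicit.
Unset Printing Implicit Defensive.

Import Order.TTheory GRing.Theory Num.Theory.
Import numFieldNormedType.Exports.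
Local Open Scope classical_set_scope.
Local Open Scope ring_scope.
Local Open Scope complex_scope.

(** * Scalars and norms *)

(** The objects of the statement (slices, legs, [act], [ad_dual], [coact_dec], [Tr]) are picked by
    [xget] from a specification, with a default when nothing satisfies it, so existence and
    uniqueness precede every computation. A slice lies in A because a faithful representation is
    isometric with closed range; this is derived from square roots in A, found by iteration, instead
    of spectral theory. The corepresentation identity of U is available only against operators for
    which Delta (x) iota has been produced as a norm limit; it is produced for the columns U (1 (x)
    |l><l0|), whose norm is controlled by a single element of A. Of |X| only the finite trace of its
    p-th power is known; a greedy choice of almost maximizing vectors takes the place of its
    eigenvectors. Identities in the dual algebra are checked on the functionals phi(u_ij .), where
    Sweedler sums become finite matrix sums, and extended by linearity. Faithfulness of the Haar
    state serves to recover a from the values of phi(a .) on [matA]. *)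

Section Scalars.
Variable R : realType.
Implicit Types (z w : R[i]) (x : R).

Definition cabs z : R := complex.Re `|z|.

Lemma conjE z : Num.conj z = conjc z. Proof. by []. Qed.

Lemma cabsE z : `|z| = (cabs z)%:C.
Proof. by rewrite RRe_real // normr_real. Qed.

Lemma ReD z w : complex.Re (z + w) = complex.Re z + complex.Re w.
Proof. by case: z; case: w. Qed.
Lemma ReN z : complex.Re (- z) = - complex.Re z.
Proof. by case: z. Qed.
Lemma ReC x : complex.Re x%:C = x. Proof. by []. Qed.
Lemma CD x y : (x + y)%:C = x%:C + y%:C :> R[i]. Proof. exact: rmorphD. Qed.
Lemma CM x y : (x * y)%:C = x%:C * y%:C :> R[i]. Proof. exact: rmorphM. Qed.
Lemma CX x n : (x ^+ n)%:C = x%:C ^+ n :> R[i]. Proof. exact: rmorphXn. Qed.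

Lemma cabs_ge0 z : 0 <= cabs z.
Proof. by have := normr_ge0 z; rewrite cabsE lecR. Qed.
Lemma cabsM z w : cabs (z * w) = cabs z * cabs w.
Proof. by apply: (@complexI R); rewrite CM -!cabsE normrM. Qed.
Lemma cabsD z w : cabs (z + w) <= cabs z + cabs w.
Proof. by rewrite -lecR CD -!cabsE ler_normD. Qed.
Lemma cabsN z : cabs (- z) = cabs z.
Proof. by rewrite /cabs normrN. Qed.
Lemma cabs0 : cabs 0 = 0. Proof. by rewrite /cabs normr0. Qed.
Lemma cabs1 : cabs 1 = 1. Proof. by rewrite /cabs normr1. Qed.
Lemma cabsJ z : cabs (Num.conj z) = cabs z.
Proof. by rewrite /cabs norm_conjC. Qed.
Lemma cabsC x : cabs x%:C = `|x|.
Proof. by rewrite /cabs normc_def /= expr0n /= addr0 sqrtr_sqr. Qed.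
Lemma cabs_ge0C x : 0 <= x -> cabs x%:C = x.
Proof. by move=> h; rewrite cabsC ger0_norm. Qed.
Lemma cabs_eq0 z : cabs z = 0 -> z = 0.
Proof. by move=> h; apply/eqP; rewrite -normr_eq0 cabsE h. Qed.
Lemma cabs_sqr z : (cabs z ^+ 2)%:C = z * Num.conj z.
Proof. by rewrite CX -cabsE normCK. Qed.
Lemma Re_le_cabs z : complex.Re z <= cabs z.
Proof. by rewrite -lecR -cabsE (le_trans _ (normc_ge_Re z)) // lecR ler_norm. Qed.
Lemma Re_cabs z : `|complex.Re z| <= cabs z.
Proof. by rewrite -lecR -cabsE normc_ge_Re. Qed.
Lemma Im_cabs z : `|complex.Im z| <= cabs z.
Proof.
have := Re_cabs ('i * z); rewrite cabsM.
have -> : cabs 'i = 1 by rewrite /cabs normc_def /= expr0n expr1n add0r sqrtr1.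
by rewrite mul1r mulrC ReiNIm normrN.
Qed.
Lemma cabs_ReIm z : cabs z <= `|complex.Re z| + `|complex.Im z|.
Proof.
rewrite {1}(complexE z) (le_trans (cabsD _ _)) // cabsM !cabsC.
have -> : cabs 'i = 1 by rewrite /cabs normc_def /= expr0n expr1n add0r sqrtr1.
by rewrite mul1r.
Qed.
Lemma posC (e : R[i]) : 0 < e -> exists2 d : R, 0 < d & e = d%:C.
Proof.
move=> e0; exists (complex.Re e); last by rewrite RRe_real // gtr0_real.
by rewrite -ltcR RRe_real // gtr0_real.
Qed.
Lemma conj_real (x : R) : Num.conj x%:C = x%:C :> R[i].
Proof. by rewrite conjE conjc_real. Qed.
Lemma conjM z w : Num.conj (z * w) = Num.conj z * Num.conj w.
Proof. exact: rmorphM. Qed.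
Lemma conjD z w : Num.conj (z + w) = Num.conj z + Num.conj w.
Proof. exact: rmorphD. Qed.
Lemma conjN z : Num.conj (- z) = - Num.conj z.
Proof. exact: rmorphN. Qed.
Lemma conj0 : Num.conj 0 = 0 :> R[i].
Proof. exact: rmorph0. Qed.
Lemma conjK z : Num.conj (Num.conj z) = z.
Proof. by case: z => a b; rewrite !conjE /= opprK. Qed.
Lemma ReJ z : complex.Re (Num.conj z) = complex.Re z.
Proof. by case: z. Qed.
Lemma ReCM x z : complex.Re (x%:C * z) = x * complex.Re z.
Proof. by case: z => a b /=; rewrite mul0r subr0. Qed.
End Scalars.

Section Norm.
Variables (R : realType).
Definition nr (V : normedModType R[i]) (x : V) : R := complex.Re `|x|.
Variable V : normedModType R[i].
Implicit Types x y : V.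

Lemma nrE x : `|x| = (nr x)%:C.
Proof. by rewrite RRe_real // normr_real. Qed.
Lemma nr_ge0 x : 0 <= nr x.
Proof. by have := normr_ge0 x; rewrite nrE lecR. Qed.
Lemma nrD x y : nr (x + y) <= nr x + nr y.
Proof. by rewrite -lecR CD -!nrE ler_normD. Qed.
Lemma nrN x : nr (- x) = nr x. Proof. by rewrite /nr normrN. Qed.
Lemma nrZ c x : nr (c *: x) = cabs c * nr x.
Proof. by apply: (@complexI R); rewrite CM -cabsE -!nrE normrZ. Qed.
Lemma nr0 : nr (0 : V) = 0. Proof. by rewrite /nr normr0. Qed.
Lemma nr_eq0 x : nr x = 0 -> x = 0.
Proof. by move=> h; apply/eqP; rewrite -normr_eq0 nrE h. Qed.
Lemma nrB x y : nr (x - y) = nr (y - x). Proof. by rewrite -nrN opprB. Qed.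
Lemma nr_le0 x : (forall e, 0 < e -> nr x <= e) -> x = 0.
Proof.
move=> h; apply: nr_eq0; apply/eqP; rewrite eq_le nr_ge0 andbT.
apply/ler_addgt0Pl => e e0; rewrite addr0; exact: h.
Qed.
End Norm.

Section Seqs.
Variables (R : realType) (V : normedModType R[i]).
Definition cvn (u : nat -> V) (l : V) :=
  forall e : R, 0 < e -> exists N, forall p, (N <= p)%N -> nr (u p - l) <= e.
Definition cauchyn (u : nat -> V) :=
  forall e : R, 0 < e -> exists N, forall p q, (N <= p)%N -> (N <= q)%N ->
    nr (u p - u q) <= e.

Lemma cvn_uniq u l l' : cvn u l -> cvn u l' -> l = l'.
Proof.
move=> h h'; apply/eqP; rewrite -subr_eq0; apply/eqP/nr_le0 => e e0.
have e2 : 0 < e / 2 by rewrite divr_gt0.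
have [N hN] := h _ e2; have [N' hN'] := h' _ e2.
have := hN (maxn N N') (leq_maxl _ _); have := hN' (maxn N N') (leq_maxr _ _).
set x := u _ => h1 h2; rewrite -(subrKA x) (le_trans (nrD _ _)) //.
rewrite nrB in h2; rewrite [leRHS](splitr e); exact: lerD.
Qed.
End Seqs.

Lemma complete_cvn (R : realType) (V : completeNormedModType R[i]) (u : nat -> V) :
  cauchyn u -> exists l, cvn u l.
Proof.
move=> hu; have : cauchy (u @ \oo).
  apply/cauchy_ballP => e /posC[d d0 ->].
  have d2 : 0 < d / 2 by rewrite divr_gt0.
  have [N hN] := hu _ d2.
  exists (u @` [set p | (N <= p)%N], u @` [set p | (N <= p)%N]) => /=.
    by split; exists N => // p /= hp; exists p.
  move=> [x y] /= [[p hp <-] [q hq <-]]; rewrite -ball_normE /ball_ /=.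
  by rewrite nrE ltcR (le_lt_trans (hN _ _ hp hq)) // ltr_pdivrMr // ltr_pMr // ltr1n.
move=> /cauchy_cvg hc; exists (lim (u @ \oo)) => e e0.
have eC : 0 < e%:C :> R[i] by rewrite ltcR.
have /cvgrPdist_le/(_ _ eC)[N _ hN] := hc.
by exists N => p hp; have := hN p hp; rewrite nrE lecR nrB.
Qed.

(** * Positive sesquilinear forms *)

Section Forms.
Variables (R : realType) (V : lmodType R[i]) (B : V -> V -> R[i]).
Hypothesis Bl : forall c x y z, B (c *: x + y) z = c * B x z + B y z.
Hypothesis Br : forall c x y z, B z (c *: x + y) = Num.conj c * B z x + B z y.
Hypothesis B_ge0 : forall x, 0 <= B x x.

Let ImB x : complex.Im (B x x) = 0. Proof. exact: ger0_Im. Qed.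

Let expand c x y : B (c *: x + y) (c *: x + y) =
  c * Num.conj c * B x x + c * B x y + Num.conj c * B y x + B y y.
Proof. by rewrite Bl !Br; ring. Qed.

(** A form with real diagonal is Hermitian: the imaginary parts of its values at [x + y] and
    ['i *: x + y] vanish, which gives two real linear relations between [B x y] and [B y x]. *)
Lemma form_conj x y : B y x = Num.conj (B x y).
Proof.
have h1 := ImB (1 *: x + y); have h2 := ImB ('i *: x + y).
move: h1 h2; rewrite !expand conjC1 mulr1 !mul1r.
have := ImB x; have := ImB y; rewrite conjE.
case: (B x x) => a b; case: (B y y) => c d; case: (B x y) => u v.
case: (B y x) => s t /= -> -> h1 h2.
by apply/eqP; rewrite eq_complex /=; apply/andP; split; apply/eqP; lra.
Qed.

(** Only semidefiniteness is assumed, so that the inequality also serves for positive operators and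
    for the Haar state. It is the discriminant argument at the vectors x - s B(x, y) y with s
    real. *)
Lemma form_CS x y : cabs (B x y) ^+ 2 <= complex.Re (B x x) * complex.Re (B y y).
Proof.
set b := cabs (B x y) ^+ 2; set a := complex.Re _; set d := complex.Re _.
have key s : 0 <= s ^+ 2 * (b * d) - 2 * s * b + a.
  have := B_ge0 ((- (s%:C * B x y)) *: y + x).
  rewrite expand (form_conj x y) -mulrA.
  have -> : (- (s%:C * B x y)) * Num.conj (B x y) = - (s * b)%:C.
    by rewrite mulNr -mulrA -cabs_sqr CM.
  have -> : Num.conj (- (s%:C * B x y)) = - (s%:C * Num.conj (B x y)).
    by rewrite conjN conjM conj_real.
  have -> : - (s%:C * Num.conj (B x y)) * B x y = - (s * b)%:C.
    by rewrite mulNr -mulrA [_ * B x y]mulrC -cabs_sqr CM.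
  have -> : - (s%:C * B x y) * (- (s%:C * Num.conj (B x y)) * B y y) =
     (s ^+ 2 * b)%:C * B y y.
    by rewrite CM CX cabs_sqr; ring.
  by rewrite lecE => /andP[_] /=; rewrite !ReD !ReN ReCM !ReC /a /d; lra.
have a0 : 0 <= a by have := B_ge0 x; rewrite lecE => /andP[].
have d0 : 0 <= d by have := B_ge0 y; rewrite lecE => /andP[].
have b0 : 0 <= b by rewrite exprn_ge0 // cabs_ge0.
(* For d = 0 the bound [key] is affine in s; unless b = 0 it takes the value -1 at s = (a + 1) / (2
   b). *)
have [d_0|dN] := eqVneq d 0.
  rewrite d_0 mulr0; have := key ((a + 1) / (2 * b)); rewrite d_0.
  have [->|bN] := eqVneq b 0; first by rewrite lexx.
  have -> : 2 * ((a + 1) / (2 * b)) * b = a + 1 by field.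
  lra.
have := key d^-1; have -> : d^-1 ^+ 2 * (b * d) - 2 * d^-1 * b + a = a - b / d.
  by field.
by rewrite subr_ge0 ler_pdivrMr // lt_def dN.
Qed.
End Forms.

Section Inner.
Variables (R : realType) (H : hilbertType R).
Implicit Types x y z : H.

Lemma innerDl x y z : [<x + y, z>] = [<x, z>] + [<y, z>].
Proof. by rewrite -{1}[x]scale1r inner_linear mul1r. Qed.
Lemma inner0l z : [<(0 : H), z>] = 0.
Proof. by have /eqP := innerDl 0 0 z; rewrite addr0 -subr_eq0 opprD addNKr oppr_eq0 => /eqP. Qed.
Lemma innerZl c x z : [<c *: x, z>] = c * [<x, z>].
Proof. by rewrite -[c *: x]addr0 inner_linear inner0l addr0. Qed.
Lemma innerNl x z : [<- x, z>] = - [<x, z>].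
Proof. by rewrite -scaleN1r innerZl mulN1r. Qed.
Lemma innerBl x y z : [<x - y, z>] = [<x, z>] - [<y, z>].
Proof. by rewrite innerDl innerNl. Qed.
Lemma innerDr x y z : [<z, x + y>] = [<z, x>] + [<z, y>].
Proof. by rewrite inner_conj innerDl conjD -!inner_conj. Qed.
Lemma innerZr c x z : [<z, c *: x>] = Num.conj c * [<z, x>].
Proof. by rewrite inner_conj innerZl conjM -!inner_conj. Qed.
Lemma inner0r z : [<z, (0 : H)>] = 0.
Proof. by rewrite inner_conj inner0l conj0. Qed.
Lemma innerNr x z : [<z, - x>] = - [<z, x>].
Proof. by rewrite inner_conj innerNl conjN -!inner_conj. Qed.
Lemma innerBr x y z : [<z, x - y>] = [<z, x>] - [<z, y>].
Proof. by rewrite innerDr innerNr. Qed.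
Lemma inner_suml (I : Type) (s : seq I) (P : pred I) (F : I -> H) z :
  [<\sum_(i <- s | P i) F i, z>] = \sum_(i <- s | P i) [<F i, z>].
Proof.
by apply: (big_morph (fun x => [<x, z>])) => [x y|]; rewrite ?innerDl ?inner0l.
Qed.
Lemma inner_sumr (I : Type) (s : seq I) (P : pred I) (F : I -> H) z :
  [<z, \sum_(i <- s | P i) F i>] = \sum_(i <- s | P i) [<z, F i>].
Proof.
by apply: (big_morph (fun x => [<z, x>])) => [x y|]; rewrite ?innerDr ?inner0r.
Qed.
Lemma inner_nr x : [<x, x>] = (nr x ^+ 2)%:C.
Proof. by rewrite inner_norm nrE CX. Qed.
Lemma inner_ge0 x : 0 <= [<x, x>].
Proof. by rewrite inner_nr lecR exprn_ge0 // nr_ge0. Qed.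
Lemma nr_sq x : nr x ^+ 2 = complex.Re [<x, x>].
Proof. by rewrite inner_nr. Qed.
Lemma inner_eq0 x : [<x, x>] = 0 -> x = 0.
Proof.
by rewrite inner_nr => -[] /eqP; rewrite expf_eq0 /= => /eqP/nr_eq0.
Qed.
Lemma inner_inj x y : (forall z, [<x, z>] = [<y, z>]) -> x = y.
Proof.
move=> h; apply/eqP; rewrite -subr_eq0; apply/eqP/inner_eq0.
by rewrite innerBl h subrr.
Qed.
Lemma inner_injr x y : (forall z, [<z, x>] = [<z, y>]) -> x = y.
Proof. by move=> h; apply: inner_inj => z; rewrite inner_conj h -inner_conj. Qed.

Lemma CS x y : cabs [<x, y>] <= nr x * nr y.
Proof.
rewrite -(@ler_pXn2r _ 2) ?nnegrE ?cabs_ge0 ?mulr_ge0 ?nr_ge0 //.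
rewrite exprMn !nr_sq; apply: (@form_CS _ _ (@inner R H)) => [||z].
- by move=> *; rewrite innerDl innerZl.
- by move=> *; rewrite innerDr innerZr.
- exact: inner_ge0.
Qed.

Lemma Re_innerC x y : complex.Re [<y, x>] = complex.Re [<x, y>].
Proof. by rewrite inner_conj ReJ. Qed.

Lemma nrD_sq x y : nr (x + y) ^+ 2 = nr x ^+ 2 + nr y ^+ 2 + 2 * complex.Re [<x, y>].
Proof. by rewrite !nr_sq innerDl !innerDr !ReD (Re_innerC x y); ring. Qed.
Lemma nrB_sq x y : nr (x - y) ^+ 2 = nr x ^+ 2 + nr y ^+ 2 - 2 * complex.Re [<x, y>].
Proof. by rewrite nrD_sq nrN innerNr ReN; ring. Qed.
Lemma pyth x y : [<x, y>] = 0 -> nr (x + y) ^+ 2 = nr x ^+ 2 + nr y ^+ 2.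
Proof. by rewrite nrD_sq => ->; rewrite mulr0 addr0. Qed.

Lemma nr_le_inner x M : 0 <= M -> (forall y, cabs [<x, y>] <= M * nr y) -> nr x <= M.
Proof.
move=> M0 /(_ x); rewrite inner_nr cabs_ge0C ?exprn_ge0 ?nr_ge0 //.
have [->|xN] := eqVneq (nr x) 0; first by rewrite mulr0 => _.
by rewrite expr2 ler_pM2r // lt_def xN nr_ge0.
Qed.
End Inner.

(** The arithmetic of the first variation in [riesz]: [I] is the infimum, [r] the defect of the
    minimizing sequence, [e] the total error. Products are generalized first so that the goal
    becomes linear. *)
Lemma quad_limit (R : realFieldType) (t n a b d f s r e I : R) :
  r <= e / 2 -> 2 * t * (b - a) <= e / 2 -> s - 2 * f < I + r ->
  I <= t ^+ 2 * n + s + 2 * (t * b) - 2 * (t * d + f) ->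
  0 <= e + (2 * t * (a - d) + t ^+ 2 * n).
Proof.
rewrite -!mulrA !mulrBr; move: (t ^+ 2 * n) (t * a) (t * b) (t * d) => u v w z.
lra.
Qed.

(** * Riesz representation and bounded operators *)

Section Riesz.
Variables (R : realType) (H : hilbertType R) (f : H -> R[i]) (M : R).
Hypothesis fl : forall c x y, f (c *: x + y) = c * f x + f y.
Hypothesis fM : forall x, cabs (f x) <= M * nr x.

Let J y : R := nr y ^+ 2 - 2 * complex.Re (f y).

Let f0 : f 0 = 0.
Proof. by have := fl (-1) 0 0; rewrite scaler0 addr0 mulN1r addNr. Qed.
Let fD x y : f (x + y) = f x + f y.
Proof. by have := fl 1 x y; rewrite scale1r mul1r. Qed.
Let fZ c x : f (c *: x) = c * f x.
Proof. by have := fl c x 0; rewrite addr0 f0 addr0. Qed.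

Let J_lb y : - M ^+ 2 <= J y.
Proof.
have := fM y; have := Re_le_cabs (f y); rewrite /J => h1 h2.
have : 0 <= (nr y - M) ^+ 2 by exact: sqr_ge0.
by rewrite sqrrB; nra.
Qed.

Let I := inf (range J).
Let hI : has_inf (range J).
Proof.
split; first by exists (J 0), 0.
by exists (- M ^+ 2) => _ [y _ <-].
Qed.
Let I_le y : I <= J y.
Proof. by apply: ge_inf; [case: hI | exists y]. Qed.

Let par x y : nr (x - y) ^+ 2 =
  2 * J x + 2 * J y - 4 * J ((2^-1)%:C *: (x + y)).
Proof.
rewrite /J nrZ cabsC normfV normr_nat fZ ReCM fD ReD exprMn nrB_sq nrD_sq.
field; rewrite ?pnatr_eq0 //.
Qed.

(** The representing vector minimizes [J y = |y|^2 - 2 Re (f y)]. The identity [par] makes a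
    minimizing sequence Cauchy, and the first variation at its limit identifies [f]. *)
Lemma riesz : exists y, forall x, f x = [<x, y>].
Proof.
have /choice[u hu] (n : nat) : exists y, J y < I + (n.+1%:R)^-1.
  have e0 : 0 < n.+1%:R^-1 :> R by rewrite invr_gt0.
  have [_ [y _ <-] hy] := inf_adherent e0 hI.
  by exists y.
have small (e : R) : 0 < e -> exists N, forall p, (N <= p)%N -> (p.+1%:R)^-1 <= e.
  move=> e0; exists (Num.truncn e^-1) => p hp.
  rewrite -[e]invrK lef_pV2 ?posrE ?invr_gt0 //.
  have h := truncnS_gt e^-1; apply/ltW/(lt_le_trans h).
  by rewrite ler_nat.
have cu : cauchyn u.
  move=> e e0; have [|N hN] := small (e ^+ 2 / 4); first by rewrite divr_gt0 ?exprn_gt0.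
  exists N => p q hp hq; rewrite -(@ler_pXn2r _ 2) ?nnegrE ?nr_ge0 ?(ltW e0) //.
  rewrite par; have := I_le ((2^-1)%:C *: (u p + u q)).
  have := hu p; have := hu q; have := hN p hp; have := hN q hq.
  move: (q.+1%:R^-1) (p.+1%:R^-1) (J _) (J _) (J _) => a b c d f2.
  lra.
have [y hy] := complete_cvn cu; exists y.
(* First variation: [J] at [t x + u p] is at least the infimum, and [u p] tends to [y]. *)
have key (t : R) x : 0 <= 2 * t * (complex.Re [<y, x>] - complex.Re (f x)) + t ^+ 2 * nr x ^+ 2.
  apply/ler_addgt0Pl => e e0.
  pose K := 2 * `|t| * nr x + 1; have K0 : 0 < K.
    by rewrite ltr_wpDl // !mulr_ge0 // nr_ge0.
  have [|N1 h1] := small (e / 2); first by rewrite divr_gt0.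
  have [|N2 h2] := hy (e / (2 * K)); first by rewrite divr_gt0 // mulr_gt0.
  pose p := maxn N1 N2.
  have {}h1 := h1 p (leq_maxl _ _); have {}h2 := h2 p (leq_maxr _ _).
  have := I_le (t%:C *: x + u p); have := hu p.
  rewrite /J nrD_sq fD fZ ReD nrZ innerZl ReCM cabsC exprMn real_normK ?num_real //.
  rewrite ReCM Re_innerC => h3 h4.
  have h5 : `|complex.Re [<u p, x>] - complex.Re [<y, x>]| <= nr (u p - y) * nr x.
    by rewrite -ReN -ReD -innerBl (le_trans (Re_cabs _)) // CS.
  have h6 : 2 * `|t| * (nr (u p - y) * nr x) <= e / 2.
    have -> : 2 * `|t| * (nr (u p - y) * nr x) = (2 * `|t| * nr x) * nr (u p - y).
      by rewrite [nr _ * nr x]mulrC mulrA.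
    have -> : e / 2 = K * (e / (2 * K)) by field; rewrite gt_eqF.
    by apply: ler_pM; rewrite ?mulr_ge0 ?nr_ge0 // lerDl.
  have h7 : 2 * t * (complex.Re [<u p, x>] - complex.Re [<y, x>]) <= e / 2.
    rewrite (le_trans _ h6) // (le_trans (ler_norm _)) // !normrM normr_nat.
    by rewrite -!mulrA ler_wpM2l // ler_wpM2l.
  exact: (quad_limit h1 h7 h3 h4).
have keyr x : complex.Re (f x) = complex.Re [<x, y>].
  rewrite Re_innerC.
  set g := complex.Re [<y, x>]; set h := complex.Re _.
  pose n2 := nr x ^+ 2; have n20 : 0 <= n2 by rewrite exprn_ge0 ?nr_ge0.
  (* The optimal t would be [- (g - h) / n2]; adding 1 avoids a division by zero and still leaves a
     negative multiple of [(g - h) ^+ 2]. *)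
  have := key (- (g - h) / (n2 + 1)) x; rewrite -/g -/h -/n2.
  have n1 : 0 < n2 + 1 by rewrite ltr_wpDl.
  have -> : 2 * (- (g - h) / (n2 + 1)) * (g - h) + (- (g - h) / (n2 + 1)) ^+ 2 * n2 =
    - (((g - h) / (n2 + 1)) ^+ 2 * (n2 + 2)) by field; rewrite gt_eqF.
  rewrite oppr_ge0 => hle.
  have : ((g - h) / (n2 + 1)) ^+ 2 * (n2 + 2) == 0.
    by rewrite eq_le hle /= mulr_ge0 ?sqr_ge0 ?addr_ge0.
  rewrite mulf_eq0 expf_eq0 /= mulf_eq0 invr_eq0 (gt_eqF n1) orbF.
  rewrite (gt_eqF (_ : 0 < n2 + 2)) ?ltr_wpDl // orbF subr_eq0 => /eqP ->//.
move=> x; apply/eqP; rewrite eq_complex keyr eqxx /=.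
have := keyr ('i *: x); rewrite fZ innerZl (mulrC _ (f x)) (mulrC _ [<x, y>]) !ReiNIm => /oppr_inj ->.
exact: eqxx.
Qed.
End Riesz.

Section Bounded.
Variables (R : realType).
Implicit Types (H K L : hilbertType R).

Definition bdd H K (f : H -> K) (M : R) := 0 <= M /\ forall x, nr (f x) <= M * nr x.

(** The source of adjoints and of slice operators: each is first written as a bounded sesquilinear
    form. As [riesz] wants a linear functional, it is applied to the conjugate in the second
    variable. *)
Lemma form_op H K (B : H -> K -> R[i]) (M : R) : 0 <= M ->
  (forall c x y z, B (c *: x + y) z = c * B x z + B y z) ->
  (forall c x y z, B z (c *: x + y) = Num.conj c * B z x + B z y) ->
  (forall x y, cabs (B x y) <= M * nr x * nr y) ->
  exists T : H -> K, [/\ linear T, bdd T M & forall x y, [<T x, y>] = B x y].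
Proof.
move=> M0 Bl Br BM.
have /choice[T hT] (x : H) : exists z : K, forall y, B x y = [<z, y>].
  have [||z hz] := @riesz R K (fun y => Num.conj (B x y)) (M * nr x).
  - by move=> c y z; rewrite Br conjD conjM conjK.
  - by move=> y; rewrite cabsJ BM.
  by exists z => y; rewrite -[B x y]conjK hz -inner_conj.
exists T; split => //.
- by move=> c x y; apply: inner_inj => z; rewrite innerDl innerZl -!hT Bl.
- split=> // x; apply: nr_le_inner; first by rewrite mulr_ge0 ?nr_ge0.
  by move=> y; rewrite -hT BM.
Qed.

Lemma bounded_opP H (T : H -> H) :
  bounded_op T <-> linear T /\ exists M, bdd T M.
Proof.
split=> -[Tl [M hM]]; split => //.
  exists (cabs M); split=> [|x]; first exact: cabs_ge0.
  rewrite -lecR CM -!nrE (le_trans (hM x)) // -cabsE.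
  (* The constant [M] is complex; at any nonzero x the inequality [0 <= M * |x|] forces it to be
     real and nonnegative. *)
  have := le_trans (normr_ge0 _) (hM x).
  have [->|xN] := eqVneq `|x| 0; first by rewrite !mulr0.
  have x0 : 0 < `|x| by rewrite lt_def xN normr_ge0.
  by rewrite pmulr_lge0 // => M0; rewrite (ger0_norm M0).
case: hM => M0 hM; exists M%:C => x.
by rewrite !nrE -CM lecR.
Qed.

Lemma bdd_le H K (f : H -> K) M N : M <= N -> bdd f M -> bdd f N.
Proof.
move=> MN [M0 h]; split; first exact: le_trans MN.
by move=> x; rewrite (le_trans (h x)) // ler_wpM2r // nr_ge0.
Qed.
Lemma bddD H K (f g : H -> K) M N : bdd f M -> bdd g N ->
  bdd (fun x => f x + g x) (M + N).
Proof.
move=> [M0 h] [N0 k]; split=> [|x]; first exact: addr_ge0.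
by rewrite mulrDl (le_trans (nrD _ _)) // lerD.
Qed.
Lemma bddZ H K (f : H -> K) M c : bdd f M -> bdd (fun x => c *: f x) (cabs c * M).
Proof.
move=> [M0 h]; split=> [|x]; first by rewrite mulr_ge0 ?cabs_ge0.
by rewrite nrZ -mulrA ler_wpM2l ?cabs_ge0.
Qed.
Lemma bdd_comp H K L (f : K -> L) (g : H -> K) M N : bdd f M -> bdd g N ->
  bdd (f \o g) (M * N).
Proof.
move=> [M0 h] [N0 k]; split=> [|x]; first exact: mulr_ge0.
by rewrite /= (le_trans (h _)) // -mulrA ler_wpM2l.
Qed.

End Bounded.

Section Lin.
Variables (R : realType) (V W : lmodType R[i]) (f : V -> W).
Hypothesis fl : linear f.
Lemma lin0 : f 0 = 0.
Proof. by have := fl (-1) 0 0; rewrite scaler0 addr0 scaleN1r addNr. Qed.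
Lemma linD x y : f (x + y) = f x + f y.
Proof. by have := fl 1 x y; rewrite !scale1r. Qed.
Lemma linZ c x : f (c *: x) = c *: f x.
Proof. by have := fl c x 0; rewrite !addr0 lin0 addr0. Qed.
Lemma linN x : f (- x) = - f x.
Proof. by rewrite -scaleN1r linZ scaleN1r. Qed.
Lemma linB x y : f (x - y) = f x - f y.
Proof. by rewrite linD linN. Qed.
Lemma lin_sum (I : Type) (s : seq I) (P : pred I) (F : I -> V) :
  f (\sum_(i <- s | P i) F i) = \sum_(i <- s | P i) f (F i).
Proof. by apply: (big_morph f) => [x y|]; rewrite ?linD ?lin0. Qed.
End Lin.

(** * The algebra of bounded operators *)

Section Bop.
Variables (R : realType) (H : hilbertType R).

(** Bundling makes operators a ring and a module over the scalars, so that later computations are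
    ring identities. The zero space is allowed, hence only a possibly trivial ring. *)
Record bop := Bop { bfun :> H -> H ; bop_bounded : bounded_op bfun }.

Lemma bopP (f g : bop) : (forall x, f x = g x) -> f = g.
Proof.
case: f g => f hf [g hg] /= /funext fg; subst g; congr Bop; exact: Prop_irrelevance.
Qed.
HB.instance Definition _ := gen_eqMixin bop.
HB.instance Definition _ := gen_choiceMixin bop.

Lemma blinear (f : bop) : linear f. Proof. by case: f => f []. Qed.
Lemma bbdd (f : bop) : exists M, bdd f M.
Proof. by case: f => f hf; have [_] := (bounded_opP f).1 hf. Qed.

Lemma b0_subproof : bounded_op (fun _ : H => 0 : H).
Proof.
apply/bounded_opP; split=> [c x y|]; first by rewrite scaler0 addr0.
by exists 0; split => // x; rewrite nr0 mul0r.
Qed.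
Lemma b1_subproof : bounded_op (idfun : H -> H).
Proof.
apply/bounded_opP; split=> // ; exists 1; split=> // x; by rewrite mul1r.
Qed.
Lemma bD_subproof (f g : bop) : bounded_op (fun x => f x + g x).
Proof.
apply/bounded_opP; split=> [c x y|].
  by rewrite !blinear scalerDr addrACA.
have [M hM] := bbdd f; have [N hN] := bbdd g; exists (M + N); exact: bddD.
Qed.
Lemma bZ_subproof c (f : bop) : bounded_op (fun x => c *: f x).
Proof.
apply/bounded_opP; split=> [d x y|].
  by rewrite blinear scalerDr !scalerA mulrC.
have [M hM] := bbdd f; exists (cabs c * M); exact: bddZ.
Qed.
Lemma bM_subproof (f g : bop) : bounded_op (f \o g).
Proof.
apply/bounded_opP; split=> [c x y|]; first by rewrite /= !blinear.
have [M hM] := bbdd f; have [N hN] := bbdd g; exists (M * N); exact: bdd_comp.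
Qed.
Definition bD f g := Bop (bD_subproof f g).
Definition bZ c f := Bop (bZ_subproof c f).

Lemma bD_A : associative bD.
Proof. by move=> f g h; apply: bopP => x /=; rewrite addrA. Qed.
Lemma bD_C : commutative bD.
Proof. by move=> f g; apply: bopP => x /=; rewrite addrC. Qed.
Lemma bD_0 : left_id (Bop b0_subproof) bD.
Proof. by move=> f; apply: bopP => x /=; rewrite add0r. Qed.
Lemma bD_N : left_inverse (Bop b0_subproof) (bZ (-1)) bD.
Proof. by move=> f; apply: bopP => x /=; rewrite scaleN1r addNr. Qed.
HB.instance Definition _ := GRing.isZmodule.Build bop bD_A bD_C bD_0 bD_N.

Definition bM f g := Bop (bM_subproof f g).
Lemma bM_A : associative bM. Proof. by move=> f g h; apply: bopP. Qed.
Lemma bM_1l : left_id (Bop b1_subproof) bM. Proof. by move=> f; apply: bopP. Qed.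
Lemma bM_1r : right_id (Bop b1_subproof) bM. Proof. by move=> f; apply: bopP. Qed.
Lemma bM_Dl : left_distributive bM +%R. Proof. by move=> f g h; apply: bopP. Qed.
Lemma bM_Dr : right_distributive bM +%R.
Proof. by move=> f g h; apply: bopP => x /=; rewrite (linD (blinear f)). Qed.
HB.instance Definition _ :=
  GRing.Zmodule_isPzRing.Build bop bM_A bM_1l bM_1r bM_Dl bM_Dr.

Lemma bZ_A a b f : bZ a (bZ b f) = bZ (a * b) f.
Proof. by apply: bopP => x /=; rewrite scalerA. Qed.
Lemma bZ_1 : left_id 1 bZ.
Proof. by move=> f; apply: bopP => x /=; rewrite scale1r. Qed.
Lemma bZ_Dr : right_distributive bZ +%R.
Proof. by move=> a f g; apply: bopP => x /=; rewrite scalerDr. Qed.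
Lemma bZ_Dl v : {morph bZ^~ v : a b / a + b}.
Proof. by move=> a b; apply: bopP => x /=; rewrite scalerDl. Qed.
HB.instance Definition _ :=
  GRing.Zmodule_isLmodule.Build R[i] bop bZ_A bZ_1 bZ_Dr bZ_Dl.

Implicit Types f g : bop.
Lemma b0E x : (0 : bop) x = 0. Proof. by []. Qed.
Lemma b1E x : (1 : bop) x = x. Proof. by []. Qed.
Lemma bDE f g x : (f + g) x = f x + g x. Proof. by []. Qed.
Lemma bNE f x : (- f) x = - f x. Proof. exact: scaleN1r. Qed.
Lemma bBE f g x : (f - g) x = f x - g x. Proof. by rewrite bDE bNE. Qed.
Lemma bME f g x : (f * g) x = f (g x). Proof. by []. Qed.
Lemma bZE c f x : (c *: f) x = c *: f x. Proof. by []. Qed.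
Lemma bsumE (I : Type) (s : seq I) (P : pred I) (F : I -> bop) x :
  (\sum_(i <- s | P i) F i) x = \sum_(i <- s | P i) F i x.
Proof. by apply: (big_morph (fun f : bop => f x)). Qed.
Lemma bsum_fun (I : Type) (s : seq I) (P : pred I) (F : I -> bop) :
  bfun (\sum_(i <- s | P i) F i) = \sum_(i <- s | P i) bfun (F i).
Proof. by apply: (big_morph bfun). Qed.
Lemma bAl c f g : c *: (f * g) = (c *: f) * g. Proof. exact: bopP. Qed.
Lemma bAr c f g : c *: (f * g) = f * (c *: g).
Proof. by apply: bopP => x; rewrite bZE !bME bZE (linZ (blinear f)). Qed.

Lemma adj_ex f : exists g : bop, forall x y, [<f x, y>] = [<x, g y>].
Proof.
have [M [M0 hM]] := bbdd f.
have [|||T [Tl Tb hT]] := @form_op R H H (fun y x => [<y, f x>]) M M0.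
- by move=> c x y z; rewrite innerDl innerZl.
- by move=> c x y z; rewrite blinear innerDr innerZr.
- move=> x y; rewrite (le_trans (CS _ _)) // [leRHS]mulrAC [leLHS]mulrC ler_wpM2r ?nr_ge0 //.
have Tb' : bounded_op T by apply/bounded_opP; split => //; exists M.
by exists (Bop Tb') => x y /=; rewrite [RHS]inner_conj hT -inner_conj.
Qed.
Definition adj f : bop := projT1 (cid (adj_ex f)).
Lemma adjP f x y : [<f x, y>] = [<x, adj f y>].
Proof. by rewrite /adj; case: cid. Qed.
Lemma adjP' f x y : [<adj f x, y>] = [<x, f y>].
Proof. by rewrite inner_conj -adjP -inner_conj. Qed.
Lemma adj_uniq f g : (forall x y, [<f x, y>] = [<x, g y>]) -> adj f = g.
Proof. by move=> h; apply: bopP => x; apply: inner_injr => z; rewrite -adjP h. Qed.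
Lemma adj1 : adj 1 = 1. Proof. exact: adj_uniq. Qed.
Lemma bop_eqP f g : (forall x y, [<f x, y>] = [<g x, y>]) -> f = g.
Proof. by move=> h; apply: bopP => x; apply: inner_inj. Qed.
Lemma bdd_adj f M : bdd f M -> bdd (adj f) M.
Proof.
move=> [M0 h]; split=> // x; apply: nr_le_inner; first by rewrite mulr_ge0 ?nr_ge0.
move=> y; rewrite adjP' (le_trans (CS _ _)) // [leRHS]mulrAC [leLHS]mulrC ler_wpM2r ?nr_ge0 //.
Qed.
Lemma bddbD f g M N : bdd f M -> bdd g N -> bdd (f + g) (M + N).
Proof. exact: bddD. Qed.
Lemma bddbM f g M N : bdd f M -> bdd g N -> bdd (f * g) (M * N).
Proof. exact: bdd_comp. Qed.
Lemma bddN f M : bdd f M -> bdd (- f) M.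
Proof. by move=> [M0 h]; split=> // x; rewrite bNE nrN. Qed.

Lemma rank1_subproof (x y : H) : bounded_op (fun v : H => [<v, y>] *: x).
Proof.
apply/bounded_opP; split=> [c u v|]; first by rewrite innerDl innerZl scalerDl scalerA.
exists (nr x * nr y); split=> [|v]; first by rewrite mulr_ge0 ?nr_ge0.
by rewrite nrZ mulrC -mulrA ler_wpM2l ?nr_ge0 // mulrC CS.
Qed.
Definition rank1 x y : bop := Bop (rank1_subproof x y).
Lemma rank1E x y v : rank1 x y v = [<v, y>] *: x. Proof. by []. Qed.
Lemma rank1Ml f x y : f * rank1 x y = rank1 (f x) y.
Proof. by apply: bopP => v; rewrite bME !rank1E (linZ (blinear f)). Qed.
Lemma rank1Mr f x y : rank1 x y * f = rank1 x (adj f y).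
Proof. by apply: bopP => v; rewrite bME !rank1E adjP. Qed.
End Bop.
Arguments Bop {R H} bfun bop_bounded.

(** Choice with memory: each term may depend on all the previous ones. Gram-Schmidt and the greedy
    selection of vectors are instances. *)
Lemma seq_choice (T : Type) (P : seq T -> T -> Prop) :
  (forall s, exists x, P s x) -> exists u : nat -> T, forall n, P (mkseq u n) (u n).
Proof.
move=> /choice[g hg].
pose l := fix l n := if n is m.+1 then rcons (l m) (g (l m)) else [::].
exists (fun n => g (l n)) => n.
suff -> : mkseq (fun n => g (l n)) n = l n by [].
by elim: n => [|n IH] //; rewrite mkseqS IH.
Qed.

(** * Orthonormal bases *)

Section Ortho.
Variables (R : realType) (H : hilbertType R) (I : eqType).
Implicit Types (u : I -> H) (s : seq I).

(* Zero vectors are allowed, so that Gram-Schmidt needs no case distinction. *)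
Definition ons (P : pred I) u :=
  (forall i j, P i -> P j -> i != j -> [<u i, u j>] = 0) /\
  (forall i, P i -> u i = 0 \/ nr (u i) = 1).

Lemma ons_sub (P : pred I) u s : (forall i, i \in s -> P i) -> ons P u -> ons (mem s) u.
Proof.
move=> h [h1 h2]; split=> [i j si sj|i si]; last exact: (h2 _ (h _ si)).
exact: (h1 _ _ (h _ si) (h _ sj)).
Qed.

Definition proj u s x := \sum_(i <- s) [<x, u i>] *: u i.

Lemma ons_self (P : pred I) u i x : ons P u -> P i -> [<x, u i>] * [<u i, u i>] = [<x, u i>].
Proof.
move=> [_ h] /h[->|]; first by rewrite !inner0r mulr0.
by rewrite inner_nr => ->; rewrite expr1n mulr1.
Qed.

Variables (u : I -> H) (s : seq I).
Hypotheses (us : uniq s) (hu : ons (mem s) u).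

Lemma inner_proj x i : i \in s -> [<proj u s x, u i>] = [<x, u i>].
Proof.
move=> si; rewrite inner_suml (bigD1_seq i) //= innerZl (ons_self _ hu) // big_seq_cond.
rewrite big1 ?addr0 // => j /andP[sj ji].
by rewrite innerZl hu.1 ?mulr0.
Qed.
Lemma proj_perp x i : i \in s -> [<x - proj u s x, u i>] = 0.
Proof. by move=> si; rewrite innerBl inner_proj // subrr. Qed.
Lemma proj_perp' x y : (forall i, i \in s -> [<x, u i>] = 0) -> [<x, proj u s y>] = 0.
Proof.
move=> h; rewrite inner_sumr big_seq big1 // => i si.
by rewrite innerZr h ?mulr0.
Qed.
Lemma nr_proj x : nr (proj u s x) ^+ 2 = \sum_(i <- s) cabs [<x, u i>] ^+ 2.
Proof.
apply: (@complexI R); rewrite -inner_nr {2}/proj inner_sumr rmorph_sum /=.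
rewrite big_seq [RHS]big_seq; apply: eq_bigr => i si.
by rewrite innerZr inner_proj // cabs_sqr mulrC.
Qed.
Lemma bessel_eq x :
  nr x ^+ 2 = nr (x - proj u s x) ^+ 2 + \sum_(i <- s) cabs [<x, u i>] ^+ 2.
Proof.
rewrite -nr_proj -pyth ?subrK //; apply: proj_perp' => i; exact: proj_perp.
Qed.
Lemma bessel x : \sum_(i <- s) cabs [<x, u i>] ^+ 2 <= nr x ^+ 2.
Proof. by rewrite (bessel_eq x) lerDr sqr_ge0. Qed.
Lemma nr_proj_le x : nr (x - proj u s x) <= nr x.
Proof.
rewrite -(@ler_pXn2r _ 2) ?nnegrE ?nr_ge0 // (bessel_eq x) lerDl sumr_ge0 // => i _.
exact: sqr_ge0.
Qed.
End Ortho.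

Section GramSchmidt.
Variables (R : realType) (H : hilbertType R).

Definition unitv (x : H) : H := ((nr x)^-1)%:C *: x.

Lemma unitv01 x : unitv x = 0 \/ nr (unitv x) = 1.
Proof.
have [x0|xN] := eqVneq (nr x) 0; [left|right].
  by rewrite /unitv (nr_eq0 x0) scaler0.
by rewrite nrZ cabs_ge0C ?invr_ge0 ?nr_ge0 // mulVf.
Qed.
Lemma unitvK x : x = [<x, unitv x>] *: unitv x.
Proof.
have [x0|xN] := eqVneq (nr x) 0; first by rewrite /unitv (nr_eq0 x0) !scaler0.
rewrite innerZr conj_real inner_nr scalerA -!CM.
by have -> : (nr x)^-1 * nr x ^+ 2 / nr x = 1; [field | rewrite scale1r].
Qed.

Lemma mkseq_ons (u : nat -> H) (P : pred nat) :
  (forall n x, P n -> x \in mkseq u n -> [<u n, x>] = 0) ->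
  (forall n, P n -> u n = 0 \/ nr (u n) = 1) -> ons P u.
Proof.
move=> h h1; split=> // i j Pi Pj; wlog ij : i j Pi Pj / (j < i)%N.
  move=> hw; rewrite neq_ltn => /orP[ij|ji].
    by rewrite inner_conj hw ?gtn_eqF // conj0.
  by rewrite hw ?gtn_eqF.
by move=> _; apply: h => //; apply/mapP; exists j => //; rewrite mem_iota.
Qed.

(** Zero vectors stay in the sequence, so that no re-indexing is needed and [v n] already lies in
    the span of the vectors up to [u n]. *)
Lemma gram_schmidt (v : nat -> H) : exists u : nat -> H, ons predT u /\
  (forall n N, (n < N)%N -> v n = proj u (iota 0 N) (v n)).
Proof.
have [s|u hu] := @seq_choice H (fun s x =>
    x = unitv (v (size s) - \sum_(y <- s) [<v (size s), y>] *: y)).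
  by eexists.
have {}hu n : u n = unitv (v n - proj u (iota 0 n) (v n)).
  by rewrite {1}hu size_mkseq big_map.
have ho n : ons (fun i => i < n)%N u.
  elim: n => [|n IH]; first by split.
  have hn i : (i < n)%N -> [<u n, u i>] = 0.
    move=> ni; rewrite hu innerZl (@proj_perp _ _ _ u (iota 0 n)) ?iota_uniq ?mem_iota //.
      by rewrite mulr0.
    by apply: ons_sub IH => j; rewrite mem_iota.
  split=> [i j|i _]; last by rewrite hu; exact: unitv01.
  rewrite !ltnS [(i <= n)%N]leq_eqVlt [(j <= n)%N]leq_eqVlt => /orP[/eqP->|ni] /orP[/eqP->|nj].
  - by rewrite eqxx.
  - by move=> _; apply: hn.
  - by move=> _; rewrite inner_conj hn // conj0.
  - exact: IH.1.
have ho' : ons predT u.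
  split=> [i j _ _|i _]; last exact: (ho i.+1).2.
  by apply: (ho (maxn i j).+1).1; rewrite ltnS leq_max leqnn ?orbT.
exists u; split=> // n N nN.
have key : v n = proj u (iota 0 n.+1) (v n).
  have hs : proj u (iota 0 n.+1) (v n) = proj u (iota 0 n) (v n) + [<v n, u n>] *: u n.
    by rewrite /proj -addn1 iotaD big_cat big_seq1.
  rewrite hs.

  apply/eqP; rewrite addrC -subr_eq; apply/eqP.
  rewrite {1}[LHS]unitvK -hu innerBl [X in _ - X]inner_conj.
  rewrite (@proj_perp' _ _ _ u (iota 0 n)) ?conj0 ?subr0 // => i.
  by rewrite mem_iota /= add0n => ni; apply: ho'.1 => //; rewrite gtn_eqF.
(* The indices from n + 1 to N - 1 contribute nothing: [v n] is a combination of the earlier [u j],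
   to which the later ones are orthogonal. *)
rewrite {1}key /proj -(subnKC nN) iotaD big_cat /= [X in _ = _ + X]big_seq.
rewrite [X in _ = _ + X]big1 ?addr0 // => i; rewrite mem_iota add0n => /andP[ni _].
rewrite key inner_conj proj_perp' ?conj0 ?scale0r // => j.
by rewrite mem_iota /= add0n => jn; apply: ho'.1; rewrite ?gtn_eqF // (leq_trans jn).
Qed.

End GramSchmidt.

Section Basis.
Variables (R : realType) (H : hilbertType R).
Implicit Types (E : set H) (s t : seq H).

Definition orthonormal E := forall x y, E x -> E y -> [<x, y>] = (x == y)%:R.

Lemma orthonormal_ons E s : orthonormal E -> {in s, forall x, E x} -> ons (mem s) id.
Proof.
move=> hE sE; split=> [x y xs ys /negPf xy|x xs].
  by rewrite /= (hE _ _ (sE _ xs) (sE _ ys)) xy.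

right; have := hE _ _ (sE _ xs) (sE _ xs); rewrite inner_nr eqxx => -[/eqP].
by rewrite sqrp_eq1 ?nr_ge0 // => /eqP.
Qed.

(** Zorn's lemma on the sets that may be added to [E]. The extension form matters beyond existence:
    a trace can then be evaluated in a basis containing prescribed vectors. *)
Lemma basis_extend E : orthonormal E ->
  exists E', E `<=` E' /\ orthonormal_basis E'.
Proof.
move=> hE.
have [F FP tF|A [PA mA]] := @Zorn_bigcup H (fun X => orthonormal (E `|` X)).
  move=> x y [Ex|[X FX Xx]] [Ey|[Y FY Yy]].
  - exact: hE.
  - by apply: (FP _ FY); [left|right].
  - by apply: (FP _ FX); [right|left].
  - by have [XY|YX] := tF _ _ FX FY; [apply: (FP _ FY)|apply: (FP _ FX)]; right;
      try exact: XY; try exact: YX.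
exists (E `|` A); split; first by move=> x; left.
split=> // x hx; apply: contrapT => /eqP xN.
have xn : nr x != 0 by apply: contra_neq xN => /nr_eq0.
pose y := unitv x; have y1 : nr y = 1.
  by case: (unitv01 x) => // h; move: xN; rewrite (unitvK x) h scaler0 eqxx.
have hy e : (E `|` A) e -> [<y, e>] = 0 by move=> he; rewrite innerZl hx ?mulr0.
have yA : ~ A y.
  move=> Ay; have := hy _ (or_intror Ay); rewrite inner_nr y1 expr1n => -[] /eqP.
  by rewrite oner_eq0.
apply: (mA (A `|` [set y])).
  split; first by move=> a Aa; left.
  by move=> h; apply/yA/h; right.
have yy : [<y, y>] = 1 by rewrite inner_nr y1 expr1n.
move=> a b; rewrite setUA.
have sym e : (E `|` A) e -> (y == e) = false.
  move=> he; apply/eqP => ye; have := hy e he; rewrite -ye yy => /eqP.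
  by rewrite oner_eq0.
move=> [ha|->] [hb|->]; first exact: PA.
- by rewrite inner_conj hy // conj0 eq_sym sym.
- by rewrite hy // sym.
- by rewrite yy eqxx.
Qed.

Lemma basis_exists : exists E, @orthonormal_basis R H E.
Proof. by have [|E [_ hE]] := @basis_extend set0; last by exists E. Qed.

(** The basis may be uncountable. The squared defect [r s] decreases along finite subsets; a
    sequence of subsets approaching its infimum has convergent remainders, whose limit is orthogonal
    to every basis vector and hence zero. *)
Lemma parseval E x : orthonormal_basis E -> forall e : R, 0 < e ->
  exists s, [/\ uniq s, {in s, forall y, E y} & forall t, uniq t ->
    {subset s <= t} -> {in t, forall y, E y} -> nr (x - proj id t x) <= e].
Proof.
move=> [hE mE]; pose ok s := uniq s /\ {in s, forall y, E y}.
pose r s := nr (x - proj id s x) ^+ 2.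
have mono s t : ok s -> ok t -> {subset s <= t} ->
    nr (proj id t x - proj id s x) ^+ 2 = r s - r t.
  move=> [us sE] [ut tE] st.
  have -> : r s = r t + nr (proj id t x - proj id s x) ^+ 2; last by rewrite [RHS]addrC addKr.
  rewrite -pyth ?addrA ?subrK // innerBr !proj_perp' ?subr0 //.
    by move=> i /st ti; apply: proj_perp => //; apply: orthonormal_ons tE.
  by move=> i ti; apply: proj_perp => //; apply: orthonormal_ons tE.
pose S := [set r s | s in ok].
have S0 : S (r [::]) by exists [::].
have hS : has_inf S by split; [exists (r [::]) | exists 0 => _ [s _ <-]; exact: sqr_ge0].
have inf_le s : ok s -> inf S <= r s.
  by move=> oks; apply: ge_inf; [case: hS | exists s].
have /choice[v hv] (n : nat) : exists s, ok s /\ r s < inf S + n.+1%:R^-1.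
  have e0 : 0 < n.+1%:R^-1 :> R by rewrite invr_gt0.
  by have [_ [s oks <-] hs] := inf_adherent e0 hS; exists s.
have small (e : R) : 0 < e -> exists N, forall p, (N <= p)%N -> (p.+1%:R)^-1 <= e.
  move=> e0; exists (Num.truncn e^-1) => p hp.
  rewrite -[e]invrK lef_pV2 ?posrE ?invr_gt0 //.
  have h := truncnS_gt e^-1; apply/ltW/(lt_le_trans h).
  by rewrite ler_nat.
have close n t : ok t -> {subset v n <= t} ->
    nr (proj id t x - proj id (v n) x) ^+ 2 <= n.+1%:R^-1.
  move=> okt vt; have [okv vlt] := hv n; rewrite mono //.
  by rewrite lerBlDl (le_trans (ltW vlt)) // lerD2r inf_le.
have close' n t e : 0 < e -> n.+1%:R^-1 <= e ^+ 2 -> ok t -> {subset v n <= t} ->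
    nr (proj id t x - proj id (v n) x) <= e.
  move=> e0 ne okt vt; rewrite -(@ler_pXn2r _ 2) ?nnegrE ?nr_ge0 ?(ltW e0) //.
  by apply: le_trans ne; exact: close.
pose w n := x - proj id (v n) x.
have union s t : ok s -> ok t -> exists z, [/\ ok z, {subset s <= z} & {subset t <= z}].
  move=> [us sE] [ut tE]; exists (undup (s ++ t)); split.
  - split; first exact: undup_uniq.
    by move=> y; rewrite mem_undup mem_cat => /orP[/sE|/tE].
  - by move=> y ys; rewrite mem_undup mem_cat ys.
  - by move=> y ys; rewrite mem_undup mem_cat ys orbT.
have cw : cauchyn w.
  move=> e e0; have [|N hN] := small ((e / 2) ^+ 2); first by rewrite exprn_gt0 // divr_gt0.
  exists N => p q hp hq.
  have [z [okz pz qz]] := union _ _ (hv p).1 (hv q).1.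
  have e2 : 0 < e / 2 by rewrite divr_gt0.
  have -> : w p - w q = (proj id z x - proj id (v p) x) - (proj id z x - proj id (v q) x).
    by rewrite /w !opprB ![_ + (proj id (v q) x - _)]addrC !subrKA.
  rewrite (le_trans (nrD _ _)) // nrN (splitr e).
  by apply: lerD; apply: close' => //; exact: hN.
have [z hz] := complete_cvn cw.
(* For a basis vector e, the subset [v n] is enlarged by e: the new remainder is exactly orthogonal
   to e and close to the old one. *)
have z0 : z = 0.
  apply: mE => e Ee; apply: cabs_eq0; apply/eqP; rewrite eq_le cabs_ge0 andbT.
  apply/ler_addgt0Pl => d d0; rewrite addr0.
  have d2 : 0 < d / 2 by rewrite divr_gt0.
  have [|N1 h1] := small ((d / 2) ^+ 2); first by rewrite exprn_gt0 // divr_gt0.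
  have [N2 h2] := hz _ d2; pose n := maxn N1 N2.
  have {}h1 := h1 n (leq_maxl _ _); have {}h2 := h2 n (leq_maxr _ _).
  have ok1 : ok [:: e] by split=> // y; rewrite inE => /eqP->.
  have [t [okt vt et]] := union _ _ (hv n).1 ok1.
  have ne : nr e = 1.
    have [_ /(_ e (mem_head _ _))] := @orthonormal_ons E [:: e] hE (ok1.2).
    case=> // {}e0; have := hE e e Ee Ee; rewrite eqxx e0 inner0l => /eqP.
    by rewrite eq_sym oner_eq0.
  have -> : z = - (w n - z) + ((x - proj id t x) + (proj id t x - proj id (v n) x)).
    by rewrite subrKA -/(w n) opprB subrK.
  rewrite innerDl [X in _ + X]innerDl [X in _ + (X + _)]proj_perp ?add0r ?okt.1 //; last 2 first.
  - by apply: orthonormal_ons hE _; exact: okt.2.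
  - by apply: et; rewrite inE.
  rewrite (le_trans (cabsD _ _)) // (splitr d); apply: lerD.
    by rewrite (le_trans (CS _ _)) // ne mulr1 nrN.
  by rewrite (le_trans (CS _ _)) // ne mulr1 close' //; exact: (hv n).1.
move=> e e0; have [N hN] := hz _ e0; exists (v N); have [[uv vE] _] := hv N; split=> //.
move=> t ut vt tE; have := hN N (leqnn _); rewrite z0 subr0; apply: le_trans.
rewrite -(@ler_pXn2r _ 2) ?nnegrE ?nr_ge0 // -subr_ge0.
by rewrite -[_ - _]/(r (v N) - r t) -mono // sqr_ge0.
Qed.
End Basis.

(** * Traces and Schatten classes *)

Section RealSeq.
Variable R : realType.
Implicit Types (c : nat -> R).

Lemma invn_small (e : R) : 0 < e -> exists N, forall p, (N <= p)%N -> (p.+1%:R)^-1 <= e.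
Proof.
move=> e0; exists (Num.truncn e^-1) => p hp.
rewrite -[e]invrK lef_pV2 ?posrE ?invr_gt0 //.
have h := truncnS_gt e^-1; apply/ltW/(lt_le_trans h).
by rewrite ler_nat.
Qed.

Lemma real_complete (u : nat -> R) :
  (forall e, 0 < e -> exists N, forall p q, (N <= p)%N -> (N <= q)%N -> `|u p - u q| <= e) ->
  exists l, forall e, 0 < e -> exists N, forall p, (N <= p)%N -> `|u p - l| <= e.
Proof.
move=> hu; have : cauchy (u @ \oo).
  apply/cauchy_ballP => d d0; have d2 : 0 < d / 2 by rewrite divr_gt0.
  have [N hN] := hu _ d2.
  exists (u @` [set p | (N <= p)%N], u @` [set p | (N <= p)%N]) => /=.
    by split; exists N => // p /= hp; exists p.
  move=> [x y] /= [[p hp <-] [q hq <-]]; rewrite -ball_normE /ball_ /=.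
  by rewrite (le_lt_trans (hN _ _ hp hq)) // ltr_pdivrMr // ltr_pMr // ltr1n.
move=> /cauchy_cvg hc; exists (lim (u @ \oo)) => e e0.
have /cvgrPdist_le/(_ _ e0)[N _ hN] := hc.
by exists N => p hp; have := hN p hp; rewrite distrC.
Qed.

Definition summable_seq c := (forall m, 0 <= c m) /\
  exists C, forall M, \sum_(m < M) c m <= C.

Lemma summable_tail c : summable_seq c -> forall e, 0 < e ->
  exists M0, forall M M', (M0 <= M)%N -> \sum_(M <= m < M') c m <= e.
Proof.
move=> [c0 [C hC]] e e0.
pose S := range (fun M => \sum_(m < M) c m).
have hS : has_sup S by split; [exists (\sum_(m < 0) c m), 0%N | exists C => _ [M _ <-]].
have [_ [M0 _ <-] hM0] := sup_adherent e0 hS.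
exists M0 => M M' MM; have [M'M|MM'] := leqP M' M; first by rewrite big_geq // ltW.
have : \sum_(m < M') c m <= sup S by apply: sup_upper_bound => //; exists M'.
rewrite -!(big_mkord xpredT c) in hM0 *.
rewrite (big_cat_nat (leq0n M) (ltnW MM')) /= (big_cat_nat (leq0n M0) MM) /= => h.
have h2 : 0 <= \sum_(M0 <= m < M) c m by exact: sumr_ge0.
move: hM0 h h2; move: (\sum_(_ <= _ < M0) _) (\sum_(M <= _ < _) _) (\sum_(M0 <= _ < _) _).
by move=> x y z; move: (sup S) => s h1 h2 h3; lra.
Qed.

Lemma summable_small c : summable_seq c -> forall e, 0 < e ->
  exists M0, forall M, (M0 <= M)%N -> c M <= e.
Proof.
move=> hc e /(summable_tail hc)[M0 h]; exists M0 => M hM.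
by have := h M M.+1 hM; rewrite big_nat1.
Qed.

Lemma summable_le c c' : (forall m, 0 <= c m <= c' m) -> summable_seq c' -> summable_seq c.
Proof.
move=> h [_ [C hC]]; split=> [m|]; first by have /andP[] := h m.
exists C => M; apply: le_trans (hC M); apply: ler_sum => m _; by have /andP[] := h m.
Qed.
Lemma summableZ k c : 0 <= k -> summable_seq c -> summable_seq (fun m => k * c m).
Proof.
move=> k0 [c0 [C hC]]; split=> [m|]; first exact: mulr_ge0.
by exists (k * C) => M; rewrite -mulr_sumr ler_wpM2l.
Qed.
Lemma summable_sum (I : Type) (s : seq I) (c : I -> nat -> R) :
  (forall i, summable_seq (c i)) -> summable_seq (fun m => \sum_(i <- s) c i m).
Proof.
move=> h; split=> [m|]; first by apply: sumr_ge0 => i _; apply: (h i).1.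
have /choice[C hC] : forall i, exists C, forall M, \sum_(m < M) c i m <= C by move=> i; exact: (h i).2.
exists (\sum_(i <- s) C i) => M; rewrite exchange_big /=; apply: ler_sum => i _; exact: hC.
Qed.

Lemma complex_series (a : nat -> R[i]) c : summable_seq c -> (forall m, cabs (a m) <= c m) ->
  exists t, forall e, 0 < e -> exists N, forall M, (N <= M)%N ->
    cabs (\sum_(m < M) a m - t) <= e.
Proof.
move=> hc ac.
have key (e : R) : 0 < e -> exists N, forall p q, (N <= p)%N -> (N <= q)%N ->
    cabs (\sum_(m < p) a m - \sum_(m < q) a m) <= e.
  move=> /(summable_tail hc)[N hN]; exists N => p q; wlog pq : p q / (q <= p)%N.
    move=> hw Np Nq; case/orP: (leq_total q p) => qp; first exact: hw.
    by rewrite -cabsN opprB; apply: hw.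
  move=> Np Nq; rewrite -!(big_mkord xpredT a) (big_cat_nat (leq0n q) pq) /=.
  rewrite addrAC subrr add0r (le_trans _ (hN q p Nq)) //.
  elim/big_ind2: _ => [|x y z w h1 h2|//]; first by rewrite cabs0.
  by apply: le_trans (cabsD _ _) _; apply: lerD.
have [|x hx] := @real_complete (fun M => complex.Re (\sum_(m < M) a m)).
  move=> e /key[N hN]; exists N => p q Np Nq.
  by rewrite -ReN -ReD (le_trans (Re_cabs _)) // hN.
have [|y hy] := @real_complete (fun M => complex.Im (\sum_(m < M) a m)).
  move=> e /key[N hN]; exists N => p q Np Nq.
  apply: le_trans (hN p q Np Nq); apply: le_trans (Im_cabs _).
  by move: (\sum_(m < p) _) (\sum_(m < q) _) => [? ?] [? ?].
exists (x +i* y) => e e0; have e2 : 0 < e / 2 by rewrite divr_gt0.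
have [N1 h1] := hx _ e2; have [N2 h2] := hy _ e2.
exists (maxn N1 N2) => M; rewrite geq_max => /andP[/h1 {}h1 /h2 {}h2].
apply: le_trans (cabs_ReIm _) _; rewrite (splitr e).
move: h1 h2; move: (\sum_(m < M) _) => [u v] /=; exact: lerD.
Qed.

End RealSeq.

Lemma telescope_down (V : zmodType) (d : nat -> V) (m n : nat) : (m <= n)%N ->
  d m = \sum_(m <= k < n) (d k - d k.+1) + d n.
Proof.
move=> mn; rewrite (@telescope_sumr_eq V m n (fun k => - d k)) //.
  by rewrite opprK addrAC addNr add0r.
by move=> k _; rewrite opprK addrC.
Qed.

(** * Unordered sums over a basis *)

Section HasSum.
Variables (R : realType) (H : hilbertType R).
Implicit Types (E : set H) (s t : seq H).

Lemma has_sumP E (f : H -> R[i]) (z : R[i]) : has_sum E f z <->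
  (forall e, 0 < e -> exists s, [/\ uniq s, {in s, forall y, E y} &
    forall t, uniq t -> {subset s <= t} -> {in t, forall y, E y} ->
    cabs (\sum_(x <- t) f x - z) <= e]).
Proof.
split=> h e e0.
  have eC : 0 < e%:C :> R[i] by rewrite ltcR.
  have [F0 [fF0 F0E hF]] := h _ eC.
  exists (finmap.enum_fset (fset_set F0)); split; first exact: finmap.fset_uniq.
    by move=> y; rewrite in_fset_set // inE => /F0E.
  move=> t ut st tE.
  have := hF [set` t]; rewrite fsbig_finite //= -lecR -cabsE.
  rewrite (perm_big t); last first.
    apply: uniq_perm => //; first exact: finmap.fset_uniq.
    by move=> y; rewrite in_fset_set ?mem_setE //; last exact: finite_seq; apply/idP/idP; rewrite inE.
  apply=> //; by move=> y F0y; apply: st; rewrite in_fset_set // inE.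
have [d d0 ed] := posC e0; have [s [us sE hs]] := h d d0.
exists [set` s]; split=> // F fF sF FE.
rewrite fsbig_finite //= cabsE ed lecR; apply: hs; first exact: finmap.fset_uniq.
- by move=> y ys; rewrite in_fset_set // inE; apply: sF.
- by move=> y; rewrite in_fset_set // inE; apply: FE.
Qed.

Lemma seq_union E s t : {in s, forall y, E y} -> {in t, forall y, E y} ->
  exists z, [/\ uniq z, {in z, forall y, E y}, {subset s <= z} & {subset t <= z}].
Proof.
move=> sE tE; exists (undup (s ++ t)); split; first exact: undup_uniq.
- by move=> y; rewrite mem_undup mem_cat => /orP[/sE|/tE].
- by move=> y ys; rewrite mem_undup mem_cat ys.
- by move=> y ys; rewrite mem_undup mem_cat ys orbT.
Qed.

Lemma has_sum_uniq E f z z' : has_sum E f z -> has_sum E f z' -> z = z'.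
Proof.
move=> /has_sumP h /has_sumP h'; apply/eqP; rewrite -subr_eq0; apply/eqP/cabs_eq0.
apply/eqP; rewrite eq_le cabs_ge0 andbT; apply/ler_addgt0Pl => e e0; rewrite addr0.
have e2 : 0 < e / 2 by rewrite divr_gt0.
have [s [us sE hs]] := h _ e2; have [t [ut tE ht]] := h' _ e2.
have [w [uw wE sw tw]] := seq_union sE tE.
have {}hs := hs w uw sw wE; have {}ht := ht w uw tw wE.
rewrite -[z](subrK (\sum_(x <- w) f x)) -addrA (le_trans (cabsD _ _)) // (splitr e).
by apply: lerD => //; rewrite -cabsN opprB.
Qed.

Lemma has_sumD E f g z w : has_sum E f z -> has_sum E g w ->
  has_sum E (fun x => f x + g x) (z + w).
Proof.
move=> /has_sumP h /has_sumP h'; apply/has_sumP => e e0.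
have e2 : 0 < e / 2 by rewrite divr_gt0.
have [s [us sE hs]] := h _ e2; have [t [ut tE ht]] := h' _ e2.
have [v [uv vE sv tv]] := seq_union sE tE.
exists v; split=> // y uy vy yE; rewrite big_split /= opprD addrACA.
rewrite (le_trans (cabsD _ _)) // (splitr e); apply: lerD.
  by apply: hs => // x /sv/vy.
by apply: ht => // x /tv/vy.
Qed.

Lemma has_sumZ E f z c : has_sum E f z -> has_sum E (fun x => c * f x) (c * z).
Proof.
move=> /has_sumP h; apply/has_sumP => e e0.
have [|s [us sE hs]] := h (e / (cabs c + 1)).
  by rewrite divr_gt0 // ltr_wpDl // cabs_ge0.
exists s; split=> // t ut st tE; rewrite -mulr_sumr -mulrBr cabsM.
have c1 : 0 < cabs c + 1 by rewrite ltr_wpDl // cabs_ge0.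
apply: le_trans (ler_wpM2l (cabs_ge0 _) (hs t ut st tE)) _.
by rewrite mulrCA -[leRHS]mulr1 ler_wpM2l ?(ltW e0) // ler_pdivrMr // mul1r lerDl.
Qed.

Lemma has_sum_ge E f (z : R[i]) : (forall x, 0 <= f x) -> has_sum E f z ->
  forall s, uniq s -> {in s, forall y, E y} ->
  \sum_(x <- s) complex.Re (f x) <= complex.Re z.
Proof.
move=> f0 /has_sumP h s us sE; apply/ler_addgt0Pr => e e0.
have [t [ut tE ht]] := h _ e0; have [v [uv vE sv tv]] := seq_union sE tE.
have {}ht := ht v uv tv vE.
have : \sum_(x <- v) complex.Re (f x) <= complex.Re z + e.
  have -> : \sum_(x <- v) complex.Re (f x) = complex.Re (\sum_(x <- v) f x).
    by rewrite (big_morph (@complex.Re R) (@ReD R) (erefl : complex.Re (0 : R[i]) = 0)).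
  by rewrite addrC -lerBlDr -ReN -ReD (le_trans (Re_le_cabs _)).
apply: le_trans.
have pv : perm_eq v (s ++ [seq x <- v | x \notin s]).
  apply: uniq_perm => //.
    rewrite cat_uniq us filter_uniq // andbT; apply/hasPn => x.
    by rewrite mem_filter => /andP[].
  move=> x; rewrite mem_cat mem_filter; have [xs|xs] := boolP (x \in s) => //=.
  by rewrite sv.
rewrite [leRHS](perm_big _ pv) /= big_cat lerDl sumr_ge0 // => x _.
by have := f0 x; rewrite lecE => /andP[].
Qed.

End HasSum.

(** * Traces by finite rank exhaustion *)

Section Trace.
Variables (R : realType) (H : hilbertType R).
Implicit Types (X Y B : bop H) (c : nat -> R) (d : nat -> bop H) (l : nat -> seq (H * H)).

Lemma has_trace_uniq (T : H -> H) (t t' : R[i]) : has_trace T t -> has_trace T t' -> t = t'.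
Proof. by have [E hE] := basis_exists H => /(_ E hE) + /(_ E hE); exact: has_sum_uniq. Qed.
Lemma has_trace_Tr (T : H -> H) (t : R[i]) : has_trace T t -> Tr T = t.
Proof. by move=> h; apply: xget_unique => // t' h'; exact: has_trace_uniq h' h. Qed.
Lemma has_traceD X Y t u : has_trace X t -> has_trace Y u -> has_trace (X + Y) (t + u).
Proof.
move=> hX hY E hE; have := has_sumD (hX E hE) (hY E hE).
by congr has_sum; apply/funext => x; rewrite bDE innerDl.
Qed.
Lemma has_traceZ X t a : has_trace X t -> has_trace (a *: X) (a * t).
Proof.
move=> hX E hE; have := has_sumZ a (hX E hE).
by congr has_sum; apply/funext => x; rewrite bZE innerZl.
Qed.
Lemma has_trace0 : has_trace (0 : bop H) (0 : R[i]).
Proof.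
move=> E hE; apply/has_sumP => e e0; exists [::]; split=> // t _ _ _.
by rewrite big1 ?subr0 ?cabs0 ?ltW // => x _; rewrite b0E inner0l.
Qed.
Lemma has_trace_sum (I : Type) (s : seq I) (X : I -> bop H) (t : I -> R[i]) :
  (forall i, has_trace (X i) (t i)) ->
  has_trace (\sum_(i <- s) X i) (\sum_(i <- s) t i).
Proof.
move=> h; elim: s => [|i s IH]; first by rewrite !big_nil; exact: has_trace0.
by rewrite !big_cons; apply: has_traceD.
Qed.

Lemma sum_rank1 s (x y : H) :
  \sum_(e <- s) [<rank1 x y e, e>] = [<proj id s x, y>].
Proof.
rewrite inner_suml; apply: eq_bigr => e _; by rewrite rank1E !innerZl mulrC.
Qed.

Lemma has_trace_rank1 (x y : H) : has_trace (rank1 x y) [<x, y>].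
Proof.
move=> E hE; apply/has_sumP => e e0.
have n1 : 0 < nr y + 1 by rewrite ltr_wpDl // nr_ge0.
have [|s [us sE hs]] := @parseval _ _ E x hE (e / (nr y + 1)); first by rewrite divr_gt0.
exists s; split=> // t ut st tE; rewrite sum_rank1 -innerBl.
rewrite (le_trans (CS _ _)) // nrB (le_trans (ler_wpM2r (nr_ge0 _) (hs t ut st tE))) //.
by rewrite mulrAC -[leRHS]mulr1 -mulrA ler_wpM2l ?(ltW e0) // ler_pdivrMr // mul1r lerDl.
Qed.

Lemma sum_rank1_le E s (x y : H) : orthonormal E -> uniq s -> {in s, forall z, E z} ->
  cabs (\sum_(e <- s) [<rank1 x y e, e>]) <= nr x * nr y.
Proof.
move=> hE us sE; rewrite sum_rank1 (le_trans (CS _ _)) // ler_wpM2r ?nr_ge0 //.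
rewrite -(@ler_pXn2r _ 2) ?nnegrE ?nr_ge0 // nr_proj //; last exact: orthonormal_ons sE.
by apply: bessel => //; exact: orthonormal_ons sE.
Qed.

Lemma sum_bdd_le E s X M : orthonormal E -> {in s, forall z, E z} -> bdd X M ->
  cabs (\sum_(e <- s) [<X e, e>]) <= (size s)%:R * M.
Proof.
move=> hE sE [M0 hM]; have ho := orthonormal_ons hE sE.
elim: s sE {ho} => [|e s IH] sE; first by rewrite big_nil cabs0 mul0r.
rewrite big_cons (le_trans (cabsD _ _)) //= mulrSr mulrDl mul1r addrC lerD //.
  by apply: IH => z zs; apply: sE; rewrite inE zs orbT.
have Ee : E e by apply: sE; rewrite mem_head.
have : nr e ^+ 2 = 1 by rewrite nr_sq hE // eqxx.
move=> /eqP; rewrite sqrp_eq1 ?nr_ge0 // => /eqP e1.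
by rewrite (le_trans (CS _ _)) // e1 mulr1 (le_trans (hM _)) // e1 mulr1.
Qed.

(* [d] exhausts [X] by finite rank pieces: [d m - d m.+1] is the sum of at most
   [N] rank one operators of norm at most [c m]. *)
Definition appr N c X d l := [/\ d 0%N = X,
  (forall m, bdd (d m) (c m) /\ bdd (d m.+1) (c m)),
  (forall m, d m - d m.+1 = \sum_(p <- l m) rank1 p.1 p.2) &
  (forall m, (size (l m) <= N)%N /\ {in l m, forall p, nr p.1 * nr p.2 <= c m})].

Definition ltrace (s : seq (H * H)) : R[i] := \sum_(p <- s) [<p.1, p.2>].

Lemma ltrace_le N c X d l m : appr N c X d l -> cabs (ltrace (l m)) <= N%:R * c m.
Proof.
move=> [_ dc _ /(_ m)[sN hs]]; have [c0 _] := (dc m).1.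
apply: (@le_trans _ _ ((size (l m))%:R * c m)); last by rewrite ler_wpM2r // ler_nat.
rewrite /ltrace; elim: (l m) hs {sN} => [|p s IH] hs; first by rewrite big_nil cabs0 mul0r.
rewrite big_cons (le_trans (cabsD _ _)) //= mulrSr mulrDl mul1r addrC lerD //.
  by apply: IH => z zs; apply: hs; rewrite inE zs orbT.
by rewrite (le_trans (CS _ _)) // hs // mem_head.
Qed.

(** The sum defining the trace must be controlled on all finite parts of every basis. The finite
    rank head has a trace by Parseval, and the remainder [d M] is small on all finite sets at
    once. *)
Lemma appr_has_trace N c X d l (t : R[i]) : appr N c X d l -> summable_seq c ->
  (forall e, 0 < e -> exists M0, forall M, (M0 <= M)%N ->
     cabs (\sum_(m < M) ltrace (l m) - t) <= e) ->
  has_trace X t.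
Proof.
move=> [d0 dc dl ls] hc ht E hE; apply/has_sumP => e e0; have hoE := hE.1.
(* The bound does not depend on the size of [s]: pieces are bounded by [N * c m] on any orthonormal
   set, and [M'] is chosen after [s], so that the smallness of [d M'] absorbs the factor
   [size s]. *)
have small M s eps : uniq s -> {in s, forall y, E y} ->
    (forall M', \sum_(M <= m < M') N%:R * c m <= eps) ->
    cabs (\sum_(x <- s) [<d M x, x>]) <= eps.
  move=> us sE heps; apply/ler_addgt0Pr => g g0.
  have [|M1 hM1] := summable_small hc (e := g / ((size s)%:R + 1)).
    by rewrite divr_gt0 // ltr_wpDl.
  pose M' := maxn M M1; have MM' : (M <= M')%N by exact: leq_maxl.
  have tele : d M = \sum_(M <= m < M') (d m - d m.+1) + d M'.
    exact: telescope_down.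
  have -> : \sum_(x <- s) [<d M x, x>] =
    \sum_(M <= m < M') \sum_(x <- s) [<(d m - d m.+1) x, x>] + \sum_(x <- s) [<d M' x, x>].
    rewrite exchange_big -big_split /=; apply: eq_bigr => x _.
    by rewrite {1}tele bDE innerDl bsumE inner_suml.
  rewrite (le_trans (cabsD _ _)) // lerD //.
    apply: le_trans (heps M').
    have : forall m, cabs (\sum_(x <- s) [<(d m - d m.+1) x, x>]) <= N%:R * c m.
      move=> m; have [c0 _] := (dc m).1; have [sN hs] := ls m.
      apply: (@le_trans _ _ ((size (l m))%:R * c m)); last by rewrite ler_wpM2r // ler_nat.
      rewrite dl; under eq_bigr do rewrite bsumE inner_suml.
      rewrite exchange_big /=; elim: (l m) hs {sN} => [|p r IH] hs.
        by rewrite big_nil cabs0 mul0r.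
      rewrite big_cons (le_trans (cabsD _ _)) //= mulrSr mulrDl mul1r addrC lerD //.
        by apply: IH => z zs; apply: hs; rewrite inE zs orbT.
      by rewrite (le_trans (sum_rank1_le _ _ hoE us sE)) // hs // mem_head.
    move=> hm; elim/big_ind2: _ => [|x y z w h1 h2|//]; first by rewrite cabs0.
    by apply: le_trans (cabsD _ _) _; apply: lerD.
  apply: le_trans (sum_bdd_le hoE sE (dc M').1) _.
  have s1 : 0 < (size s)%:R + 1 :> R by rewrite ltr_wpDl.
  apply: (@le_trans _ _ ((size s)%:R * (g / ((size s)%:R + 1)))).
    by rewrite ler_wpM2l // hM1 // leq_maxr.
  by rewrite mulrCA -[leRHS]mulr1 ler_wpM2l ?(ltW g0) // ler_pdivrMr // mul1r lerDl.
have e3 : 0 < e / 3 by rewrite divr_gt0.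
have [M0 hM0] := ht _ e3.
have [M1 hM1] := summable_tail (summableZ (ler0n _ N) hc) e3.
pose M := maxn M0 M1.
have fin : has_trace (\sum_(m < M) (d m - d m.+1)) (\sum_(m < M) ltrace (l m)).
  apply: has_trace_sum => m; rewrite dl; apply: has_trace_sum => p; exact: has_trace_rank1.
have /has_sumP/(_ _ e3)[s [us sE hs]] := fin E hE.
exists s; split=> // r ur sr rE.
have -> : \sum_(x <- r) [<X x, x>] - t =
    (\sum_(x <- r) [<(\sum_(m < M) (d m - d m.+1)) x, x>] - \sum_(m < M) ltrace (l m)) +
    \sum_(x <- r) [<d M x, x>] + (\sum_(m < M) ltrace (l m) - t).
  have XE : X = \sum_(m < M) (d m - d m.+1) + d M.
    by rewrite -(big_mkord xpredT (fun m => d m - d m.+1)) -d0; exact: telescope_down.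
  under eq_bigr => x do rewrite {1}XE bDE innerDl.
  by rewrite big_split /=; ring.
rewrite (le_trans (cabsD _ _)) //.
have -> : e = e / 3 + e / 3 + e / 3 by field.
apply: lerD; last by apply: hM0; exact: leq_maxl.
rewrite (le_trans (cabsD _ _)) //; apply: lerD; first exact: hs.
by apply: small => // M'; apply: hM1; exact: leq_maxr.
Qed.

Lemma appr_trace_class N c X d l : appr N c X d l -> summable_seq c ->
  exists2 t : R[i], has_trace X t & forall e, 0 < e -> exists M0, forall M, (M0 <= M)%N ->
     cabs (\sum_(m < M) ltrace (l m) - t) <= e.
Proof.
move=> h hc.
have [|t ht] := @complex_series R (fun m => ltrace (l m)) _ (summableZ (ler0n _ N) hc).
  by move=> m; apply: ltrace_le h.
by exists t => //; apply: appr_has_trace h hc ht.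
Qed.

(** The pieces of [d m * d' m] and, for [lmul'], of [d' m * d m]. Both telescope so that differences
    of [d] meet [d' m] and differences of [d'] meet [d m.+1]; the m-th pieces then have equal
    traces, term by term. *)
Definition lmul d d' l l' m :=
  [seq (p.1, adj (d' m) p.2) | p <- l m] ++ [seq (d m.+1 p.1, p.2) | p <- l' m].
Definition lmul' d d' l l' m :=
  [seq (d' m p.1, p.2) | p <- l m] ++ [seq (p.1, adj (d m.+1) p.2) | p <- l' m].

Lemma appr_mul N c X d l N' c' Y d' l' : appr N c X d l -> appr N' c' Y d' l' ->
  appr (N + N') (fun m => c m * c' m) (X * Y) (fun m => d m * d' m) (lmul d d' l l').
Proof.
move=> [d0 dc dl ls] [d0' dc' dl' ls']; split.
- by rewrite d0 d0'.
- move=> m; have [a1 a2] := dc m; have [b1 b2] := dc' m.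
  by split; apply: bddbM.
- move=> m; rewrite /lmul big_cat !big_map /=.
  under eq_bigr do rewrite -rank1Mr.
  under [X in _ = _ + X]eq_bigr do rewrite -rank1Ml.
  by rewrite -mulr_suml -mulr_sumr -dl -dl' mulrBl mulrBr subrKA.
- move=> m; rewrite /lmul size_cat !size_map; split.
    by rewrite leq_add //; [case: (ls m)|case: (ls' m)].
  have [a1 a2] := dc m; have [b1 b2] := dc' m.
  move=> p; rewrite mem_cat => /orP[] /mapP[q qs ->] /=.
    have [_ hb] := bdd_adj b1.
    rewrite (le_trans (ler_wpM2l (nr_ge0 _) (hb _))) // mulrCA mulrC ler_wpM2r ?b1.1 //.
    exact: (ls m).2.
  rewrite (le_trans (ler_wpM2r (nr_ge0 _) (a2.2 _))) // -mulrA ler_wpM2l ?a1.1 //.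
  exact: (ls' m).2.
Qed.

Lemma appr_mul' N c X d l N' c' Y d' l' : appr N c X d l -> appr N' c' Y d' l' ->
  appr (N + N') (fun m => c m * c' m) (Y * X) (fun m => d' m * d m) (lmul' d d' l l').
Proof.
move=> [d0 dc dl ls] [d0' dc' dl' ls']; split.
- by rewrite d0 d0'.
- move=> m; have [a1 a2] := dc m; have [b1 b2] := dc' m.
  by rewrite [c m * _]mulrC; split; apply: bddbM.
- move=> m; rewrite /lmul' big_cat !big_map /=.
  under eq_bigr do rewrite -rank1Ml.
  under [X in _ = _ + X]eq_bigr do rewrite -rank1Mr.
  by rewrite -mulr_suml -mulr_sumr -dl -dl' mulrBl mulrBr subrKA.
- move=> m; rewrite /lmul' size_cat !size_map; split.
    by rewrite leq_add //; [case: (ls m)|case: (ls' m)].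
  have [a1 a2] := dc m; have [b1 b2] := dc' m.
  move=> p; rewrite mem_cat => /orP[] /mapP[q qs ->] /=.
    rewrite (le_trans (ler_wpM2r (nr_ge0 _) (b1.2 _))) // -mulrA [leRHS]mulrC ler_wpM2l ?b1.1 //.
    exact: (ls m).2.
  have [_ ha] := bdd_adj a2.
  rewrite (le_trans (ler_wpM2l (nr_ge0 _) (ha _))) // mulrCA ler_wpM2l ?a1.1 //.
  exact: (ls' m).2.
Qed.

Lemma ltrace_lmul d d' l l' m : ltrace (lmul d d' l l' m) = ltrace (lmul' d d' l l' m).
Proof.
rewrite /ltrace !big_cat !big_map /=; congr (_ + _); apply: eq_bigr => p _;
  by rewrite -adjP.
Qed.

(* A finite rank perturbation of a product has the same trace in both orders,
   and such perturbations exhaust [X * Y] and [Y * X] simultaneously. *)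
Lemma appr_cyc N c X d l N' c' Y d' l' : appr N c X d l -> appr N' c' Y d' l' ->
  summable_seq (fun m => c m * c' m) ->
  exists t : R[i], has_trace (X * Y) t /\ has_trace (Y * X) t.
Proof.
move=> hX hY hc; have [t t1 t2] := appr_trace_class (appr_mul hX hY) hc.
exists t; split=> //; apply: appr_has_trace (appr_mul' hX hY) hc _.
move=> e /t2[M0 h]; exists M0 => M hM; under eq_bigr do rewrite -ltrace_lmul; exact: h.
Qed.

End Trace.

(** * Schatten classes and the Hoelder inequality *)

Section Schatten.
Variables (R : realType) (H : hilbertType R) (p : nat).
Hypothesis p0 : (0 < p)%N.
Implicit Types (X Y B : bop H).

(* X lies in the Schatten class of exponent p / k *)
Definition sch k X := exists N c d l (K : R) (cs : seq (nat -> R)),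
  [/\ appr N c X d l, 0 <= K, size cs = k,
    (forall f, List.In f cs ->
       (forall m, 0 <= f m) /\ summable_seq (fun m => f m ^+ p)) &
    forall m, c m = K * \prod_(f <- cs) f m].

(** The constant sequence works, with no pieces at all: nothing in [appr] asks [d m] to tend to 0,
    and summability only enters once the number of factors reaches p. *)
Lemma sch0 X : sch 0 X.
Proof.
have [M hM] := bbdd X; exists 0%N, (fun=> M), (fun=> X), (fun=> [::]), M, [::].
split=> //; first 2 last; first by move=> m; rewrite big_nil mulr1.
  by split=> // m; rewrite big_nil subrr.
by case: hM.
Qed.

Lemma sch_mul k k' X Y : sch k X -> sch k' Y -> sch (k + k') (X * Y).
Proof.
move=> [N [c [d [l [K [cs [h K0 sc hcs hc]]]]]]] [N' [c' [d' [l' [K' [cs' [h' K0' sc' hcs' hc']]]]]]].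
exists (N + N')%N; do 3 eexists; exists (K * K'), (cs ++ cs').
split; first exact: appr_mul h h'.
- exact: mulr_ge0.
- by rewrite size_cat sc sc'.
- move=> f hf; have [] := List.in_app_or _ _ _ hf; [exact: hcs|exact: hcs'].
- by move=> m; rewrite /= hc hc' big_cat /= mulrACA.
Qed.

(** The product is at most a power of its largest factor. This crude form of the
    arithmetic-geometric inequality is enough, since only summability matters and not the
    constant. *)
Lemma prod_le_sum (s : seq R) : {in s, forall x, 0 <= x} -> (0 < size s)%N ->
  \prod_(x <- s) x <= \sum_(x <- s) x ^+ size s.
Proof.
move=> s0 sN.
have [M [Ms hM]] : exists M, M \in s /\ {in s, forall x, x <= M}.
  elim: s s0 sN => // x [|y s] IH s0 _.
    by exists x; rewrite mem_head; split=> // z; rewrite inE => /eqP->.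
  have s0' : {in y :: s, forall x, 0 <= x} by move=> z zs; apply: s0; rewrite inE zs orbT.
  have [M [Ms hM]] := IH s0' isT.
  have [xM|Mx] := leP x M.
    by exists M; rewrite inE Ms orbT; split=> // z; rewrite inE => /orP[/eqP->|/hM].
  exists x; rewrite mem_head; split=> // z; rewrite inE => /orP[/eqP->//|/hM zM].
  exact: le_trans zM (ltW Mx).
apply: (@le_trans _ _ (M ^+ size s)).
  elim: s s0 hM {sN Ms} => [|x s IH] s0 hM; first by rewrite big_nil.
  rewrite big_cons exprS; apply: ler_pM.
  - by rewrite s0 ?mem_head.
  - rewrite big_seq; apply: prodr_ge0 => z zs; by apply: s0; rewrite inE zs orbT.
  - by rewrite hM ?mem_head.
  - by apply: IH => z zs; [apply: s0|apply: hM]; rewrite inE zs orbT.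
rewrite (big_rem M) //= lerDl big_seq sumr_ge0 // => x /mem_rem xs.
by rewrite exprn_ge0 // s0.
Qed.

Lemma summable_prod (K : R) (cs : seq (nat -> R)) : 0 <= K -> size cs = p ->
  (forall f, List.In f cs ->
       (forall m, 0 <= f m) /\ summable_seq (fun m => f m ^+ p)) ->
  summable_seq (fun m => K * \prod_(f <- cs) f m).
Proof.
move=> K0 sc h; apply: summableZ => //.
pose g i := nth (fun=> 0) cs i.
have hg i : (i < p)%N -> (forall m, 0 <= g i m) /\ summable_seq (fun m => g i m ^+ p).
  move=> ip; apply: h => //; rewrite /g -sc in ip *.
  by elim: cs i ip {sc g} => // f s IH [|i] /= ip; [left|right; apply: IH].
have hs : summable_seq (fun m => \sum_(i <- index_enum 'I_p) g i m ^+ p).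
  by apply: summable_sum => i; apply: (hg i _).2.
apply: summable_le hs => m.
have -> : \prod_(f <- cs) f m = \prod_(i < p) g i m.
  by rewrite (big_nth (fun=> 0)) big_mkord sc.
rewrite prodr_ge0 => [/=|i _]; last exact: (hg i _).1.
have sz : size (index_enum 'I_p) = p by rewrite [index_enum _]unlock -enumT size_enum_ord.
have := @prod_le_sum (map (fun i : 'I_p => g i m) (index_enum 'I_p)).
rewrite !big_map size_map sz; apply=> //.
by move=> x /mapP[i _ ->]; apply: (hg i _).1.
Qed.
Lemma sch_trace X : sch p X -> exists t : R[i], has_trace X t.
Proof.
move=> [N [c [d [l [K [cs [h K0 sc hcs hc]]]]]]].
have {hc} cE : c = fun m => K * \prod_(f <- cs) f m by exact/funext.
by rewrite cE in h; have [t ht _] := appr_trace_class h (summable_prod K0 sc hcs); exists t.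
Qed.

Lemma sch_cyc k k' X Y : sch k X -> sch k' Y -> (k + k' = p)%N ->
  Tr (X * Y) = Tr (Y * X) :> R[i].
Proof.
move=> [N [c [d [l [K [cs [h K0 sc hcs hc]]]]]]] [N' [c' [d' [l' [K' [cs' [h' K0' sc' hcs' hc']]]]]]] kp.
have [|t [/has_trace_Tr-> /has_trace_Tr->]//] := appr_cyc h h'.
have -> : (fun m => c m * c' m) = fun m => (K * K') * \prod_(f <- cs ++ cs') f m.
  by apply/funext => m; rewrite hc hc' big_cat /= mulrACA.
apply: summable_prod; rewrite ?mulr_ge0 ?size_cat ?sc ?sc' //.
move=> f hf; have [] := List.in_app_or _ _ _ hf; [exact: hcs|exact: hcs'].
Qed.

End Schatten.

(** * Positive operators and the greedy approximation *)

Section PositiveOp.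
Variables (R : realType) (H : hilbertType R) (P : bop H).
Hypothesis Ppos : forall x, 0 <= [<P x, x>].
Implicit Types x y : H.

Definition qf x : R := complex.Re [<P x, x>].

Lemma qf_ge0 x : 0 <= qf x.
Proof. by have := Ppos x; rewrite lecE => /andP[]. Qed.
Lemma pos_sa x y : [<P x, y>] = [<x, P y>].
Proof.
rewrite [RHS]inner_conj (@form_conj _ _ (fun x y => [<P x, y>]) _ _ _ x y) ?conjK //.
- by move=> c u v z; rewrite (blinear P) innerDl innerZl.
- by move=> c u v z; rewrite innerDr innerZr.
Qed.
Lemma pos_CS x y : cabs [<P x, y>] ^+ 2 <= qf x * qf y.
Proof.
apply: (@form_CS _ _ (fun x y => [<P x, y>])) => //.
- by move=> c u v z; rewrite (blinear P) innerDl innerZl.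
- by move=> c u v z; rewrite innerDr innerZr.
Qed.
Lemma pos_powsa n x y : [<(P ^+ n) x, y>] = [<x, (P ^+ n) y>].
Proof.
elim: n x y => [|n IH] x y; first by rewrite expr0.
by rewrite {1}exprS exprSr !bME pos_sa IH.
Qed.
Definition mom k x : R := complex.Re [<(P ^+ k) x, x>].

Lemma mom_even i x : mom (i + i)%N x = nr ((P ^+ i) x) ^+ 2.
Proof. by rewrite /mom exprD bME pos_powsa nr_sq. Qed.
Lemma pow_ge0 k x : 0 <= [<(P ^+ k) x, x>].
Proof.
rewrite -(odd_double_half k) -addnn; case: (odd k) => /=.
  by rewrite add1n -addnS exprD bME pos_powsa exprS bME.
by rewrite add0n exprD bME pos_powsa inner_ge0.
Qed.
Lemma mom_ge0 k x : 0 <= mom k x.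
Proof. by have := pow_ge0 k x; rewrite lecE => /andP[]. Qed.

(** Log-convexity of the moments. Between two even moments it is Cauchy-Schwarz for the inner
    product, between two odd ones Cauchy-Schwarz for the form <P x, y>. *)
Lemma mom_convex k x : mom k.+1 x ^+ 2 <= mom k x * mom k.+2 x.
Proof.
have sq (z : R[i]) : complex.Re z ^+ 2 <= cabs z ^+ 2.
  by rewrite -real_normK ?num_real // ler_pXn2r ?nnegrE ?cabs_ge0 // Re_cabs.
have D a b : mom (a + b)%N x = complex.Re [<(P ^+ a) x, (P ^+ b) x>].
  by rewrite /mom addnC exprD bME pos_powsa.
have D1 a b : mom (a + b)%N.+1 x = complex.Re [<P ((P ^+ a) x), (P ^+ b) x>].
  by rewrite -addnS D exprS bME -pos_sa.
rewrite -(odd_double_half k) -addnn; case: (odd k) => /=; set i := k./2.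
  have E1 : (i + i)%N.+2 = (i + i.+1)%N.+1 by rewrite addnS.
  have E2 : (i + i.+1)%N.+2 = (i.+1 + i.+1)%N.+1 by rewrite addSn.
  rewrite add1n D1 E1 D1 E2 D1.
  exact: le_trans (sq _) (pos_CS _ _).
have E1 : (i + i.+1)%N.+1 = (i.+1 + i.+1)%N by rewrite addSn.
rewrite add0n -addnS D E1 !mom_even.
rewrite (le_trans (sq _)) // -exprMn.
by rewrite ler_pXn2r ?nnegrE ?mulr_ge0 ?nr_ge0 ?cabs_ge0 // CS.
Qed.
(** Jensen's inequality for the spectral measure of P at x, without that measure: by log-convexity
    the ratios of consecutive moments increase, and the first of them is [qf x]. *)
Lemma jensen k x : nr x = 1 -> qf x ^+ k <= mom k x.
Proof.
move=> x1; have m0 : mom 0 x = 1 by rewrite /mom expr0 b1E -nr_sq x1 expr1n.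
have m1 : mom 1 x = qf x by rewrite /mom expr1.
have key j : qf x * mom j x <= mom j.+1 x.
  elim: j => [|j IH]; first by rewrite m0 m1 mulr1.
  have := mom_convex j x; have := mom_ge0 j x; have := mom_ge0 j.+1 x.
  have := mom_ge0 j.+2 x; have := qf_ge0 x; move: IH.
  move: (qf x) (mom j x) (mom j.+1 x) (mom j.+2 x) => q a b c qab q0 c0 b0 a0 bac.
  have [aE|aN] := eqVneq a 0.
    have b2 : b ^+ 2 <= 0 by move: bac; rewrite aE mul0r.
    have /eqP : b == 0 by rewrite -sqrf_eq0 eq_le b2 sqr_ge0.
    by move=> ->; rewrite mulr0.
  have a1 : 0 < a by rewrite lt_def aN.
  rewrite -(ler_pM2l a1) (le_trans _ bac) // expr2 mulrA ler_wpM2r //.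
  by rewrite mulrC.
elim: k => [|k IH]; first by rewrite expr0 m0.
by rewrite exprS (le_trans _ (key k)) // ler_wpM2l ?qf_ge0 ?IH.
Qed.

Lemma qfZ c x : qf (c *: x) = cabs c ^+ 2 * qf x.
Proof.
rewrite /qf (linZ (blinear P)) innerZl innerZr mulrA -cabs_sqr ReCM //.
Qed.

(** The supremum of the quadratic form over unit vectors need not be attained; a vector reaching
    half of it is enough, whence the 2. The zero vector covers the case where the form takes no
    positive value. *)
Lemma greedy_step (s : seq H) : exists x, [/\ {in s, forall z, [<x, z>] = 0},
  x = 0 \/ nr x = 1 & forall y, {in s, forall z, [<y, z>] = 0} ->
  qf y <= 2 * qf x * nr y ^+ 2].
Proof.
pose S := [set qf y | y in [set y : H | {in s, forall z, [<y, z>] = 0} /\ nr y = 1]].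
have [M [M0 hM]] := bbdd P.
have ub : ubound S M.
  move=> _ [y [_ y1] <-]; rewrite (le_trans (Re_le_cabs _)) // (le_trans (CS _ _)) //.
  by rewrite y1 mulr1 (le_trans (hM _)) // y1 mulr1.
have toS y : {in s, forall z, [<y, z>] = 0} -> nr y != 0 -> S (qf (unitv y)).
  move=> hy yN; exists (unitv y) => //; split.
    by move=> z zs; rewrite innerZl hy // mulr0.
  by rewrite nrZ cabs_ge0C ?invr_ge0 ?nr_ge0 // mulVf.
have scale y : qf y = qf (unitv y) * nr y ^+ 2.
  have [y0|yN] := eqVneq (nr y) 0.
    by rewrite y0 (nr_eq0 y0) expr0n mulr0 /qf inner0r.
  rewrite qfZ cabs_ge0C ?invr_ge0 ?nr_ge0 // mulrAC -exprMn mulVf // expr1n mul1r //.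
have [S0|Sy] := pselect (exists y : R, S y /\ 0 < y); last first.
  exists 0; split=> [z _|| y' hy']; [by rewrite inner0l|by left|].
  rewrite {2}/qf inner0r mulr0 mul0r scale.
  have [y0|yN] := eqVneq (nr y') 0; first by rewrite y0 expr0n mulr0.
  rewrite mulr_le0_ge0 ?sqr_ge0 // leNgt; apply/negP => h; apply: Sy.
  by exists (qf (unitv y')); split=> //; exact: toS.
have [w [Sw w0]] := S0.
have hS : has_sup S by split; [exists w | exists M].
have s0 : 0 < sup S / 2 by rewrite divr_gt0 // (lt_le_trans w0) // sup_upper_bound.
have [_ [x [hx x1] <-] hxs] := sup_adherent s0 hS.
exists x; split=> //; first by right.
move=> y hy; have [y0|yN] := eqVneq (nr y) 0; first by rewrite y0 (nr_eq0 y0) /qf inner0r expr0n mulr0.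
rewrite scale ler_wpM2r ?sqr_ge0 //.
have := sup_upper_bound hS (toS y hy yN); move: hxs; move: (sup S) (qf x) (qf _) => a b c; lra.
Qed.

Variables (p : nat) (t : R[i]).
Hypotheses (p0 : (0 < p)%N) (ht : has_trace (P ^+ p) t).

(** In a basis containing the nonzero [e k], the trace of [P ^+ p] dominates its diagonal entries
    there, and these dominate [qf (e k) ^+ p] by Jensen. Zero vectors contribute nothing because p
    is positive. *)
Lemma trace_bound (e : nat -> H) K : ons predT e ->
  \sum_(k < K) qf (e k) ^+ p <= complex.Re t.
Proof.
move=> [e0 e1]; pose r := [seq k <- iota 0 K | e k != 0].
have n1 k : e k != 0 -> nr (e k) = 1 by case: (e1 k isT) => // ->; rewrite eqxx.
have ee i j : e i != 0 -> [<e i, e j>] = (e i == e j)%:R.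
  move=> iN; have [ <-|ij] := eqVneq i j; first by rewrite eqxx inner_nr n1 // expr1n.
  rewrite e0 //; case: eqP => // eij; have := e0 i j isT isT ij.
  by rewrite -eij => /inner_eq0 ei; rewrite ei eqxx in iN.
have ho : orthonormal [set e k | k in [set k | e k != 0]].
  by move=> _ _ [i /= iN <-] [j /= jN <-]; rewrite ee.
have [E [sE hE]] := basis_extend ho.
have us : uniq (map e r).
  rewrite map_inj_in_uniq ?filter_uniq ?iota_uniq // => i j.
  rewrite !mem_filter => /andP[iN _] /andP[jN _] eij.
  apply: contrapT => /eqP ij; have := e0 i j isT isT ij.
  by rewrite ee // eij eqxx => /eqP; rewrite oner_eq0.
have rE : {in map e r, forall y, E y}.
  move=> y /mapP[k]; rewrite mem_filter => /andP[kN _] ->; apply: sE.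
  by exists k.
apply: le_trans (has_sum_ge (pow_ge0 p) (ht hE) us rE); rewrite big_map.
rewrite -(big_mkord xpredT (fun k => qf (e k) ^+ p)) /r big_filter /index_iota subn0.
rewrite (bigID (fun k => e k != 0)) /= [X in _ + X]big1 ?addr0.
  by apply: ler_sum => k kN; apply: jensen; exact: n1.
move=> k /negPn/eqP ->; rewrite /qf inner0r /=.
by rewrite expr0n; case: (p) p0.
Qed.

(* The greedy choice of [e] makes the quadratic form of [P] small off the first
   [e i]; off [P (e i)] as well, the norm of [P] itself is small. *)
Lemma greedy_approx : exists (u : nat -> H) (nu : nat -> R),
  [/\ ons predT u, forall k, 0 <= nu k, summable_seq (fun k => nu k ^+ p) &
   forall m x, (forall j, (j < m)%N -> [<x, u j>] = 0) -> nr (P x) <= nu m./2 * nr x].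
Proof.
have [e he] := seq_choice greedy_step.
have oe : ons predT e.
  apply: mkseq_ons => [n x _ xs|n _]; first by have [h _ _] := he n; apply: h.
  by have [_ h _] := he n.
pose nu k := 2 * qf (e k).
have nu0 k : 0 <= nu k by rewrite mulr_ge0 ?qf_ge0.
(* Interleaving puts both [e i] and [P (e i)] among the first m vectors for every i < m / 2; this is
   the origin of the index [m./2]. *)
pose v j := if odd j then P (e j./2) else e j./2.
have [u [ou vu]] := gram_schmidt v; exists u, nu; split=> //.
  split=> [k|]; first by rewrite exprn_ge0.
  exists (2 ^+ p * complex.Re t) => K; under eq_bigr do rewrite /nu exprMn.
  by rewrite -mulr_sumr ler_wpM2l ?exprn_ge0 // trace_bound.
move=> m x xu; set k := m./2.
have xv j : (j < m)%N -> [<x, v j>] = 0.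
  move=> jm; rewrite (vu _ _ jm) proj_perp' // => i; rewrite mem_iota add0n => im.
  exact: xu.
have km i : (i < k)%N -> ((i.*2).+1 < m)%N.
  by rewrite /k geq_half_double doubleS.
have xe i : (i < k)%N -> [<x, e i>] = 0.
  by move=> /km/ltnW im; have := xv _ im; rewrite /v odd_double doubleK.
have xPe i : (i < k)%N -> [<x, P (e i)>] = 0.
  by move=> /km im; have := xv _ im; rewrite /v /= odd_double /= uphalf_double.
have bnd y : (forall i, (i < k)%N -> [<y, e i>] = 0) -> qf y <= nu k * nr y ^+ 2.
  move=> ye; have [_ _] := he k; apply=> z /mapP[ i]; rewrite mem_iota add0n => ik ->.
  exact: ye.
(* Cauchy-Schwarz for P bounds the fourth power of |P x| by [qf x * qf (P x)]. Both x and P x are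
   orthogonal to the first [e i], the latter because x is orthogonal to [P (e i)]. *)
have := pos_CS x (P x); rewrite inner_nr cabs_ge0C ?sqr_ge0 //.
have h1 := bnd x xe; have h2 : qf (P x) <= nu k * nr (P x) ^+ 2.
  by apply: bnd => i ik; rewrite pos_sa xPe.
have [y0|yN] := eqVneq (nr (P x)) 0; first by rewrite y0 => _; rewrite mulr_ge0 ?nr_ge0.
have y0 : 0 < nr (P x) by rewrite lt_def yN nr_ge0.
move=> h3; rewrite -(@ler_pXn2r _ 2) ?nnegrE ?mulr_ge0 ?nr_ge0 ?qf_ge0 // exprMn.
rewrite -(ler_pM2r (exprn_gt0 2 y0)) -[leLHS]expr2 (le_trans h3) //.
apply: (le_trans (ler_pM (qf_ge0 _) (qf_ge0 _) h1 h2)).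
by rewrite mulrACA -expr2 mulrA.
Qed.
End PositiveOp.

Lemma sum_half (R : numDomainType) (f : nat -> R) M : (forall k, 0 <= f k) ->
  \sum_(m < M) f m./2 <= 2 * \sum_(k < M) f k.
Proof.
move=> f0; have -> : 2 * \sum_(k < M) f k = \sum_(m < M.*2) f m./2.
  elim: M => [|M IH]; first by rewrite !big_ord0 mulr0.
  rewrite doubleS !big_ord_recr /= mulrDr IH -addrA; congr (_ + _).
  by rewrite uphalf_double doubleK mulr2n mulrDl mul1r.
rewrite -!(big_mkord xpredT (fun m => f m./2)).
have MM : (M <= M.*2)%N by rewrite -addnn leq_addr.
by rewrite (big_cat_nat (leq0n M) MM) /= lerDl sumr_ge0.
Qed.

(** X is exhausted by [X * (1 - Q m)], with [Q m] the projection on the first m vectors found for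
    |X|: each step removes one rank one operator, and the norm bounds transfer because X and |X|
    have equal norms on every vector. *)
Lemma schatten_sch (R : realType) (H : hilbertType R) (p : nat) (X : bop H) :
  (0 < p)%N -> schatten p X -> sch p 1 X.
Proof.
move=> p0 [_ [P0 [Pb Ppos Pabs] [t ht]]].
pose P := Bop P0 Pb.
have PX x : nr (X x) = nr (P x).
  apply/eqP; rewrite -(@eqrXn2 _ 2) ?nr_ge0 //; apply/eqP.
  by rewrite !nr_sq -Pabs -[P0 (P0 x)]/(P (P x)) (@pos_sa _ _ P).
have htP : has_trace (P ^+ p) t.
  suff -> : bfun (P ^+ p) = iter p (comp P0) idfun by [].
  by elim: (p) => [|k IH] //=; rewrite -IH exprS.
have [u [nu [ou nu0 snu hnu]]] := @greedy_approx _ _ P Ppos p t p0 htP.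
pose Q m := \sum_(i <- iota 0 m) rank1 (u i) (u i).
have QE m x : Q m x = proj u (iota 0 m) x by rewrite bsumE.
have perp m x j : (j < m)%N -> [<(1 - Q m) x, u j>] = 0.
  move=> jm; rewrite bBE QE proj_perp ?iota_uniq ?mem_iota //.
  by apply: ons_sub ou.
have bd m k : (k <= m)%N -> bdd (X * (1 - Q m)) (nu k./2).
  move=> km; split=> // x; rewrite bME PX (le_trans (hnu k _ _)) //.
    by move=> j jk; apply: perp; exact: leq_trans jk km.
  rewrite ler_wpM2l // bBE QE nr_proj_le ?iota_uniq //; exact: ons_sub ou.
exists 1%N, (fun m => nu m./2), (fun m => X * (1 - Q m)),
  (fun m => [:: (X (u m), u m)]), 1, [:: fun m => nu m./2].
split=> //.
- split=> [|m|m|m].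
  + by rewrite /Q big_nil subr0 mulr1.
  + by split; apply: bd.
  + rewrite -mulrBr opprB addrC subrKA big_seq1 /= -rank1Ml; congr (_ * _).
    by rewrite /Q -addn1 iotaD big_cat /= big_seq1 addrAC subrr add0r.
  + split=> // q; rewrite inE => /eqP -> /=.
    have u1 : nr (u m) <= 1.
      by case: (ou.2 m isT) => [->|->] //; rewrite nr0.
    rewrite PX -[leRHS]mulr1 ler_pM ?nr_ge0 //.
    rewrite (le_trans (hnu m _ _)) // ?ler_piMr //.
    by move=> j jm; apply: ou.1 => //; rewrite gtn_eqF.
- move=> f [ <-|[]]; split=> [m|]; first exact: nu0.
  have [_ [C hC]] := snu; split=> [m|]; first exact: exprn_ge0.
  exists (2 * C) => M; rewrite (le_trans (sum_half (f := fun k => nu k ^+ p) _ _)) //.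
    by move=> k; exact: exprn_ge0.
  by rewrite ler_wpM2l.
- by move=> m; rewrite mul1r big_seq1.
Qed.

(** * Hilbert space tensor products *)

Section Extension.
Variables (R : realType) (M N : hilbertType R) (I : Type) (v : I -> M) (g : I -> N) (C : R).
Let V (s : seq (R[i] * I)) := \sum_(p <- s) p.1 *: v p.2.
Let G (s : seq (R[i] * I)) := \sum_(p <- s) p.1 *: g p.2.
Hypothesis C0 : 0 <= C.
Hypothesis approx : forall (x : M) (e : R), 0 < e -> exists s, nr (x - V s) <= e.
Hypothesis GV : forall s, nr (G s) <= C * nr (V s).

Let sc c (s : seq (R[i] * I)) := [seq (c * p.1, p.2) | p <- s].
Let V_cat s r : V (s ++ r) = V s + V r. Proof. exact: big_cat. Qed.
Let G_cat s r : G (s ++ r) = G s + G r. Proof. exact: big_cat. Qed.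
Let V_sc c s : V (sc c s) = c *: V s.
Proof. by rewrite /V big_map scaler_sumr; apply: eq_bigr => p _; rewrite scalerA. Qed.
Let G_sc c s : G (sc c s) = c *: G s.
Proof. by rewrite /G big_map scaler_sumr; apply: eq_bigr => p _; rewrite scalerA. Qed.
Let GVB s r : nr (G s - G r) <= C * nr (V s - V r).
Proof.
by have := GV (s ++ sc (-1) r); rewrite V_cat G_cat V_sc G_sc !scaleN1r.
Qed.

Let ext_point (x : M) : exists y, forall s, nr (y - G s) <= C * nr (x - V s).
Proof.
have /choice[r hr] (n : nat) : exists s, nr (x - V s) <= n.+1%:R^-1.
  by apply: approx; rewrite invr_gt0.
have C1 : 0 < 2 * (C + 1) by rewrite mulr_gt0 // ltr_wpDl.
have [e e0|y hy] := @complete_cvn R N (fun n => G (r n)).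
  have [|n hn] := invn_small (e := e / (2 * (C + 1))); first by rewrite divr_gt0.
  exists n => p q np nq; rewrite (le_trans (GVB _ _)) //.
  have h : nr (V (r p) - V (r q)) <= 2 * (e / (2 * (C + 1))).
    rewrite -(subrKA x) (le_trans (nrD _ _)) // nrB mulr2n mulrDl mul1r lerD //.
      by rewrite (le_trans (hr p)) ?hn.
    by rewrite (le_trans (hr q)) ?hn.
  rewrite (le_trans (ler_wpM2l C0 h)) //.
  have -> : C * (2 * (e / (2 * (C + 1)))) = e * (C / (C + 1)).
    by field; rewrite gt_eqF ?ltr_wpDl.
  by rewrite -[leRHS]mulr1 ler_wpM2l ?(ltW e0) // ler_pdivrMr ?ltr_wpDl // mul1r lerDl.
exists y => s; apply/ler_addgt0Pl => e e0.
have e2 : 0 < e / 2 by rewrite divr_gt0.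
have [n1 h1] := hy _ e2.
have [|n2 h2] := invn_small (e := e / (2 * (C + 1))); first by rewrite divr_gt0.
pose n := maxn n1 n2.
have {}h1 := h1 n (leq_maxl _ _).
have {}h2 := le_trans (hr n) (h2 n (leq_maxr _ _)).
rewrite -(subrKA (G (r n))) (le_trans (nrD _ _)) // nrB.
have h3 : nr (G (r n) - G s) <= C * (e / (2 * (C + 1))) + C * nr (x - V s).
  rewrite (le_trans (GVB _ _)) // -mulrDr ler_wpM2l // -(subrKA x).
  by rewrite (le_trans (nrD _ _)) // nrB lerD2r.
have h4 : C * (e / (2 * (C + 1))) <= e / 2.
  have -> : C * (e / (2 * (C + 1))) = e / 2 * (C / (C + 1)).
    by field; rewrite gt_eqF ?ltr_wpDl.
  by rewrite -[leRHS]mulr1 ler_wpM2l ?(ltW e2) // ler_pdivrMr ?ltr_wpDl // mul1r lerDl.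
by rewrite (le_trans (lerD h1 h3)) // addrA lerD2r [leRHS]splitr lerD2l.
Qed.

(** The estimate between formal linear combinations makes the assignment of [g i] to [v i] well
    defined, linear and continuous at once; [ext_point] gives its value at a limit. *)
Lemma extend : exists T : M -> N, [/\ linear T, bdd T C & forall i, T (v i) = g i].
Proof.
have /choice[T hT] := ext_point; exists T; split.
- move=> c x y; apply/eqP; rewrite -subr_eq0; apply/eqP/nr_le0 => e e0.
  pose K := 2 * (C * (cabs c + 1) + 1).
  have K0 : 0 < K by rewrite mulr_gt0 // ltr_wpDl // mulr_ge0 ?addr_ge0 ?cabs_ge0.
  have eK : 0 < e / K by rewrite divr_gt0.
  have [s hs] := approx x eK; have [r hr] := approx y eK.
  pose q := sc c s ++ r.
  have Vq : nr (c *: x + y - V q) <= (cabs c + 1) * (e / K).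
    rewrite V_cat V_sc opprD addrACA -scalerBr (le_trans (nrD _ _)) // nrZ.
    by rewrite mulrDl mul1r lerD // ler_wpM2l ?cabs_ge0.
  have h1 := le_trans (hT (c *: x + y) q) (ler_wpM2l C0 Vq).
  have h2 : nr (c *: T x + T y - G q) <= C * ((cabs c + 1) * (e / K)).
    rewrite G_cat G_sc opprD addrACA -scalerBr (le_trans (nrD _ _)) // nrZ.
    rewrite mulrDl mul1r mulrDr lerD //.
      rewrite mulrCA ler_wpM2l ?cabs_ge0 //; exact: le_trans (hT _ _) (ler_wpM2l C0 hs).
    exact: le_trans (hT _ _) (ler_wpM2l C0 hr).
  rewrite -(subrKA (G q)) (le_trans (nrD _ _)) // [X in _ + X]nrB (le_trans (lerD h1 h2)) //.
  have -> : C * ((cabs c + 1) * (e / K)) + C * ((cabs c + 1) * (e / K)) =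
     e * ((2 * (C * (cabs c + 1))) / K) by field; rewrite gt_eqF.
  rewrite -[leRHS]mulr1 ler_wpM2l ?(ltW e0) // ler_pdivrMr // mul1r /K [leRHS]mulrDr.
  by rewrite lerDl mulr_ge0.
- split=> // x; have := hT x [::]; by rewrite /V /G !big_nil !subr0.
- move=> i; apply/eqP; rewrite -subr_eq0; apply/eqP/nr_eq0/eqP; rewrite eq_le nr_ge0 andbT.
  by have := hT (v i) [:: (1, i)]; rewrite /V /G !big_seq1 /= !scale1r subrr nr0 mulr0.
Qed.
End Extension.

(** * Bilinear maps realizing a Hilbert tensor product *)

Section TensorMap.
Variable R : realType.
Implicit Types K L M N P Q : hilbertType R.

(** The axioms of [hilbertTensor] as a property of a bilinear map. In this form they pass to flipped
    and re-associated products, which is how the legs of operators are handled. *)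
Definition tensor_map K L M (t : K -> L -> M) := [/\
  forall l, linear (fun k => t k l), forall k, linear (t k),
  forall k l k' l', [<t k l, t k' l'>] = [<k, k'>] * [<l, l'>] &
  forall x (e : R), 0 < e -> exists s : seq (K * L), nr (x - \sum_(p <- s) t p.1 p.2) <= e].

Lemma tensor_map_flip K L M (t : K -> L -> M) : tensor_map t ->
  tensor_map (fun l k => t k l).
Proof.
move=> [l1 l2 ti ta]; split=> //; first by move=> *; rewrite ti mulrC.
move=> x e /(ta x)[s hs]; exists [seq (p.2, p.1) | p <- s]; by rewrite big_map.
Qed.

Lemma hilbertTensor_map K L (KL : hilbertTensor K L) : tensor_map (@tens _ _ _ KL).
Proof.
split; [exact: tens_linearl | exact: tens_linearr | exact: tens_inner |].
move=> x e e0; have eC : 0 < e%:C :> R[i] by rewrite ltcR.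
have [] := @tens_dense _ _ _ KL (ball x e%:C).
- by exists x; exact: ballxx.
- exact: ball_open.
move=> y [bxy [n [c [f [hf yE]]]]].
have /choice[kl hkl] : forall j, exists p : K * L, f j = tens KL p.1 p.2.
  by move=> j; have [k [l ->]] := hf j; exists (k, l).
exists [seq (c j *: (kl j).1, (kl j).2) | j <- index_enum 'I_n].
rewrite big_map /=; move: bxy; rewrite -ball_normE /ball_ /= nrE ltcR => /ltW.
rewrite yE; congr (nr (_ - _) <= _); apply: eq_bigr => j _.
by rewrite (linZ (tens_linearl _ _)) hkl.
Qed.

Section Theory.
Variables (K L M : hilbertType R) (t : K -> L -> M).
Hypothesis ht : tensor_map t.

Lemma nr_tensor k l : nr (t k l) = nr k * nr l.
Proof.
case: ht => _ _ ti _; apply/eqP; rewrite -(@eqrXn2 _ 2) ?mulr_ge0 ?nr_ge0 //; apply/eqP.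
by rewrite nr_sq ti !inner_nr -CM ReC exprMn.
Qed.

Lemma tensor_total x : (forall k l, [<x, t k l>] = 0) -> x = 0.
Proof.
case: ht => _ _ _ ta h; apply: nr_le0 => e e0; have [s hs] := ta x e e0.
have [->|xN] := eqVneq (nr x) 0; first exact: ltW.
have x0 : 0 < nr x by rewrite lt_def xN nr_ge0.
rewrite -(ler_pM2l x0) -expr2 (le_trans _ (ler_wpM2l (ltW x0) hs)) //.
have <- : complex.Re [<x, x - \sum_(p <- s) t p.1 p.2>] = nr x ^+ 2.
  by rewrite innerBr inner_sumr big1 ?subr0 ?nr_sq // => p _; exact: h.
exact: le_trans (Re_le_cabs _) (CS _ _).
Qed.

Lemma tensor_vec_ext x y : (forall k l, [<x, t k l>] = [<y, t k l>]) -> x = y.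
Proof.
move=> h; apply/eqP; rewrite -subr_eq0; apply/eqP/tensor_total => k l.
by rewrite innerBl h subrr.
Qed.

Lemma tensor_lin_ext N (f g : M -> N) A B : linear f -> linear g -> bdd f A -> bdd g B ->
  (forall k l, f (t k l) = g (t k l)) -> f = g.
Proof.
case: ht => _ _ _ ta fl gl [A0 fA] [B0 gB] fg; apply/funext => x.
apply/eqP; rewrite -subr_eq0; apply/eqP/nr_le0 => e e0.
have AB : 0 < A + B + 1 by rewrite ltr_wpDl // addr_ge0.
have [|s hs] := ta x (e / (A + B + 1)); first by rewrite divr_gt0.
set y := \sum_(p <- s) _ in hs.
have fgy : f y = g y by rewrite /y (lin_sum fl) (lin_sum gl); apply: eq_bigr.
have -> : f x - g x = f (x - y) - g (x - y).
  by rewrite (linB fl) (linB gl) fgy opprB addrA subrK.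
rewrite (le_trans (nrD _ _)) // nrN (le_trans (lerD (fA _) (gB _))) // -mulrDl.
rewrite (le_trans (ler_wpM2l _ hs)) ?addr_ge0 // mulrCA -[leRHS]mulr1.
by rewrite ler_wpM2l ?(ltW e0) // ler_pdivrMr // mul1r lerDl.
Qed.

Lemma tensor_bop_ext (f g : bop M) : (forall k l, f (t k l) = g (t k l)) -> f = g.
Proof.
move=> h; have [A hA] := bbdd f; have [B hB] := bbdd g.
have := tensor_lin_ext (blinear f) (blinear g) hA hB h.
by move=> fg; apply: bopP => x; rewrite fg.
Qed.

Lemma tensor_bop_eq (f g : bop M) :
  (forall k l k' l', [<f (t k l), t k' l'>] = [<g (t k l), t k' l'>]) -> f = g.
Proof. by move=> h; apply: tensor_bop_ext => k l; apply: tensor_vec_ext. Qed.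

Section Ext.
Variables (N : hilbertType R) (g : K -> L -> N) (B : L -> L -> R[i]) (C : R).
Hypotheses (C0 : 0 <= C) (gl : forall l, linear (fun k => g k l)) (gr : forall k, linear (g k)).
Hypothesis gi : forall k l k' l', [<g k l, g k' l'>] = [<k, k'>] * B l l'.
Hypothesis BC : forall l, complex.Re (B l l) <= C ^+ 2 * nr l ^+ 2.

Let rewrite_gs N' (h : K -> L -> N') (hl : forall l, linear (fun k => h k l))
    (hr : forall k, linear (h k)) (s : seq (R[i] * (K * L))) (u : nat -> K)
    (hu : forall n, (n < size s)%N ->
      (nth (0, (0, 0)) s n).2.1 = proj u (iota 0 (size s)) (nth (0, (0, 0)) s n).2.1) :
  \sum_(p <- s) p.1 *: h p.2.1 p.2.2 =
  \sum_(i <- iota 0 (size s)) h (u i) (\sum_(p <- s) (p.1 * [<p.2.1, u i>]) *: p.2.2).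
Proof.
transitivity (\sum_(p <- s) \sum_(i <- iota 0 (size s))
    (p.1 * [<p.2.1, u i>]) *: h (u i) p.2.2).
  rewrite !(big_nth (0, (0, 0))) !big_nat; apply: eq_bigr => n /andP[_ ns].
  rewrite {1}hu // /proj (lin_sum (hl _)) scaler_sumr; apply: eq_bigr => i _.
  by rewrite (linZ (hl _)) scalerA.
rewrite exchange_big /=; apply: eq_bigr => i _; rewrite (lin_sum (hr _)).
by apply: eq_bigr => p _; rewrite (linZ (hr _)).
Qed.

Let nr_gs N' (h : K -> L -> N') (D : L -> L -> R[i]) (u : nat -> K) (m : nat -> L) n :
  (forall k l k' l', [<h k l, h k' l'>] = [<k, k'>] * D l l') -> ons predT u ->
  nr (\sum_(i <- iota 0 n) h (u i) (m i)) ^+ 2 =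
  \sum_(i <- iota 0 n) nr (u i) ^+ 2 * complex.Re (D (m i) (m i)).
Proof.
move=> hD [u0 _]; rewrite nr_sq inner_suml.
rewrite (big_morph (@complex.Re R) (@ReD R) (erefl : complex.Re (0 : R[i]) = 0)).
rewrite big_seq [RHS]big_seq; apply: eq_bigr => i hi.
rewrite inner_sumr (bigD1_seq i) ?iota_uniq //= big1 ?addr0 => [|j ji].
  by rewrite hD inner_nr ReCM.
by rewrite hD u0 ?mul0r // eq_sym.
Qed.

(** Gram-Schmidt in the first leg rewrites a finite sum of simple tensors as a sum of u_i (x) m_i
    with orthogonal u_i; both norms then split into sums that are compared term by term. *)
Lemma tensor_extend : exists T : M -> N,
  [/\ linear T, bdd T C & forall k l, T (t k l) = g k l].
Proof.
case: ht => tl tr ti ta.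
have [|s|T [Tl Tb Tt]] := @extend R M N (K * L)%type (fun p => t p.1 p.2)
    (fun p => g p.1 p.2) C C0.
- move=> x e /(ta x)[s hs]; exists [seq (1, p) | p <- s].
  by rewrite big_map /=; under eq_bigr do rewrite scale1r.
- have [u [ou vu]] := gram_schmidt (fun n => (nth (0, (0, 0)) s n).2.1).
  have hu n : (n < size s)%N -> (nth (0, (0, 0)) s n).2.1 =
      proj u (iota 0 (size s)) (nth (0, (0, 0)) s n).2.1 by exact: vu.
  rewrite (rewrite_gs gl gr hu) (rewrite_gs tl tr hu).
  rewrite -(@ler_pXn2r _ 2) ?nnegrE ?mulr_ge0 ?nr_ge0 // exprMn.
  rewrite (nr_gs _ _ gi ou) (nr_gs _ _ ti ou) mulr_sumr; apply: ler_sum => i _.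
  by rewrite -nr_sq mulrCA ler_wpM2l ?sqr_ge0.
by exists T; split=> // k l; exact: (Tt (k, l)).
Qed.
End Ext.

Lemma tensor_id_op N (V : L -> N) (Q : hilbertType R) (q : K -> N -> Q) A :
  linear V -> bdd V A -> tensor_map q ->
  exists T : M -> Q, [/\ linear T, bdd T A & forall k l, T (t k l) = q k (V l)].
Proof.
move=> Vl [A0 VA] [ql qr qi qa].
apply: (@tensor_extend _ _ (fun l l' => [<V l, V l'>]) A A0).
- by move=> l; exact: ql.
- by move=> k c l l'; rewrite Vl qr.
- by move=> *; rewrite qi.
- by move=> l; rewrite -nr_sq -exprMn ler_pXn2r ?nnegrE ?mulr_ge0 ?nr_ge0.
Qed.
End Theory.

Lemma tn_ex K L M (t : K -> L -> M) (ht : tensor_map t) (T : bop K) (S : bop L) :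
  exists V : bop M, forall k l, V (t k l) = t (T k) (S l).
Proof.
have [A hA] := bbdd S; have [B hB] := bbdd T.
have [V [Vl Vb VE]] := tensor_id_op ht (blinear S) hA ht.
(* T (x) S is the product of T (x) 1 and 1 (x) S, and T (x) 1 is an instance of 1 (x) T after
   flipping the legs. *)
have [W [Wl Wb WE]] := tensor_id_op (tensor_map_flip ht) (blinear T) hB (tensor_map_flip ht).
have Vo : bounded_op V by apply/bounded_opP; split => //; exists A.
have Wo : bounded_op W by apply/bounded_opP; split => //; exists B.
by exists (Bop W Wo * Bop V Vo) => k l; rewrite bME /= VE WE.
Qed.
Definition tn K L M (t : K -> L -> M) (ht : tensor_map t) T S : bop M :=
  projT1 (cid (tn_ex ht T S)).

Section Tn.
Variables (K L M : hilbertType R) (t : K -> L -> M).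
Hypothesis ht : tensor_map t.
Implicit Types (T : bop K) (S : bop L).
Let tl := let: And4 tl _ _ _ := ht in tl.
Let tr := let: And4 _ tr _ _ := ht in tr.
Let ti := let: And4 _ _ ti _ := ht in ti.
Local Notation tn := (tn ht).

Lemma tnE T S k l : tn T S (t k l) = t (T k) (S l).
Proof. by rewrite /tn; case: cid. Qed.
Lemma tn_uniq (V : bop M) T S : (forall k l, V (t k l) = t (T k) (S l)) -> V = tn T S.
Proof. by move=> h; apply: (tensor_bop_ext ht) => k l; rewrite h tnE. Qed.
Lemma tnM T S T' S' : tn T S * tn T' S' = tn (T * T') (S * S').
Proof. by apply: tn_uniq => k l; rewrite bME !tnE. Qed.
Lemma tn11 : tn 1 1 = 1. Proof. by apply/esym/tn_uniq. Qed.
Lemma tnDr T S S' : tn T (S + S') = tn T S + tn T S'.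
Proof. by apply/esym/tn_uniq => k l; rewrite !bDE !tnE (linD (tr _)). Qed.
Lemma tnZl c T S : tn (c *: T) S = c *: tn T S.
Proof. by apply/esym/tn_uniq => k l; rewrite !bZE !tnE (linZ (tl _)). Qed.
Lemma tnZr c T S : tn T (c *: S) = c *: tn T S.
Proof. by apply/esym/tn_uniq => k l; rewrite !bZE !tnE (linZ (tr _)). Qed.
Lemma tnNr T S : tn T (- S) = - tn T S.
Proof. by rewrite -scaleN1r tnZr scaleN1r. Qed.
Lemma tnBr T S S' : tn T (S - S') = tn T S - tn T S'.
Proof. by rewrite tnDr tnNr. Qed.
Lemma adj_tn T S : adj (tn T S) = tn (adj T) (adj S).
Proof.
apply: (tensor_bop_eq ht) => k l k' l'.
by rewrite adjP' !tnE !ti -!adjP'.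
Qed.
Lemma inner_tn T S k l k' l' : [<tn T S (t k l), t k' l'>] = [<T k, k'>] * [<S l, l'>].
Proof. by rewrite tnE ti. Qed.
End Tn.

(* With [a] = flipped tensor of KK this yields the structure behind leg 13. *)
Lemma tensor_assoc K1 K2 L P Q M (a : K1 -> K2 -> P) (b : P -> L -> M) (c : K2 -> L -> Q) :
  tensor_map a -> tensor_map b -> tensor_map c ->
  exists J : K1 -> Q -> M, tensor_map J /\
    forall k1 k2 l, J k1 (c k2 l) = b (a k1 k2) l.
Proof.
move=> ha hb hc; have [al ar ai aa] := ha; have [bl br bi ba] := hb.
have [cl cr ci ca] := hc.
have /choice[J hJ] (k1 : K1) : exists T : Q -> M,
    [/\ linear T, bdd T (nr k1) & forall k l, T (c k l) = b (a k1 k) l].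
  apply: (@tensor_extend _ _ _ _ hc _ _ (fun l l' => [<k1, k1>] * [<l, l'>])).
  - exact: nr_ge0.
  - by move=> l x k k'; rewrite ar bl.
  - by move=> k; exact: br.
  - by move=> k l k' l'; rewrite bi ai mulrCA mulrA.
  - by move=> l; rewrite inner_nr ReCM -nr_sq.
have Jl k1 : linear (J k1) by case: (hJ k1).
have JE k1 k2 l : J k1 (c k2 l) = b (a k1 k2) l by case: (hJ k1).
exists J; split=> //; split=> //.
- move=> q x k k'; have [_ h1 _] := hJ (x *: k + k'); have [_ h2 _] := hJ k.
  have [_ h3 _] := hJ k'.
  have h4 := bddD (bddZ x h2) h3.
  apply: (congr1 (fun f => f q) (tensor_lin_ext hc (Jl _) _ h1 h4 _)).
    by move=> y u v; rewrite !Jl scalerDr !scalerA mulrC -!scalerA addrACA scalerDr.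
  by move=> k2 l; rewrite !JE al bl.
- move=> k q k' q'.
  have [_ h1 _] := hJ k; have [_ h2 _] := hJ k'.
  (* For fixed k and k' the form <J k x, J k' y> belongs to a bounded operator on Q, which agrees
     with the scalar <k, k'> on simple tensors and hence everywhere. *)
  have [|x y z|x y z|x y|T [Tl Tb TE]] :=
      @form_op R Q Q (fun x y => [<J k x, J k' y>]) (nr k * nr k').
  - by rewrite mulr_ge0 ?nr_ge0.
  - by move=> w; rewrite Jl innerDl innerZl.
  - by move=> w; rewrite Jl innerDr innerZr.
    have -> : nr k * nr k' * nr x * nr y = (nr k * nr x) * (nr k' * nr y) by ring.
    by rewrite (le_trans (CS _ _)) // ler_pM ?nr_ge0 //; [exact: h1.2|exact: h2.2].
  have To : bounded_op T by apply/bounded_opP; split=> //; eexists; exact: Tb.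
  have -> : [<J k q, J k' q'>] = [<Bop T To q, q'>] by rewrite /= TE.
  have -> : Bop T To = [<k, k'>] *: (1 : bop Q).
    apply: (tensor_bop_eq hc) => k2 l k2' l'.
    by rewrite [LHS]/= TE !JE bi ai bZE innerZl b1E ci mulrA.
  by rewrite bZE innerZl.
- move=> x e e0; have e2 : 0 < e / 2 by rewrite divr_gt0.
  have [s hs] := ba x _ e2.
  have apx (p : P * L) (d : R) : 0 < d ->
      exists r : seq (K1 * Q), nr (b p.1 p.2 - \sum_(q <- r) J q.1 q.2) <= d.
    move=> d0; have n1 : 0 < nr p.2 + 1 by rewrite ltr_wpDl // nr_ge0.
    have [|r hr] := aa p.1 (d / (nr p.2 + 1)); first by rewrite divr_gt0.
    exists [seq (q.1, c q.2 p.2) | q <- r]; rewrite big_map /=.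
    under eq_bigr do rewrite JE.
    have -> : \sum_(j <- r) b (a j.1 j.2) p.2 = b (\sum_(j <- r) a j.1 j.2) p.2.
      by rewrite (lin_sum (bl p.2)).
    rewrite -(linB (bl p.2)).
    rewrite (nr_tensor hb) (le_trans (ler_wpM2r (nr_ge0 _) hr)) // mulrAC -mulrA.
    by rewrite -[leRHS]mulr1 ler_wpM2l ?(ltW d0) // ler_pdivrMr // mul1r lerDl.
  have [r hr] : exists r : seq (K1 * Q),
      nr (\sum_(p <- s) b p.1 p.2 - \sum_(q <- r) J q.1 q.2) <= e / 2.
    elim: s (e / 2) e2 {hs} => [|p s IH] d d0.
      by exists [::]; rewrite !big_nil subr0 nr0 ltW.
    have d2 : 0 < d / 2 by rewrite divr_gt0.
    have [r1 h1] := IH _ d2; have [r2 h2] := apx p _ d2.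
    exists (r2 ++ r1); rewrite big_cons big_cat /= opprD addrACA (le_trans (nrD _ _)) //.
    by rewrite (splitr d) lerD.
  exists r; rewrite -(subrKA (\sum_(p <- s) b p.1 p.2)) (le_trans (nrD _ _)) //.
  by rewrite (splitr e) lerD.
Qed.

End TensorMap.

(** * C*-algebras and their representations *)

Section CStar.
Variables (R : realType) (A : cstarAlgType R).
Implicit Types (a b x y z : A).

Lemma starD a b : star (a + b) = star a + star b.
Proof. by rewrite -{1}[a]scale1r star_antilinear conjC1 scale1r. Qed.
Lemma star0 : star (0 : A) = 0.
Proof. by apply: (@addrI _ (star 0)); rewrite -starD !addr0. Qed.
Lemma starZ c a : star (c *: a) = Num.conj c *: star a.
Proof. by rewrite -[c *: a]addr0 star_antilinear star0 addr0. Qed.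
Lemma starN a : star (- a) = - star a.
Proof. by rewrite -scaleN1r starZ conjN conjC1 scaleN1r. Qed.
Lemma starB a b : star (a - b) = star a - star b.
Proof. by rewrite starD starN. Qed.
Lemma star1 : star (1 : A) = 1.
Proof. by rewrite -[LHS]mul1r -{1}(starK 1) -starM mul1r starK. Qed.
Lemma star_sum (I : Type) (s : seq I) (F : I -> A) :
  star (\sum_(i <- s) F i) = \sum_(i <- s) star (F i).
Proof. by apply: (big_morph (@star R A)); [exact: starD|exact: star0]. Qed.

Lemma cnormZr c a : cnorm (c *: a) = cabs c * cnorm a.
Proof. by apply: (@complexI R); rewrite cnormZ CM cabsE. Qed.
Lemma cnorm0 : cnorm (0 : A) = 0.
Proof. by rewrite -(scale0r (0 : A)) cnormZr cabs0 mul0r. Qed.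
Lemma cnormN a : cnorm (- a) = cnorm a.
Proof. by rewrite -scaleN1r cnormZr cabsN cabs1 mul1r. Qed.
Lemma cnormB a b : cnorm (a - b) = cnorm (b - a).
Proof. by rewrite -cnormN opprB. Qed.
Lemma cnorm_star a : cnorm (star a) = cnorm a.
Proof.
have le b : cnorm b <= cnorm (star b).
  have [->|bN] := eqVneq (cnorm b) 0; first exact: cnorm_ge0.
  have b0 : 0 < cnorm b by rewrite lt_def bN cnorm_ge0.
  by rewrite -(ler_pM2r b0) -expr2 -cstar_identity cnormM.
by apply/eqP; rewrite eq_le le andbT -{2}(starK a) le.
Qed.
Lemma cnorm1 : cnorm (1 : A) = 1.
Proof.
have n1 : cnorm (1 : A) != 0 by apply/eqP => /cnorm_eq0/eqP; rewrite oner_eq0.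
apply: (mulfI n1); rewrite mulr1 -expr2 -cstar_identity star1 mulr1 //.
Qed.
Lemma cnorm_le0 a : (forall e, 0 < e -> cnorm a <= e) -> a = 0.
Proof.
move=> h; apply: cnorm_eq0; apply/eqP; rewrite eq_le cnorm_ge0 andbT.
apply/ler_addgt0Pl => e e0; rewrite addr0; exact: h.
Qed.
Lemma cnorm_sq a : star a = a -> cnorm (a * a) = cnorm a ^+ 2.
Proof. by move=> {1}<-; exact: cstar_identity. Qed.

Section Sqrt.
Variable y : A.
Hypotheses (ys : star y = y) (y1 : cnorm y <= 1).

(** A limit t satisfies 2 t = y + t^2, so that 1 - t is a square root of 1 - y. The scalars [s]
    follow the same recursion for y = 1; they increase, stay below 1 and dominate the increments of
    [r]. *)
Let r := fix r n : A := if n is m.+1 then (2^-1)%:C *: (y + r m * r m) else 0.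
Let s := fix s n : R := if n is m.+1 then 2^-1 * (1 + s m ^+ 2) else 0.

Let s01 n : 0 <= s n <= 1.
Proof. by elim: n => [|n /= /andP[h1 h2]]; [rewrite lexx ler01 | apply/andP; split; nra]. Qed.
Let half a : cnorm ((2^-1)%:C *: a) = 2^-1 * cnorm a.
Proof. by rewrite cnormZr cabs_ge0C ?invr_ge0. Qed.
Let r_s n : cnorm (r n) <= s n.
Proof.
elim: n => [|n IH] /=; first by rewrite cnorm0.
rewrite half ler_wpM2l ?invr_ge0 // (le_trans (cnormD _ _)) // lerD //.
by rewrite (le_trans (cnormM _ _)) // expr2 ler_pM ?cnorm_ge0.
Qed.
Let rd n : cnorm (r n.+1 - r n) <= s n.+1 - s n.
Proof.
elim: n => [|n IH].
  rewrite /= !subr0 mulr0 addr0 expr0n /= addr0 half ler_wpM2l ?invr_ge0 //.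
have -> : r n.+2 - r n.+1 = (2^-1)%:C *: ((r n.+1 - r n) * r n.+1 + r n * (r n.+1 - r n)).
  rewrite -[r n.+2]/((2^-1)%:C *: (y + r n.+1 * r n.+1)).
  rewrite -[X in _ - X]/((2^-1)%:C *: (y + r n * r n)) -scalerBr; congr (_ *: _).
  by rewrite mulrBl mulrBr subrKA opprD addrACA subrr add0r.
have -> : s n.+2 - s n.+1 = 2^-1 * ((s n.+1 - s n) * s n.+1 + s n * (s n.+1 - s n)).
  rewrite -[s n.+2]/(2^-1 * (1 + s n.+1 ^+ 2)).
  rewrite -[X in _ - X]/(2^-1 * (1 + s n ^+ 2)); ring.
rewrite half ler_wpM2l ?invr_ge0 // (le_trans (cnormD _ _)) // lerD //.
  by rewrite (le_trans (cnormM _ _)) // ler_pM ?cnorm_ge0.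
by rewrite (le_trans (cnormM _ _)) // ler_pM ?cnorm_ge0.
Qed.
Let sd_ge0 n : 0 <= s n.+1 - s n. Proof. exact: le_trans (cnorm_ge0 _) (rd n). Qed.
Let rpq p q : (q <= p)%N -> cnorm (r p - r q) <= \sum_(q <= m < p) (s m.+1 - s m).
Proof.
move=> qp; have -> : r p - r q = \sum_(q <= m < p) (r m.+1 - r m).
  by rewrite telescope_sumr.
apply: (big_ind2 (fun a t => cnorm a <= t)) => [|a u b v h1 h2|m _]; last exact: rd.
  by rewrite cnorm0.
by rewrite (le_trans (cnormD _ _)) // lerD.
Qed.

Lemma sqrt_one_minus : exists d, [/\ star d = d, d * d = 1 - y, cnorm (1 - d) <= 1 &
  forall z, z * y = y * z -> z * d = d * z].
Proof.
have hs : summable_seq (fun m => s m.+1 - s m).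
  split=> //; exists 1 => M; rewrite -(big_mkord xpredT (fun m => s m.+1 - s m)).
  by rewrite telescope_sumr // subr0; case/andP: (s01 M).
have [e e0|t ht] := @cnorm_complete R A r.
  have [N hN] := summable_tail hs e0; exists N => p q; wlog qp : p q / (q <= p)%N.
    move=> hw; case/orP: (leq_total q p) => qp Np Nq; first exact: hw.
    by rewrite cnormB; apply: hw.
  by move=> Np Nq; rewrite (le_trans (rpq qp)) // hN.
have near (e : R) : 0 < e -> exists N, forall n, (N <= n)%N -> cnorm (r n - t) <= e by exact: ht.
have t1 : cnorm t <= 1.
  apply/ler_addgt0Pl => e /near[N /(_ _ (leqnn N)) hN].
  rewrite -[t](subKr (r N)) addrC -[_ + r N]addrC (le_trans (cnormD _ _)) // addrC.
  rewrite cnormN; apply: lerD => //; apply: le_trans (r_s N) _; by case/andP: (s01 N).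
have small (K e : R) : 0 < e -> 0 <= K -> exists2 d : R, 0 < d & K * d <= e.
  move=> e0 K0; have K1 : 0 < K + 1 by rewrite ltr_wpDl.
  exists (e / (K + 1)); first by rewrite divr_gt0.
  by rewrite mulrCA -[leRHS]mulr1 ler_wpM2l ?(ltW e0) // ler_pdivrMr // mul1r lerDl.
have teq : t = (2^-1)%:C *: (y + t * t).
  apply/eqP; rewrite -subr_eq0; apply/eqP/cnorm_le0 => e e0.
  have [d d0 hd] := small 2 e e0 (ler0n _ _); have [N hN] := near d d0.
  have h1 := hN N.+1 (leqnSn _); have h2 := hN N (leqnn _).
  have -> : t - (2^-1)%:C *: (y + t * t) =
     - (r N.+1 - t) + (2^-1)%:C *: ((r N - t) * r N + t * (r N - t)).
    rewrite mulrBl mulrBr subrKA opprB -addrA; congr (_ + _).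
    have -> : r N.+1 = (2^-1)%:C *: (y + r N * r N) by [].
    by rewrite -!scalerN -scalerDr !opprD subrKA.
  rewrite (le_trans (cnormD _ _)) // cnormN half (le_trans _ hd) // (_ : 2 * d = d + d); last by ring.
  apply: lerD => //.
  have h3 : cnorm ((r N - t) * r N + t * (r N - t)) <= d * 1 + 1 * d.
    rewrite (le_trans (cnormD _ _)) // lerD // (le_trans (cnormM _ _)) // ler_pM ?cnorm_ge0 //.
    by apply: le_trans (r_s N) _; case/andP: (s01 N).
  by rewrite -(ler_pM2l (ltr0n R 2)) mulrA mulfV ?mul1r // (le_trans h3) // mulr1 mul1r -mulr2n mulr_natl.
exists (1 - t); split.
- rewrite starB star1; congr (_ - _); apply/eqP; rewrite -subr_eq0; apply/eqP/cnorm_le0 => e e0.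
  have rs n : star (r n) = r n.
    by elim: n => [|n IH] /=; rewrite ?star0 // starZ starD starM IH ys conj_real.
  have [d d0 hd] := small 2 e e0 (ler0n _ _); have [N /(_ N (leqnn _)) hN] := near d d0.
  have -> : star t - t = - star (r N - t) + (r N - t) by rewrite starB rs opprB subrKA.
  rewrite (le_trans (cnormD _ _)) // cnormN cnorm_star (le_trans _ hd) //.
  by rewrite mulr2n mulrDl mul1r lerD.
- have h2 : 2%:R *: t = y + t * t.
    rewrite {1}teq scalerA; have -> : 2%:R * (2^-1)%:C = 1 :> R[i]; last by rewrite scale1r.
    by rewrite -(rmorph_nat (real_complex R)) -CM mulfV.
  have {}h2 : t + t = y + t * t by rewrite -h2 scaler_nat mulr2n.
  rewrite mulrBl mul1r mulrBr mulr1 -addrA; congr (_ + _).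
  rewrite opprB addrCA -[- t - t]opprD h2 opprD addrCA subrr addr0 //.
- by rewrite opprB addrC subrK.
- move=> z zy; have zr n : z * r n = r n * z.
    elim: n => [|n IH] /=; first by rewrite mulr0 mul0r.
    by rewrite -scalerAr -scalerAl mulrDr mulrDl zy mulrA IH -mulrA IH mulrA.
  rewrite mulrBr mulrBl mulr1 mul1r; congr (_ - _).
  apply/eqP; rewrite -subr_eq0; apply/eqP/cnorm_le0 => e e0.
  have [|d d0 hd] := small (2 * cnorm z) e e0; first by rewrite mulr_ge0 ?cnorm_ge0.
  have [N /(_ N (leqnn _)) hN] := near d d0.
  have -> : z * t - t * z = - (z * (r N - t)) + (r N - t) * z.
    by rewrite mulrBr mulrBl zr opprB subrKA.
  rewrite (le_trans (cnormD _ _)) // cnormN (le_trans _ hd) //.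
  have -> : 2 * cnorm z * d = cnorm z * d + d * cnorm z by ring.
  by rewrite lerD // (le_trans (cnormM _ _)) // ler_pM ?cnorm_ge0.
Qed.
End Sqrt.

(** For u = x + i d, commutation makes [star u * u] the scalar [M ^+ 2], so u has norm M by the
    C*-identity; x and d are its real and imaginary parts. *)
Lemma cnorm_sum_squares x d (M : R) : star x = x -> star d = d -> x * d = d * x ->
  x * x + d * d = (M ^+ 2)%:C *: 1 -> 0 <= M -> cnorm x <= M /\ cnorm d <= M.
Proof.
move=> xs ds xd xxdd M0.
pose u := x + 'i *: d; have su : star u = x - 'i *: d.
  rewrite starD starZ xs ds; congr (_ + _); rewrite -scaleNr; congr (_ *: _).
  by apply/eqP; rewrite conjE eq_complex /= !oppr0 !eqxx.
have ii : 'i * 'i = -1 :> R[i] by rewrite -expr2 sqr_i.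
have uu : star u * u = (M ^+ 2)%:C *: 1.
  rewrite su mulrBl !mulrDr -!scalerAl -!scalerAr scalerA ii scaleN1r -xxdd.
  by rewrite xd opprD opprK addrA addrK.
have nu : cnorm u = M.
  apply/eqP; rewrite -(@eqrXn2 _ 2) ?cnorm_ge0 //; apply/eqP.
  by rewrite -cstar_identity uu cnormZr cnorm1 mulr1 cabs_ge0C ?sqr_ge0.
have ns : cnorm (star u) = M by rewrite cnorm_star.
have i1 : cabs ('i : R[i]) = 1 by rewrite /cabs normc_def /= expr0n expr1n add0r sqrtr1.
have i2 : 0 < 2 :> R by [].
split; rewrite -(ler_pM2l i2).
  have -> : 2 * cnorm x = cnorm (u + star u).
    have -> : u + star u = 2%:R *: x by rewrite su /u addrACA subrr addr0 scaler_nat mulr2n.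
    by rewrite cnormZr -(rmorph_nat (real_complex R)) cabs_ge0C.
  by rewrite (le_trans (cnormD _ _)) // nu ns mulr2n mulrDl mul1r.
have -> : 2 * cnorm d = cnorm (u - star u).
  have -> : u - star u = 2%:R *: ('i *: d).
    by rewrite su /u opprB addrC subrKA scaler_nat mulr2n.
  by rewrite !cnormZr i1 mul1r -(rmorph_nat (real_complex R)) cabs_ge0C.
by rewrite (le_trans (cnormD _ _)) // cnormN nu ns mulr2n mulrDl mul1r.
Qed.

Section Hom.
Variables (H : hilbertType R).
Definition star_hom (psi : A -> bop H) := [/\ linear psi, psi 1 = 1,
  forall a b, psi (a * b) = psi a * psi b & forall a, psi (star a) = adj (psi a)].
Variable psi : A -> bop H.
Hypothesis hp : star_hom psi.

(** For |b| <= 1 write [1 - star b * b = d * d] with d self-adjoint: then |v|^2 - |psi b v|^2 is the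
    square |psi d v|^2. *)
Lemma hom_contractive a : bdd (psi a) (cnorm a).
Proof.
have [pl p1 pM ps] := hp.
have key b : cnorm b <= 1 -> forall v, nr (psi b v) <= nr v.
  move=> b1 v; have [||d [ds dd _ _]] := @sqrt_one_minus (star b * b).
  - by rewrite starM starK.
  - by rewrite cstar_identity exprn_ile1 ?cnorm_ge0.
  rewrite -(@ler_pXn2r _ 2) ?nnegrE ?nr_ge0 // -subr_ge0.
  suff -> : nr v ^+ 2 - nr (psi b v) ^+ 2 = nr (psi d v) ^+ 2 by exact: sqr_ge0.
  have -> : nr (psi d v) ^+ 2 = complex.Re [<psi (d * d) v, v>].
    by rewrite nr_sq pM bME [in RHS]adjP -ps ds.
  have -> : nr (psi b v) ^+ 2 = complex.Re [<psi (star b * b) v, v>].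
    by rewrite nr_sq pM bME ps adjP'.
  by rewrite nr_sq dd (linB pl) p1 bBE innerBl ReD ReN.
split=> [|v]; first exact: cnorm_ge0.
have [a0|aN] := eqVneq (cnorm a) 0.
  by rewrite a0 (cnorm_eq0 _ a0) (lin0 pl) b0E nr0 mul0r.
have := key ((cnorm a)^-1%:C *: a); rewrite cnormZr cabs_ge0C ?invr_ge0 ?cnorm_ge0 //.
rewrite mulVf // => /(_ (lexx _) v); rewrite (linZ pl) bZE nrZ.
rewrite cabs_ge0C ?invr_ge0 ?cnorm_ge0 // mulrC ler_pdivrMr; first by rewrite mulrC.
by rewrite lt_def aN cnorm_ge0.
Qed.

Hypothesis inj : injective psi.

(* If psi x is positive then so is x: |x| and x have the same image, because a
   positive operator is the only positive square root of its square. *)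
Lemma positive_square x : star x = x -> (forall v, 0 <= [<psi x v, v>]) ->
  exists g, [/\ star g = g, g * g = x & forall z, z * x = x * z -> z * g = g * z].
Proof.
move=> xs xp; have [pl p1 pM ps] := hp.
wlog x1 : x xs xp / cnorm x <= 1.
  move=> hw; have [|x1] := leP (cnorm x) 1; first exact: hw.
  have x0 : 0 < cnorm x by rewrite (lt_trans ltr01).
  pose c := Num.sqrt (cnorm x).
  have cc : c%:C * c%:C = (cnorm x)%:C :> R[i] by rewrite -CM -expr2 sqr_sqrtr // ltW.
  have [|v||g [gs gg gc]] := hw ((cnorm x)^-1%:C *: x).
  - by rewrite starZ conj_real xs.
  - by rewrite (linZ pl) bZE innerZl mulr_ge0 // lecR invr_ge0 ltW.
  - by rewrite cnormZr cabs_ge0C ?invr_ge0 ?(ltW x0) // mulVf ?gt_eqF.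
  exists (c%:C *: g); split=> [||z zx].
  - by rewrite starZ conj_real gs.
  - by rewrite -scalerAl -scalerAr scalerA cc gg scalerA -CM mulfV ?scale1r ?gt_eqF.
  - rewrite -scalerAl -scalerAr gc // -scalerAl -scalerAr zx //.
(* The iteration only gives roots of elements 1 - y. With d the root of 1 - x^2, the root q of 1 -
   d^2 plays the part of |x|, and the root of 1 - (1 - q) is a root of q. The bound on the norm of d
   comes from [cnorm_sum_squares]. *)
have [||d [ds dd _ dc]] := @sqrt_one_minus (x * x).
- by rewrite starM xs.
- by rewrite cnorm_sq // exprn_ile1 ?cnorm_ge0.
have xd : x * d = d * x by apply: dc; rewrite mulrA.
have xxdd : x * x + d * d = (1 ^+ 2)%:C *: 1 by rewrite dd addrC subrK expr1n scale1r.
have [_ d1] := cnorm_sum_squares xs ds xd xxdd ler01.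
have [||q [qs qq q1 qc]] := @sqrt_one_minus (d * d).
- by rewrite starM ds.
- by rewrite cnorm_sq // exprn_ile1 ?cnorm_ge0.
have [||g [gs gg _ gc]] := @sqrt_one_minus (1 - q).
- by rewrite starB star1 qs.
- exact: q1.
have {}gg : g * g = q by rewrite gg subKr.
have {}qq : q * q = x * x by rewrite qq dd subKr.
have zq z : z * x = x * z -> z * q = q * z.
  move=> zx; apply: qc; rewrite dd mulrBr mulrBl mulr1 mul1r.
  by rewrite mulrA zx -mulrA zx mulrA.
suff qx : q = x.
  exists g; split; rewrite ?gg //; move=> z zx; apply: gc.
  by rewrite mulrBr mulrBl mulr1 mul1r zq.
apply: inj.
pose X := psi x; pose Y := psi q.
have Yp v : 0 <= [<Y v, v>] by rewrite /Y -gg pM bME adjP -ps gs inner_ge0.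
have XY : X * Y = Y * X by rewrite -!pM zq.
(* On w = (Y - X) v the sum of the two positive forms vanishes, hence each does, hence Y w = X w =
   0; then <w, w> = <v, (Y - X) w> = 0. *)
have D0 : (Y + X) * (Y - X) = 0.
  by rewrite mulrDl !mulrBr XY addrA subrK -!pM qq subrr.
have DE : adj (Y - X) = Y - X.
  apply: adj_uniq => u v; rewrite !bBE innerBl innerBr.
  by rewrite (pos_sa Yp) (pos_sa (P := X) xp).
apply/eqP; rewrite -subr_eq0; apply/eqP/bopP => v; rewrite -/X -/Y b0E.
set w := (Y - X) v; apply: inner_eq0.
have w0 : [<Y w, w>] + [<X w, w>] = 0.
  by rewrite -innerDl -bDE -bME D0 b0E inner0l.
have Xw := xp w; have Yw := Yp w.
have kill (T : bop H) : (forall v, 0 <= [<T v, v>]) -> [<T w, w>] = 0 -> T w = 0.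
  move=> Tp Tw; apply: inner_eq0; apply: cabs_eq0; apply/eqP.
  have := pos_CS Tp w (T w); rewrite /qf Tw mul0r => h.
  by rewrite -sqrf_eq0 eq_le h sqr_ge0.
have Yw0 : [<Y w, w>] = 0.
  by apply/eqP; rewrite eq_le Yw andbT -w0 lerDl.
have Xw0 : [<X w, w>] = 0 by move: w0; rewrite Yw0 add0r.
rewrite {1}/w adjP DE bBE (kill Y) // (kill X) // subrr inner0r //.
Qed.

(** With h = a^* a, both h and M^2 - h have positive images and are therefore squares of commuting
    self-adjoint k and g. As k^2 + g^2 = M^2, the norm of k is at most M, and |a|^2 = |h| =
    |k|^2. *)
Lemma hom_isometric a M : bdd (psi a) M -> cnorm a <= M.
Proof.
have [pl p1 pM ps] := hp; move=> [M0 hM].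
pose h := star a * a; pose x := (M ^+ 2)%:C *: 1 - h.
have hs : star h = h by rewrite starM starK.
have [v|k [ks kk kc]] := positive_square hs.
  by rewrite pM bME ps adjP' inner_ge0.
have xs : star x = x by rewrite starB starZ star1 conj_real hs.
have [v|g [gs gg gc]] := positive_square xs.
  rewrite (linB pl) (linZ pl) p1 bBE bZE b1E innerBl innerZl pM bME ps adjP'.
  rewrite !inner_nr -CM -rmorphB lecR subr_ge0 -exprMn.
  by rewrite ler_pXn2r ?nnegrE ?mulr_ge0 ?nr_ge0.
have kx : k * x = x * k.
  have kh : k * h = h * k by rewrite -kk mulrA.
  by rewrite mulrBr mulrBl -scalerAl -scalerAr mulr1 mul1r kh.
have kkgg : k * k + g * g = (M ^+ 2)%:C *: 1 by rewrite kk gg addrC subrK.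
have [k1 _] := cnorm_sum_squares ks gs (gc _ kx) kkgg M0.
rewrite -(@ler_pXn2r _ 2) ?nnegrE ?cnorm_ge0 // -cstar_identity -/h -kk cnorm_sq //.
by rewrite ler_pXn2r ?nnegrE ?cnorm_ge0.
Qed.

(** The approximating elements form a Cauchy sequence because [psi] is isometric, and A is complete.
    This is what places slices back inside the algebras. *)
Lemma hom_closed (T : bop H) :
  (forall e : R, 0 < e -> exists a, bdd (T - psi a) e) -> exists a, psi a = T.
Proof.
have [pl p1 pM ps] := hp; move=> h.
have /choice[u hu] (n : nat) : exists a, bdd (T - psi a) n.+1%:R^-1.
  by apply: h; rewrite invr_gt0.
have [e e0|a ha] := @cnorm_complete R A u.
  have [|N hN] := invn_small (e := e / 2); first by rewrite divr_gt0.
  exists N => p q Np Nq; apply: hom_isometric; rewrite (linB pl).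
  have -> : psi (u p) - psi (u q) = - (T - psi (u p)) + (T - psi (u q)).
    by rewrite opprB subrKA.
  rewrite (splitr e); apply: bddbD; first apply: bddN.
    by apply: bdd_le (hu p); exact: hN.
  by apply: bdd_le (hu q); exact: hN.
exists a; apply/eqP; rewrite -subr_eq0; apply/eqP/bopP => v; apply: nr_le0 => e e0.
have v1 : 0 < nr v + 1 by rewrite ltr_wpDl // nr_ge0.
pose d := e / (nr v + 1); have d2 : 0 < d / 2 by rewrite !divr_gt0.
have [N1 h1] := ha _ d2; have [N2 h2] := invn_small d2; pose N := maxn N1 N2.
have {}h1 := h1 N (leq_maxl _ _); have {}h2 := h2 N (leq_maxr _ _).
have -> : psi a - T = - psi (u N - a) + - (T - psi (u N)).
  by rewrite (linB pl) !opprB subrKA.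
have [_ b] := bddbD (bddN (bdd_le h1 (hom_contractive _))) (bddN (bdd_le h2 (hu N))).
rewrite (le_trans (b v)) // -splitr /d mulrAC -mulrA -[leRHS]mulr1.
by rewrite ler_wpM2l ?(ltW e0) // ler_pdivrMr // mul1r lerDl.
Qed.

End Hom.
End CStar.

(** * Faithful representations *)

Section Rep.
Variables (R : realType) (A : repCStar R).

Definition brep (a : A) : bop (rc_space A) := Bop (rep a) (rep_bounded a).

Lemma brep_hom : star_hom brep.
Proof.
split.
- by move=> c a b; apply: bopP => v; rewrite bDE bZE /= rep_linear.
- by apply: bopP => v; rewrite /= rep1.
- by move=> a b; apply: bopP => v; rewrite /= repM.
- by move=> a; apply/esym/adj_uniq => x y; exact: rep_star.
Qed.
Lemma brep_inj : injective brep.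
Proof. by move=> a b /(congr1 (@bfun _ _)) /= /rep_inj. Qed.
Lemma brepL : linear brep. Proof. by case: brep_hom. Qed.
Lemma brep1 : brep 1 = 1. Proof. by case: brep_hom. Qed.
Lemma brepM a b : brep (a * b) = brep a * brep b. Proof. by case: brep_hom. Qed.
Lemma brep_star a : brep (star a) = adj (brep a). Proof. by case: brep_hom. Qed.
Lemma brepD a b : brep (a + b) = brep a + brep b. Proof. exact: linD brepL _ _. Qed.
Lemma brepZ c a : brep (c *: a) = c *: brep a. Proof. exact: linZ brepL _ _. Qed.
Lemma brep0 : brep 0 = 0. Proof. exact: lin0 brepL. Qed.
Lemma brep_sum (I : Type) (s : seq I) (F : I -> A) :
  brep (\sum_(i <- s) F i) = \sum_(i <- s) brep (F i).
Proof. exact: (lin_sum brepL). Qed.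
Lemma brep_ext a b : (forall k k', [<brep a k, k'>] = [<brep b k, k'>]) -> a = b.
Proof. by move=> h; apply: brep_inj; apply: bop_eqP. Qed.
End Rep.

Lemma op_tensE (R : realType) (K L : hilbertType R) (KL : hilbertTensor K L)
    (T : bop K) (S : bop L) : op_tens KL T S = tn (hilbertTensor_map KL) T S.
Proof.
apply: xget_unique.
  by split; [exact: bop_bounded | exact: tnE].
move=> V [Vb VE]; have -> : V = Bop V Vb by [].
by congr bfun; apply: tn_uniq.
Qed.

(** * Slice maps *)

Section Coef.
Variables (R : realType) (A : repCStar R) (L M : hilbertType R).
Variable t : rc_space A -> L -> M.
Hypothesis ht : tensor_map t.
Implicit Types (T : bop M) (S : bop L) (a : A) (w : A -> R[i]).
Let tl : forall l, linear (fun k => t k l) := let: And4 tl _ _ _ := ht in tl.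
Let tr : forall k, linear (t k) := let: And4 _ tr _ _ := ht in tr.
Let ti : forall k l k' l', [<t k l, t k' l'>] = [<k, k'>] * [<l, l'>] :=
  let: And4 _ _ ti _ := ht in ti.
Local Notation "a \tn S" := (tn ht (brep a) S) (at level 35).

Definition has_coef (T : M -> M) l l' a :=
  forall k k', [<rep a k, k'>] = [<T (t k l), t k' l'>].
Definition coefg (T : M -> M) l l' : A := xget 0 [set a | has_coef T l l' a].
(** Operators whose slices along the second leg all lie in A. The class is closed under norm limits
    and under multiplication by simple tensors, and it contains U, which is only a multiplier. *)
Definition aop T := forall l l', exists a, has_coef T l l' a.

Lemma coefgP T l l' a : has_coef T l l' a -> coefg T l l' = a.
Proof.
move=> h; apply: xget_unique => // b hb; apply: brep_ext => k k'.
by rewrite [LHS]hb [RHS]h.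
Qed.
Lemma coefgE T l l' : aop T -> has_coef T l l' (coefg T l l').
Proof. by move=> /(_ l l')[a ha]; rewrite (coefgP ha). Qed.

Lemma has_coef_tn a S l l' : has_coef (a \tn S) l l' ([<S l, l'>] *: a).
Proof.
move=> k k'; rewrite inner_tn -[rep _ k]/(brep ([<S l, l'>] *: a) k) brepZ bZE innerZl.
by rewrite mulrC.
Qed.
Lemma has_coefD T T' l l' a b : has_coef T l l' a -> has_coef T' l l' b ->
  has_coef (T + T') l l' (a + b).
Proof.
move=> h h' k k'; rewrite -[rep _ k]/(brep (a + b) k) brepD !bDE !innerDl.
by rewrite -h -h'.
Qed.
Lemma has_coefZ T l l' a c : has_coef T l l' a -> has_coef (c *: T) l l' (c *: a).
Proof. by move=> h k k'; rewrite -[rep _ k]/(brep (c *: a) k) brepZ !bZE !innerZl -h. Qed.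
Lemma has_coef0 l l' : has_coef (0 : bop M) l l' 0.
Proof. by move=> k k'; rewrite -[rep _ k]/(brep 0 k) brep0 !b0E !inner0l. Qed.
Lemma has_coef_sum (I : Type) (s : seq I) (F : I -> bop M) (f : I -> A) l l' :
  (forall i, has_coef (F i) l l' (f i)) ->
  has_coef (\sum_(i <- s) F i) l l' (\sum_(i <- s) f i).
Proof.
move=> h; elim: s => [|i s IH]; first by rewrite !big_nil; exact: has_coef0.
by rewrite !big_cons; apply: has_coefD.
Qed.
Lemma coefg_sum_tn (I : Type) (s : seq I) (a : I -> A) (F : I -> bop L) l l' :
  coefg (\sum_(i <- s) tn ht (brep (a i)) (F i)) l l' = \sum_(i <- s) [<F i l, l'>] *: a i.
Proof. by apply: coefgP; apply: has_coef_sum => i; exact: has_coef_tn. Qed.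
Lemma has_coefN T l l' a : has_coef T l l' a -> has_coef (- T) l l' (- a).
Proof. by rewrite -(scaleN1r T) -(scaleN1r a); exact: has_coefZ. Qed.
Lemma has_coefB T T' l l' a b : has_coef T l l' a -> has_coef T' l l' b ->
  has_coef (T - T') l l' (a - b).
Proof. by move=> h h'; apply: has_coefD => //; apply: has_coefN. Qed.
Lemma has_coef_mull T l l' a b S :
  has_coef T l (adj S l') a -> has_coef (b \tn S * T) l l' (b * a).
Proof.
move=> h k k'; rewrite -[rep _ k]/(brep (b * a) k) brepM bME adjP -brep_star.
by rewrite -[brep a k]/(rep a k) h bME [RHS]adjP adj_tn tnE -brep_star.
Qed.
Lemma has_coef_mulr T l l' a b S :
  has_coef T (S l) l' a -> has_coef (T * (b \tn S)) l l' (a * b).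
Proof.
move=> h k k'; rewrite -[rep _ k]/(brep (a * b) k) brepM bME.
by rewrite -[brep a _]/(rep a _) h bME tnE.
Qed.

Lemma has_coef_lin T c l1 l2 l' a b : has_coef T l1 l' a -> has_coef T l2 l' b ->
  has_coef T (c *: l1 + l2) l' (c *: a + b).
Proof.
move=> h1 h2 k k'; rewrite -[rep _ k]/(brep (c *: a + b) k) brepL bDE bZE innerDl innerZl.
by rewrite tr blinear innerDl innerZl -h1 -h2.
Qed.
Lemma has_coef_antilin T c l1 l2 l a b : has_coef T l l1 a -> has_coef T l l2 b ->
  has_coef T l (c *: l1 + l2) (Num.conj c *: a + b).
Proof.
move=> h1 h2 k k'; rewrite -[rep _ k]/(brep (Num.conj c *: a + b) k) brepL bDE bZE.
by rewrite innerDl innerZl tr innerDr innerZr -h1 -h2.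
Qed.

Lemma coefg_sumr (I : Type) (s : seq I) (x : I -> L) T l : aop T ->
  coefg T l (\sum_(i <- s) x i) = \sum_(i <- s) coefg T l (x i).
Proof.
move=> hT; apply: coefgP => k k'; rewrite -[rep _ k]/(brep _ k) brep_sum bsumE inner_suml.
rewrite (lin_sum (tr _)) inner_sumr; apply: eq_bigr => i _; exact: coefgE.
Qed.
Lemma coefg0r T l : coefg T l 0 = 0.
Proof.
apply: coefgP => k k'; rewrite -[rep _ k]/(brep 0 k) brep0 b0E inner0l.
by rewrite (lin0 (tr _)) inner0r.
Qed.

Lemma cnorm_coef T l l' a C : has_coef T l l' a -> bdd T C -> cnorm a <= C * nr l * nr l'.
Proof.
move=> h [C0 hC]; apply: (hom_isometric (brep_hom A) (@brep_inj _ A)).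
split=> [|k]; first by rewrite !mulr_ge0 ?nr_ge0.
apply: nr_le_inner; first by rewrite !mulr_ge0 ?nr_ge0.
move=> k'; rewrite -[brep a k]/(rep a k) h (le_trans (CS _ _)) //.
rewrite (le_trans (ler_wpM2r (nr_ge0 _) (hC _))) // !(nr_tensor ht).
by have -> : C * (nr k * nr l) * (nr k' * nr l') = C * nr l * nr l' * nr k * nr k' by ring.
Qed.

(** The slice of the limit exists as an operator by its form, and it is a norm limit of elements of
    A because slicing multiplies norms by at most |l| |l'|. *)
Lemma aop_lim T : (forall e : R, 0 < e -> exists T', aop T' /\ bdd (T - T') e) -> aop T.
Proof.
move=> h l l'; have [C [C0 hC]] := bbdd T.
have [||||T0 [T0l T0b T0E]] := @form_op R (rc_space A) (rc_space A)
   (fun k k' => [<T (t k l), t k' l'>]) (C * nr l * nr l').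
- by rewrite !mulr_ge0 ?nr_ge0.
- by move=> c x y z; rewrite tl blinear innerDl innerZl.
- by move=> c x y z; rewrite tl innerDr innerZr.
- move=> k k'; rewrite (le_trans (CS _ _)) //.
  rewrite (le_trans (ler_wpM2r (nr_ge0 _) (hC _))) // !(nr_tensor ht).
  by have -> : C * (nr k * nr l) * (nr k' * nr l') = C * nr l * nr l' * nr k * nr k' by ring.
have T0o : bounded_op T0 by apply/bounded_opP; split=> //; eexists; exact: T0b.
have [e e0|a ha] := hom_closed (brep_hom A) (@brep_inj _ A) (T := Bop T0 T0o).
  have n1 : 0 < nr l * nr l' + 1 by rewrite ltr_wpDl // mulr_ge0 ?nr_ge0.
  have [|T' [/(_ l l')[a ha] [e' hT']]] := h (e / (nr l * nr l' + 1)).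
    by rewrite divr_gt0.
  exists a; split=> [|k]; first exact: ltW.
  apply: nr_le_inner; first by rewrite mulr_ge0 ?nr_ge0 // ltW.
  move=> k'; rewrite bBE innerBl /= T0E ha -innerBl -bBE (le_trans (CS _ _)) //.
  rewrite (le_trans (ler_wpM2r (nr_ge0 _) (hT' _))) // !(nr_tensor ht).
  set q := e / _.
  have -> : q * (nr k * nr l) * (nr k' * nr l') = (q * (nr l * nr l')) * (nr k * nr k') by ring.
  rewrite -[leRHS]mulrA ler_wpM2r ?mulr_ge0 ?nr_ge0 // /q mulrAC -mulrA -[leRHS]mulr1.
  by rewrite ler_wpM2l ?(ltW e0) // ler_pdivrMr // mul1r lerDl.
by exists a => k k'; rewrite -[rep a k]/(brep a k) ha /= T0E.
Qed.

Definition bfl w := scalar w /\ exists2 C : R, 0 <= C & forall a, cabs (w a) <= C * cnorm a.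

Lemma slice_ex w T : aop T -> bfl w -> exists S : bop L,
  (forall l l', [<S l, l'>] = w (coefg T l l')) /\
  (forall C D, 0 <= C -> (forall a, cabs (w a) <= C * cnorm a) -> bdd T D -> bdd S (C * D)).
Proof.
move=> hT [wl [C C0 wC]]; have [D [D0 hD]] := bbdd T.
have est C' D' l l' : 0 <= C' -> (forall a, cabs (w a) <= C' * cnorm a) -> bdd T D' ->
    cabs (w (coefg T l l')) <= C' * D' * nr l * nr l'.
  move=> C0' wC' hD'; rewrite (le_trans (wC' _)) // -!mulrA ler_wpM2l // mulrA.
  exact: cnorm_coef (coefgE _ _ hT) hD'.
have [||||S [Sl Sb SE]] := @form_op R L L (fun l l' => w (coefg T l l')) (C * D).
- exact: mulr_ge0.
- move=> c x y z; rewrite (coefgP (has_coef_lin c (coefgE x z hT) (coefgE y z hT))).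
  exact: wl.
- move=> c x y z; rewrite (coefgP (has_coef_antilin c (coefgE z x hT) (coefgE z y hT))).
  exact: wl.
- by move=> l l'; apply: est.
have So : bounded_op S by apply/bounded_opP; split=> //; eexists; exact: Sb.
exists (Bop S So); split=> // C' D' C0' wC' hD'; split=> [|l].
  by rewrite mulr_ge0 // hD'.1.
apply: nr_le_inner; first by rewrite !mulr_ge0 ?nr_ge0 ?hD'.1.
by move=> l' /=; rewrite SE est.
Qed.

Definition sliceg w (T : M -> M) : L -> L :=
  xget (fun=> 0) [set S : L -> L | bounded_op S /\
    forall l l', [<S l, l'>] = w (coefg T l l')].

(** The default value is the zero operator, so slices can be bundled without side conditions. *)
Lemma sliceg_bounded w (T : M -> M) : bounded_op (sliceg w T).
Proof. by rewrite /sliceg; case: xgetP => [S _ []//|_]; exact: b0_subproof. Qed.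
Definition sl w (T : M -> M) : bop L := Bop (sliceg w T) (sliceg_bounded w T).

Lemma slE w T l l' : aop T -> bfl w -> [<sl w T l, l'>] = w (coefg T l l').
Proof.
move=> hT hw; have [S [SE _]] := slice_ex hT hw; rewrite /= /sliceg.
case: xgetP => [V _ [_ ->]//|/(_ (bfun S))[]]; split=> //; exact: bop_bounded.
Qed.
Lemma sl_bdd w T C D : aop T -> bfl w -> 0 <= C -> (forall a, cabs (w a) <= C * cnorm a) ->
  bdd T D -> bdd (sl w T) (C * D).
Proof.
move=> hT hw C0 wC hD; have [S [SE Sb]] := slice_ex hT hw.
suff -> : sl w T = S by exact: Sb.
by apply: bop_eqP => l l'; rewrite slE // SE.
Qed.
Lemma sl_uniq w T (S : bop L) : aop T -> bfl w ->
  (forall l l' a, has_coef T l l' a -> [<S l, l'>] = w a) -> sl w T = S.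
Proof.
move=> hT hw h; apply: bop_eqP => l l'; rewrite slE // (h _ _ (coefg T l l')) //.
exact: coefgE.
Qed.

Lemma aop_tn a S : aop (a \tn S).
Proof. by move=> l l'; eexists; exact: has_coef_tn. Qed.
Lemma aop_sum (I : Type) (s : seq I) (F : I -> bop M) :
  (forall i, aop (F i)) -> aop (\sum_(i <- s) F i).
Proof.
move=> h l l'; have /choice[f hf] i := h i l l'.
by exists (\sum_(i <- s) f i); apply: has_coef_sum.
Qed.
Lemma aopB T T' : aop T -> aop T' -> aop (T - T').
Proof.
move=> h h' l l'; have [a ha] := h l l'; have [b hb] := h' l l'.
by exists (a - b); apply: has_coefB.
Qed.
Lemma aop_mull T b S : aop T -> aop (b \tn S * T).
Proof.
by move=> h l l'; have [a ha] := h l (adj S l'); exists (b * a); apply: has_coef_mull.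
Qed.
Lemma aop_mulr T b S : aop T -> aop (T * (b \tn S)).
Proof.
by move=> h l l'; have [a ha] := h (S l) l'; exists (a * b); apply: has_coef_mulr.
Qed.

Lemma bflM w x : bfl w -> bfl (fun c => w (c * x)).
Proof.
move=> [wl [C C0 wC]]; split=> [c a b|]; first by rewrite mulrDl -scalerAl wl.
exists (C * cnorm x); first by rewrite mulr_ge0 ?cnorm_ge0.
move=> a; rewrite (le_trans (wC _)) // -mulrA ler_wpM2l // mulrC; exact: cnormM.
Qed.
Lemma bflMl w x : bfl w -> bfl (fun c => w (x * c)).
Proof.
move=> [wl [C C0 wC]]; split=> [c a b|]; first by rewrite mulrDr -scalerAr wl.
exists (C * cnorm x); first by rewrite mulr_ge0 ?cnorm_ge0.
move=> a; rewrite (le_trans (wC _)) // -mulrA ler_wpM2l //; exact: cnormM.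
Qed.
End Coef.

Section Spatial.
Variables (R : realType) (A : repCStar R) (L : hilbertType R).
Variable AL : hilbertTensor (rc_space A) L.
Local Notation ht := (hilbertTensor_map AL).

Lemma lspan_ind (V : lmodType R[i]) (X P : set V) :
  P 0 -> (forall c x y, X x -> P y -> P (c *: x + y)) -> forall v, lspan X v -> P v.
Proof.
move=> P0 PD v [n [c [x [hx ->]]]].
elim: n c x hx => [|n IH] c x hx; first by rewrite big_ord0.
by rewrite big_ord_recl; apply: PD => //; apply: IH.
Qed.

Lemma spatial_approx (Y : set (L -> L)) (T : AL -> AL) :
  (forall S, Y S -> bounded_op S) -> spatial AL (@rep_range R A) Y T ->
  exists2 Tb : bop AL, bfun Tb = T & forall e : R, 0 < e ->
    exists s : seq (A * bop L), (forall p, p \in s -> Y p.2) /\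
      bdd (Tb - \sum_(p <- s) tn ht (brep p.1) p.2) e.
Proof.
move=> Yb [To h]; exists (Bop T To) => // e e0.
have eC : 0 < e%:C :> R[i] by rewrite ltcR.
have [S XS nS] := h _ eC.
have [s [sY SE]] : exists s : seq (A * bop L), (forall p, p \in s -> Y p.2) /\
    S = bfun (\sum_(p <- s) tn ht (brep p.1) p.2).
  apply: (lspan_ind (P := [set S | exists s : seq (A * bop L),
     (forall p, p \in s -> Y p.2) /\ S = bfun (\sum_(p <- s) tn ht (brep p.1) p.2)]) _ _ XS).
    by exists [::]; rewrite big_nil.
  move=> c _ _ [_ [S1 [[a _ <-] YS1 ->]]] [s [sY ->]].
  exists ((c *: a, Bop S1 (Yb _ YS1)) :: s); split.
    by move=> p; rewrite inE => /orP[/eqP->|/sY].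
  have -> : op_tens AL (rep a) S1 = tn ht (brep a) (Bop S1 (Yb _ YS1)) by rewrite -op_tensE.
  by rewrite big_cons brepZ tnZl.
exists s; split=> //; split=> [|x]; first exact: ltW.
by have := nS x; rewrite SE bBE !nrE -CM lecR.
Qed.

Lemma spatial_aop (Y : set (L -> L)) (T : bop AL) :
  (forall S, Y S -> bounded_op S) -> spatial AL (@rep_range R A) Y T -> aop (tens AL) T.
Proof.
move=> Yb /(spatial_approx Yb)[Tb TE h]; have -> : T = Tb by apply: bopP => x; rewrite TE.
apply: (aop_lim ht) => e /h[s [_ hs]]; eexists; split; last exact: hs.
by apply: aop_sum => p; exact: aop_tn.
Qed.

Lemma slice_sl w (T : AL -> AL) : slice w T = sl (tens AL) w T.
Proof. by []. Qed.
End Spatial.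

Section Lspan.
Variables (R : realType) (V : lmodType R[i]).
Implicit Types (X : set V).

Lemma lspan0 X : lspan X 0.
Proof. by exists 0%N, (fun=> 0), (fun=> 0); split=> [[]|]; rewrite ?big_ord0. Qed.
Lemma lspan_gen X x : X x -> lspan X x.
Proof. by exists 1%N, (fun=> 1), (fun=> x); split=> //; rewrite big_ord1 scale1r. Qed.
Lemma lspan_lin X c x y : lspan X x -> lspan X y -> lspan X (c *: x + y).
Proof.
move=> [n [a [u [hu ->]]]] [m [b [v [hv ->]]]].
exists (n + m)%N, (fun i => match fintype.split i with inl j => c * a j | inr j => b j end),
  (fun i => match fintype.split i with inl j => u j | inr j => v j end); split.
  by move=> j; case: fintype.split.
rewrite big_split_ord /= scaler_sumr; congr (_ + _); apply: eq_bigr => i _.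
  by rewrite (unsplitK (inl i)) scalerA.
by rewrite (unsplitK (inr i)).
Qed.
Lemma lspanD X x y : lspan X x -> lspan X y -> lspan X (x + y).
Proof. by move=> hx hy; rewrite -[x]scale1r; apply: lspan_lin. Qed.
Lemma lspanZ X c x : lspan X x -> lspan X (c *: x).
Proof. by move=> hx; rewrite -[_ *: _]addr0; apply: lspan_lin => //; exact: lspan0. Qed.
Lemma lspan_induct X (P : V -> Prop) : P 0 ->
  (forall c x y, X x -> lspan X y -> P y -> P (c *: x + y)) -> forall v, lspan X v -> P v.
Proof.
move=> P0 PD v [n [c [x [hx ->]]]].
elim: n c x hx => [|n IH] c x hx; first by rewrite big_ord0.
rewrite big_ord_recl; apply: PD => //; last exact: IH.
by exists n, (fun i => c (lift ord0 i)), (fun i => x (lift ord0 i)).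
Qed.
End Lspan.

Lemma tn_flip (R : realType) (K L M : hilbertType R) (t : K -> L -> M) (ht : tensor_map t)
  (T : bop K) (S : bop L) : tn (tensor_map_flip ht) S T = tn ht T S.
Proof. by apply: tn_uniq => k l; rewrite (tnE (tensor_map_flip ht)). Qed.

Section StarHom.
Variables (R : realType) (A B : repCStar R) (AB : tensC A B) (d : B -> AB -> AB).
Hypothesis hd : unital_star_hom d.
Local Notation ht := (hilbertTensor_map AB).

Lemma hom_bounded b : bounded_op (d b).
Proof. by case: hd => /(_ b)[]. Qed.
Definition dB b : bop AB := Bop (d b) (hom_bounded b).

Lemma dB_hom : star_hom dB.
Proof.
case: hd => _ dl d1 dM ds; split.
- by move=> c a b; apply: bopP => x; rewrite /= dl.
- by apply: bopP => x; rewrite /= d1.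
- by move=> a b; apply: bopP => x; rewrite /= dM.
- by move=> a; apply/esym/adj_uniq => x y; exact: ds.
Qed.
Lemma dBL : linear dB. Proof. by case: dB_hom. Qed.
Lemma dB1 : dB 1 = 1. Proof. by case: dB_hom. Qed.
Lemma dBM a b : dB (a * b) = dB a * dB b. Proof. by case: dB_hom. Qed.
Lemma dB_star a : dB (star a) = adj (dB a). Proof. by case: dB_hom. Qed.

Lemma rep_range_bounded (C : repCStar R) S : @rep_range R C S -> bounded_op S.
Proof. by move=> [a _ <-]; exact: rep_bounded. Qed.

Lemma dB_approx b (e : R) : 0 < e -> exists s : seq (A * B),
  bdd (dB b - \sum_(p <- s) tn ht (brep p.1) (brep p.2)) e.
Proof.
have [hs _ _ _ _] := hd; move=> e0.
have [Tb TE /(_ e e0)[s [sY hb]]] := spatial_approx (@rep_range_bounded B) (hs b).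
have -> : dB b = Tb by apply: bopP => x; rewrite TE.
have /choice[f hf] (p : A * bop _) : exists c : B, p \in s -> brep c = p.2.
  have [ps|ps] := boolP (p \in s); last by exists 0.
  by have [c _ cE] := sY p ps; exists c => _; apply: bopP => x; rewrite /= cE.
exists [seq (p.1, f p) | p <- s]; rewrite big_map /=.
have -> : \sum_(p <- s) tn ht (brep p.1) (brep (f p)) = \sum_(p <- s) tn ht (brep p.1) p.2.
  by rewrite big_seq [RHS]big_seq; apply: eq_bigr => p ps; rewrite hf.
exact: hb.
Qed.

Lemma dB_aop b : aop (tens AB) (dB b).
Proof.
apply: (aop_lim ht) => e /(dB_approx b)[s hs]; eexists; split; last exact: hs.
by apply: aop_sum => p; exact: aop_tn.
Qed.
Lemma dB_aopr b : aop (fun l k => tens AB k l) (dB b).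
Proof.
apply: (aop_lim (tensor_map_flip ht)) => e /(dB_approx b)[s hs]; eexists; split; last exact: hs.
by apply: aop_sum => p; rewrite -tn_flip; exact: aop_tn.
Qed.

Lemma decompE (s : seq (A * B)) :
  \sum_(p <- s) op_tens AB (rep p.1) (rep p.2) =
  bfun (\sum_(p <- s) tn ht (brep p.1) (brep p.2)).
Proof. by rewrite bsum_fun; apply: eq_bigr => p _; rewrite -op_tensE. Qed.
Lemma decomposes_bop P Q b s : decomposes P Q (d b) s ->
  dB b = \sum_(p <- s) tn ht (brep p.1) (brep p.2).
Proof. by move=> [_ h]; apply: bopP => x; rewrite -decompE -h. Qed.
Lemma bop_decomposes (P : set A) (Q : set B) b s : (forall p, p \in s -> P p.1 /\ Q p.2) ->
  dB b = \sum_(p <- s) tn ht (brep p.1) (brep p.2) -> decomposes P Q (d b) s.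
Proof. by move=> h e; split=> //; rewrite decompE -e. Qed.

Lemma decomposes_lin X Q c b b' s s' :
  decomposes (lspan X) Q (d b) s -> decomposes (lspan X) Q (d b') s' ->
  decomposes (lspan X) Q (d (c *: b + b')) ([seq (c *: p.1, p.2) | p <- s] ++ s').
Proof.
move=> h h'; apply: bop_decomposes.
  move=> p; rewrite mem_cat => /orP[/mapP[q qs ->] /=|ps]; last exact: h'.1.
  by split; [apply: lspanZ|]; case: (h.1 q qs).
rewrite dBL (decomposes_bop h) (decomposes_bop h') big_cat big_map scaler_sumr /=.
by congr (_ + _); apply: eq_bigr => p _; rewrite brepZ tnZl.
Qed.

End StarHom.

(** * Strong invariance of the Haar state *)

Section Haar.
Variables (R : realType) (A : repCStar R) (AA : tensC A A) (Delta : A -> AA -> AA).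
Variable phi : A -> R[i].
Hypotheses (hD : unital_star_hom Delta) (hphi : haar_state Delta phi).
Local Notation ht := (hilbertTensor_map AA).
Local Notation hf := (tensor_map_flip ht).

Lemma phi_scalar : scalar phi. Proof. by case: hphi. Qed.
Lemma phiD a b : phi (a + b) = phi a + phi b.
Proof. by have := phi_scalar 1 a b; rewrite scale1r mul1r. Qed.
Lemma phi0 : phi 0 = 0.
Proof. by have := phi_scalar (-1) 0 0; rewrite scaler0 addr0 mulN1r addNr. Qed.
Lemma phiZ c a : phi (c *: a) = c * phi a.
Proof. by have := phi_scalar c a 0; rewrite !addr0 phi0 addr0. Qed.
Lemma phi_sum (I : Type) (s : seq I) (F : I -> A) :
  phi (\sum_(i <- s) F i) = \sum_(i <- s) phi (F i).
Proof. by apply: (big_morph phi); [exact: phiD|exact: phi0]. Qed.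

(** Cauchy-Schwarz against 1 reduces the bound to the value at [star b * b] with |b| <= 1, and there
    1 - b^* b is the square of a self-adjoint element, at which phi is nonnegative. *)
Lemma phi_bfl : bfl phi.
Proof.
have [pl pp p1 _ _] := hphi; split=> //; exists 1 => // a; rewrite mul1r.
have CSp : cabs (phi a) ^+ 2 <= complex.Re (phi (star a * a)).
  have := @form_CS R A (fun x y => phi (star y * x)) _ _ pp a 1.
  rewrite star1 !mul1r p1 mulr1; apply.
    by move=> c x y z; rewrite mulrDr -scalerAr pl.
  by move=> c x y z; rewrite starD starZ mulrDl -scalerAl pl.
have key b : cnorm b <= 1 -> complex.Re (phi (star b * b)) <= 1.
  move=> b1; have [||e [es ee _ _]] := @sqrt_one_minus _ _ (star b * b).
  - by rewrite starM starK.
  - by rewrite cstar_identity exprn_ile1 ?cnorm_ge0.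
  have := pp e; rewrite es ee addrC -scaleN1r phi_scalar p1 mulN1r lecE => /andP[_] /=.
  by rewrite ReD ReN addrC subr_ge0.
have [a0|aN] := eqVneq (cnorm a) 0.
  by rewrite a0 (cnorm_eq0 _ a0) phi0 cabs0.
have a0 : 0 < cnorm a by rewrite lt_def aN cnorm_ge0.
have := key ((cnorm a)^-1%:C *: a).
rewrite cnormZr cabs_ge0C ?invr_ge0 ?(ltW a0) // mulVf // => /(_ (lexx _)).
rewrite starZ -scalerAl -scalerAr !phiZ conj_real !ReCM => h.
rewrite -(@ler_pXn2r _ 2) ?nnegrE ?cabs_ge0 ?(ltW a0) // (le_trans CSp) //.
have -> : complex.Re (phi (star a * a)) =
    cnorm a ^+ 2 * ((cnorm a)^-1 * ((cnorm a)^-1 * complex.Re (phi (star a * a)))).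
  by field; rewrite aN.
by rewrite -[leRHS]mulr1 ler_wpM2l ?sqr_ge0.
Qed.

Lemma haar_left a l l' : phi (coefg (tens AA) (dB hD a) l l') = phi a * [<l, l'>].
Proof.
have [_ _ _ hl _] := hphi.
rewrite -(slE ht l l' (dB_aop hD a) phi_bfl).
have := hl a; rewrite slice_sl => ->; exact: innerZl.
Qed.
Lemma haar_right a l l' :
  phi (coefg (fun l k => tens AA k l) (dB hD a) l l') = phi a * [<l, l'>].
Proof.
have [_ _ _ _ hr] := hphi.
rewrite -(slE hf l l' (dB_aopr hD a) phi_bfl).
have := hr a; rewrite -[slicer _ _]/(bfun (sl (fun l k => tens AA k l) phi (Delta a))) => ->.
exact: innerZl.
Qed.

Lemma hatA_bfl w : hatA Delta phi w -> bfl w.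
Proof.
move=> [a _ wE]; have -> : w = fun x => phi (a * x) by exact/funext.
exact: bflMl phi_bfl.
Qed.
Lemma hatA_lin c w w' : hatA Delta phi w -> hatA Delta phi w' ->
  hatA Delta phi (fun x => c * w x + w' x).
Proof.
move=> [a ha wE] [b hb wE']; exists (c *: a + b); first exact: lspan_lin.
by move=> x; rewrite wE wE' mulrDl -scalerAl phi_scalar.
Qed.

Section Irr.
Variables (n : nat) (u : 'M[A]_n).
Hypothesis hu : irr_corep Delta u.

Lemma irr_uustar i j : \sum_k u i k * star (u j k) = (i == j)%:R.
Proof. by case: hu. Qed.
Lemma irr_ustaru i j : \sum_k star (u k i) * u k j = (i == j)%:R.
Proof. by case: hu. Qed.
Lemma matA_irr i j : matA Delta (u i j).
Proof. by apply: lspan_gen; exists n, u, i, j. Qed.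
Definition irr_dec i j := [seq (u i k, u k j) | k <- index_enum 'I_n].
Lemma irr_decP i j : decomposes (matA Delta) (matA Delta) (Delta (u i j)) (irr_dec i j).
Proof.
split; last by case: hu => _ _ _ -> _; rewrite big_map.
by move=> p /mapP[k _ ->]; split; exact: matA_irr.
Qed.
Lemma dB_irr i j : dB hD (u i j) = \sum_k tn ht (brep (u i k)) (brep (u k j)).
Proof. by rewrite (decomposes_bop hD (irr_decP i j)) big_map. Qed.

(* (iota (x) phi(u_ij .)) Delta(c) = sum_k u_ki^* phi(u_kj c) *)
Lemma strong_right i j c l l' :
  phi (u i j * coefg (fun l k => tens AA k l) (dB hD c) l l') =
  \sum_k phi (u k j * c) * [<rep (star (u k i)) l, l'>].
Proof.
set T := dB hD c; have aT : aop (fun l k => tens AA k l) T by exact: dB_aopr.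
(* The double sum collapses in two ways: over k, where the sum of u_km^* u_ki is a Kronecker delta,
   it is the left side; over m, where Delta(u_kj) is the sum of the u_km (x) u_mj, it is Haar
   invariance at u_kj c. *)
transitivity (\sum_k \sum_m
   phi (u m j * coefg (fun l k => tens AA k l) T l (brep (star (u k m)  * u k i) l'))).
  rewrite exchange_big.
  have key m : \sum_k phi (u m j * coefg (fun l k => tens AA k l) T l
      (brep (star (u k m) * u k i) l')) =
    phi (u m j * coefg (fun l k => tens AA k l) T l (brep (m == i)%:R l')).
    rewrite -phi_sum -mulr_sumr -(coefg_sumr hf) //; congr (phi (_ * coefg _ _ _ _)).
    by rewrite -bsumE -brep_sum irr_ustaru.
  rewrite (eq_bigr _ (fun m _ => key m)) (bigD1 i) // big1 ?addr0 => [|m mi].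
    by rewrite eqxx mulr1n brep1 b1E /= addr0.
  by rewrite (negPf mi) brep0 b0E (coefg0r hf) mulr0 phi0.
apply: eq_bigr => k _; rewrite -phi_sum.
have -> : [<rep (star (u k i)) l, l'>] = [<l, brep (u k i) l'>].
  by rewrite -[rep _ l]/(brep (star (u k i)) l) brep_star adjP'.
rewrite -haar_right; congr phi; apply/esym/coefgP.
move=> m m'; rewrite dBM dB_irr mulr_suml bsumE inner_suml.
rewrite -[rep _ m]/(brep _ m) brep_sum bsumE inner_suml; apply: eq_bigr => q _.
rewrite -tn_flip; apply: (has_coef_mull hf) => m1 m2.
by rewrite brepM bME -brep_star; exact: coefgE.
Qed.
End Irr.
End Haar.

(** * The antipode *)

Section Antipode.
Variables (R : realType) (A : repCStar R) (AA : tensC A A) (Delta : A -> AA -> AA).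
Variables (phi : A -> R[i]) (S : A -> A).
Hypotheses (hD : unital_star_hom Delta) (hphi : haar_state Delta phi).
Hypotheses (hf : faithful_state phi) (hS : antipode Delta S).
Local Notation ht := (hilbertTensor_map AA).
Local Notation matA := (matA Delta).
Local Notation fl := (fun l k => tens AA k l).

Lemma S_matA a : matA a -> matA (S a). Proof. by case: hS => h _ _; exact: h. Qed.
Lemma S_lin c a b : matA a -> matA b -> S (c *: a + b) = c *: S a + S b.
Proof. by case: hS => _ h _; exact: h. Qed.
Lemma S0 : S 0 = 0.
Proof.
have := S_lin (-1) (lspan0 _) (lspan0 _).
by rewrite scaler0 addr0 scaleN1r addNr.
Qed.
Lemma matA_sum (I : eqType) (s : seq I) (c : I -> R[i]) (F : I -> A) :
  (forall i, i \in s -> matA (F i)) -> matA (\sum_(i <- s) c i *: F i).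
Proof.
elim: s => [|i s IH] hF; first by rewrite big_nil; exact: lspan0.
rewrite big_cons; apply: lspan_lin; first by apply: hF; rewrite mem_head.
by apply: IH => j js; apply: hF; rewrite inE js orbT.
Qed.
Lemma S_sum (I : eqType) (s : seq I) (c : I -> R[i]) (F : I -> A) :
  (forall i, i \in s -> matA (F i)) ->
  S (\sum_(i <- s) c i *: F i) = \sum_(i <- s) c i *: S (F i).
Proof.
elim: s => [|i s IH] hF; first by rewrite !big_nil S0.
have hs j : j \in s -> matA (F j) by move=> js; apply: hF; rewrite inE js orbT.
rewrite !big_cons S_lin ?IH //; first by apply: hF; rewrite mem_head.
exact: matA_sum.
Qed.

Section Irr.
Variables (n : nat) (u : 'M[A]_n).
Hypothesis hu : irr_corep Delta u.

Lemma delta_sum (F : 'I_n -> A) j : \sum_k (j == k)%:R *: F k = F j.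
Proof.
rewrite (bigD1 j) //= eqxx scale1r big1 ?addr0 // => k.
by rewrite eq_sym => /negPf ->; rewrite scale0r.
Qed.

Lemma counit_irr eps i j : counit Delta eps -> eps (u i j) = (i == j)%:R.
Proof.
move=> [_ h]; have h1 m : \sum_k eps (u i k) *: u k m = u i m.
  by have [+ _] := h _ _ (matA_irr hu i m) (irr_decP hu i m); rewrite big_map.
have : \sum_m (\sum_k eps (u i k) *: u k m) * star (u j m) = \sum_m u i m * star (u j m).
  by apply: eq_bigr => m _; rewrite h1.
rewrite (irr_uustar hu); under eq_bigr do rewrite mulr_suml.
rewrite exchange_big /=.
have -> : \sum_k \sum_m eps (u i k) *: u k m * star (u j m) = eps (u i j) *: 1.
  rewrite -(delta_sum (fun k => eps (u i k) *: 1) j); apply: eq_bigr => k _.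
  under eq_bigr do rewrite -scalerAl.
  rewrite -scaler_sumr (irr_uustar hu) eq_sym; case: (j == k); first by rewrite scale1r.
  by rewrite scaler0 scale0r.
case: eqP => _ /eqP; last by rewrite scaler_eq0 oner_eq0 orbF => /eqP.
rewrite -[X in _ == X]scale1r -subr_eq0 -scalerBl scaler_eq0 oner_eq0 orbF subr_eq0.
by move=> /eqP.
Qed.

(** The antipode axiom makes S(u) a left inverse of the matrix u, of which u^* is a right
    inverse. *)
Lemma S_irr i j : S (u i j) = star (u j i).
Proof.
have [_ _ [eps heps h]] := hS.
have h1 m : \sum_k S (u i k) * u k m = (i == m)%:R *: 1.
  have [+ _] := h _ _ (matA_irr hu i m) (irr_decP hu i m).
  by rewrite big_map (counit_irr _ _ heps).
have : \sum_m (\sum_k S (u i k) * u k m) * star (u j m) = \sum_m (i == m)%:R *: star (u j m).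
  by apply: eq_bigr => m _; rewrite h1 -scalerAl mul1r.
rewrite delta_sum => <-; under [RHS]eq_bigr do rewrite mulr_suml.
rewrite exchange_big /= -[LHS](delta_sum (fun k => S (u i k)) j); apply: eq_bigr => k _.
under eq_bigr do rewrite -mulrA.
rewrite -mulr_sumr (irr_uustar hu) eq_sym; case: (_ == _); first by rewrite scale1r mulr1.
by rewrite scale0r mulr0.
Qed.

(** Stability of [matA] under the involution is read off from its stability under S. *)
Lemma matA_star_irr i j : matA (star (u i j)).
Proof. by rewrite -S_irr; apply: S_matA; exact: matA_irr. Qed.

Lemma star_irr_dec i j : decomposes matA matA (Delta (star (u i j)))
  [seq (star (u i k), star (u k j)) | k <- index_enum 'I_n].
Proof.
refine (bop_decomposes (hd := hD) _ _).
  by move=> p /mapP[k _ ->]; split; exact: matA_star_irr.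
rewrite dB_star (dB_irr hD hu) big_map; apply: adj_uniq => x y.
rewrite !bsumE inner_suml inner_sumr; apply: eq_bigr => k _.
by rewrite adjP adj_tn -!brep_star.
Qed.

(** The entries are S^-1(u_kj), in the explicit form star o S o star; [antipode_invE] shows that
    this is the inverse of S on [matA]. *)
Definition zz : 'M[A]_n := \matrix_(k, j) star (S (star (u k j))).

Lemma matA_zz k j : matA (star (zz k j)).
Proof. by rewrite mxE starK; apply: S_matA; exact: matA_star_irr. Qed.

Lemma zz_irr i j : \sum_k zz k j * u i k = (i == j)%:R.
Proof.
have [_ _ [eps heps h]] := hS.
(* The axioms for [eps] do not mention the involution, so its values at the adjoint coefficients are
   computed anew. *)
have e1 m : eps (star (u i m)) = (i == m)%:R.
  have h1 j' : \sum_k eps (star (u i k)) *: star (u k j') = star (u i j').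
    by have [+ _] := heps.2 _ _ (matA_star_irr i j') (star_irr_dec i j'); rewrite big_map.
  have {}h1 j' : \sum_k Num.conj (eps (star (u i k))) *: u k j' = u i j'.
    rewrite -[RHS]starK -h1 star_sum; apply: eq_bigr => k _.
    by rewrite starZ starK.
  have : \sum_j' (\sum_k Num.conj (eps (star (u i k))) *: u k j') * star (u m j') =
      \sum_j' u i j' * star (u m j').
    by apply: eq_bigr => j' _; rewrite h1.
  rewrite (irr_uustar hu); under eq_bigr do rewrite mulr_suml.
  rewrite exchange_big /=.
  have -> : \sum_k \sum_j' Num.conj (eps (star (u i k))) *: u k j' * star (u m j') =
     Num.conj (eps (star (u i m))) *: 1.
    rewrite -(delta_sum (fun k => Num.conj (eps (star (u i k))) *: 1) m).
    apply: eq_bigr => k _; under eq_bigr do rewrite -scalerAl.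
    rewrite -scaler_sumr (irr_uustar hu) eq_sym; case: (m == k); first by rewrite scale1r.
    by rewrite scaler0 scale0r.
  move=> hc; apply: (can_inj (@conjK R)); move: hc.
  case: eqP => _ /eqP; rewrite ?conjC1 ?conj0; last first.
    by rewrite scaler_eq0 oner_eq0 orbF => /eqP.
  rewrite -[X in _ == X]scale1r -subr_eq0 -scalerBl scaler_eq0 oner_eq0 orbF subr_eq0.
  by move=> /eqP.
(* The antipode axiom at [star (u i j)], read through the involution, yields the products in the
   order S^-1(u_kj) u_ik. *)
have [_] := h _ _ (matA_star_irr i j) (star_irr_dec i j).
rewrite big_map e1 => /(congr1 star); rewrite star_sum starZ star1.
have -> : Num.conj (i == j)%:R *: 1 = (i == j)%:R :> A.
  by case: (i == j); rewrite ?conjC1 ?scale1r ?conj0 ?scale0r.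
by move=> <-; apply: eq_bigr => k _; rewrite mxE starM starK.
Qed.

(* (phi(u_ij .) (x) iota) Delta(c) = sum_k phi(u_ik c) z_kj *)
Lemma strong_left i j c l l' :
  phi (u i j * coefg (tens AA) (dB hD c) l l') =
  \sum_k phi (u i k * c) * [<rep (zz k j) l, l'>].
Proof.
set T := dB hD c; have aT : aop (tens AA) T by exact: dB_aop.
(* As in [strong_right], with [zz_irr] in place of u^* u = 1: the factors now stand in the opposite
   order, which is why S^-1 appears. *)
transitivity (\sum_k \sum_m
   phi (u i m * coefg (tens AA) T l (brep (star (u m k) * star (zz k j)) l'))).
  rewrite exchange_big.
  have key m : \sum_k phi (u i m * coefg (tens AA) T l
      (brep (star (u m k) * star (zz k j)) l')) =
    phi (u i m * coefg (tens AA) T l (brep (m == j)%:R l')).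
    rewrite -(phi_sum hphi) -mulr_sumr -(coefg_sumr ht) //; congr (phi (_ * coefg _ _ _ _)).
    rewrite -bsumE -brep_sum; congr (brep _ _).
    under eq_bigr do rewrite -starM.
    rewrite -star_sum zz_irr; case: (m == j); [exact: star1|exact: star0].
  rewrite (eq_bigr _ (fun m _ => key m)) (bigD1 j) // big1 ?addr0 => [|m mi].
    by rewrite eqxx mulr1n brep1 b1E /= addr0.
  by rewrite (negPf mi) brep0 b0E (coefg0r ht) mulr0 (phi0 hphi).
apply: eq_bigr => k _; rewrite -(phi_sum hphi).
have -> : [<rep (zz k j) l, l'>] = [<l, brep (star (zz k j)) l'>].
  by rewrite -[rep _ l]/(brep (zz k j) l) adjP -brep_star.
rewrite -(haar_left hD hphi); congr phi; apply/esym/coefgP.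
move=> m m'; rewrite dBM (dB_irr hD hu) mulr_suml bsumE inner_suml.
rewrite -[rep _ m]/(brep _ m) brep_sum bsumE inner_suml; apply: eq_bigr => q _.
apply: (has_coef_mull ht) => m1 m2.
by rewrite brepM bME -brep_star; exact: coefgE.
Qed.
End Irr.

Lemma matA_star a : matA a -> matA (star a).
Proof.
move: a; apply: (@lspan_induct R A _ (fun a => matA (star a))).
  by rewrite star0; exact: lspan0.
move=> c _ y [n [u [i [j [hu ->]]]]] _ hy; rewrite star_antilinear; apply: lspan_lin => //.
exact: (matA_star_irr hu).
Qed.

Lemma star_S_star a : matA a -> star (S (star (S a))) = a.
Proof.
move: a; apply: (@lspan_induct R A _ (fun a => star (S (star (S a))) = a)).
  by rewrite S0 star0 S0 star0.
move=> c _ y [n [u [i [j [hu ->]]]]] hy IH.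
have h1 : matA (u i j) by exact: (matA_irr hu).
rewrite S_lin // star_antilinear S_lin; try by apply: matA_star; exact: S_matA.
rewrite star_antilinear conjK IH; congr (_ *: _ + _).
by rewrite (S_irr hu) starK (S_irr hu) starK.
Qed.

Lemma antipode_invE a : matA a -> antipode_inv Delta S a = star (S (star a)).
Proof.
move=> ha; apply: xget_unique.
  split; first by apply/matA_star/S_matA/matA_star.
  by have := star_S_star (matA_star ha) => /(congr1 star); rewrite !starK.
by move=> c [hc <-]; rewrite star_S_star.
Qed.

Lemma matA_dec a : matA a -> exists s, decomposes matA matA (Delta a) s.
Proof.
move: a; apply: (@lspan_induct R A _ (fun a => exists s, decomposes matA matA (Delta a) s)).
  exists [::]; refine (bop_decomposes (hd := hD) _ _) => //.
  by rewrite big_nil; apply: lin0; exact: dBL.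
move=> c _ y [n [u [i [j [hu ->]]]]] hy [s hs].
by eexists; apply: (decomposes_lin hD c _ hs); exact: irr_decP hu i j.
Qed.

Definition ad_spec w eta x (g : A -> R[i]) := hatA Delta phi g /\
  forall c (s : seq (A * A)) (r : A * A -> seq (A * A)),
    matA c -> decomposes matA matA (Delta c) s ->
    (forall p, p \in s -> decomposes matA matA (Delta p.1) (r p)) ->
    g c = \sum_(p <- s) \sum_(q <- r p)
            w (antipode_inv Delta S q.1 * p.2 * x) * eta q.2.

(** The specification fixes values on [matA] only. Both functionals have the form phi(a .), so they
    are compared at the adjoint of a - b, where faithfulness of phi gives a = b. *)
Lemma ad_spec_uniq w eta x g g' : ad_spec w eta x g -> ad_spec w eta x g' -> g = g'.
Proof.
move=> [[a ha gE] h] [[b hb gE'] h'].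
have eq c : matA c -> g c = g' c.
  move=> hc; have [s hs] := matA_dec hc.
  have /choice[r hr] (p : A * A) : exists r, p \in s -> decomposes matA matA (Delta p.1) r.
    have [ps|ps] := boolP (p \in s); last by exists [::].
    by have [r hr] := matA_dec (hs.1 p ps).1; exists r.
  by rewrite (h c s r) // (h' c s r).
suff ab : a = b by apply/funext => y; rewrite gE gE' ab.
have hab : matA (star (a - b)).
  by apply: matA_star; rewrite -scaleN1r; apply: lspanD => //; apply: lspanZ.
apply/eqP; rewrite -subr_eq0 -[_ - _]starK; apply/eqP; rewrite -[0](star0 A); congr star.
apply: hf; rewrite starK mulrBl (phiD hphi) -[- (b * _)]scaleN1r (phiZ hphi) -gE -gE'.
by rewrite (eq _ hab) mulN1r subrr.
Qed.

Lemma ad_dualE w eta x g : ad_spec w eta x g -> ad_dual Delta phi S w eta x = g.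
Proof. by move=> h; apply: xget_unique => // g' h'; exact: ad_spec_uniq h' h. Qed.

Lemma ad_spec_lin w eta eta' x g g' c : ad_spec w eta x g -> ad_spec w eta' x g' ->
  ad_spec w (fun y => c * eta y + eta' y) x (fun y => c * g y + g' y).
Proof.
move=> [hg h] [hg' h']; split; first exact: hatA_lin.
move=> y s r hy hs hr; rewrite (h _ s r) // (h' _ s r) // mulr_sumr -big_split /=.
apply: eq_bigr => p _; rewrite mulr_sumr -big_split /=; apply: eq_bigr => q _.
by rewrite mulrDr mulrCA.
Qed.

(** Both comultiplications of the Sweedler formula are evaluated by strong invariance:
    [strong_right] for the inner one turns S^-1(c_0) into u_ik, and [strong_left] for the outer one
    turns c_2 into z_lj. *)
Lemma ad_spec_irr w n (u : 'M[A]_n) i j x : irr_corep Delta u -> bfl w ->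
  ad_spec w (fun y => phi (u i j * y)) x
    (fun y => \sum_k \sum_l w (u i k * zz u l j * x) * phi (u k l * y)).
Proof.
move=> hu [wl wb].
have w_sum (I : Type) (s : seq I) (c : I -> R[i]) (F : I -> A) :
    w (\sum_(i <- s) c i *: F i) = \sum_(i <- s) c i * w (F i).
  elim: s => [|y s IH]; last by rewrite !big_cons wl IH.
  rewrite !big_nil; have := wl (-1) 0 0; rewrite scaler0 addr0 mulN1r addNr //.
split.
  exists (\sum_k \sum_l w (u i k * zz u l j * x) *: u k l).
    have sumM (I : Type) (s : seq I) (F : I -> A) : (forall i, matA (F i)) ->
        matA (\sum_(i <- s) F i).
      move=> hF; elim: s => [|y s IH]; first by rewrite big_nil; exact: lspan0.
      rewrite big_cons; apply: lspanD; [exact: hF|exact: IH].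
    by apply: (sumM) => k; apply: (sumM) => l; apply: lspanZ; exact: (matA_irr hu).
  move=> y; rewrite mulr_suml (phi_sum hphi); apply: eq_bigr => k _.
  rewrite mulr_suml (phi_sum hphi); apply: eq_bigr => l _.
  by rewrite -scalerAl (phiZ hphi).
move=> c s r hc hs hr.
have inner p : p \in s ->
    \sum_(q <- r p) phi (u i j * q.2) *: antipode_inv Delta S q.1 =
    \sum_k phi (u k j * p.1) *: u i k.
  move=> ps; have rp := hr p ps.
  have star_sumZ (I : eqType) (z : seq I) (d : I -> R[i]) (F : I -> A) :
      star (\sum_(q <- z) d q *: F q) = \sum_(q <- z) Num.conj (d q) *: star (F q).
    by rewrite star_sum; apply: eq_bigr => q _; rewrite starZ.
  have inv_sum (I : eqType) (z : seq I) (d : I -> R[i]) (F : I -> A) :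
      (forall q, q \in z -> matA (F q)) ->
      \sum_(q <- z) d q *: antipode_inv Delta S (F q) =
      antipode_inv Delta S (\sum_(q <- z) d q *: F q).
    move=> hF; rewrite antipode_invE; last exact: matA_sum.
    rewrite star_sumZ S_sum; last by move=> q /hF; exact: matA_star.
    rewrite star_sumZ big_seq [RHS]big_seq; apply: eq_bigr => q qz.
    by rewrite conjK antipode_invE //; exact: hF.
  rewrite inv_sum; last by move=> q /(rp.1 _)[].
  have -> : \sum_(q <- r p) phi (u i j * q.2) *: q.1 =
      \sum_k phi (u k j * p.1) *: star (u k i).
    apply: brep_ext => l l'; rewrite !brep_sum !bsumE !inner_suml.
    under [RHS]eq_bigr do rewrite brepZ bZE innerZl.
    rewrite -(strong_right hD hphi hu) (decomposes_bop hD rp).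
    under [in RHS]eq_bigr do rewrite -tn_flip.
    rewrite (coefg_sum_tn (tensor_map_flip ht)).
    rewrite mulr_sumr (phi_sum hphi); apply: eq_bigr => q _.
    by rewrite -scalerAr (phiZ hphi) brepZ bZE innerZl mulrC.
  rewrite -inv_sum; last by move=> k _; exact: (matA_star_irr hu).
  apply: eq_bigr => k _; rewrite antipode_invE; last exact: (matA_star_irr hu).
  by rewrite starK (S_irr hu) starK.
have outer k : \sum_(p <- s) phi (u k j * p.1) *: p.2 =
    \sum_l phi (u k l * c) *: zz u l j.
  apply: brep_ext => l l'; rewrite !brep_sum !bsumE !inner_suml.
  under [RHS]eq_bigr do rewrite brepZ bZE innerZl.
  rewrite -(strong_left hu) (decomposes_bop hD hs).
  rewrite (coefg_sum_tn ht).
  rewrite mulr_sumr (phi_sum hphi); apply: eq_bigr => p _.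
  by rewrite -scalerAr (phiZ hphi) brepZ bZE innerZl mulrC.
transitivity (\sum_k w (u i k * (\sum_(p <- s) phi (u k j * p.1) *: p.2) * x)).
  apply: eq_bigr => k _; rewrite outer mulr_sumr mulr_suml.
  under [in RHS]eq_bigr do rewrite -scalerAr -scalerAl.
  by rewrite w_sum; apply: eq_bigr => l _; rewrite mulrC.
transitivity (\sum_(p <- s) w (\sum_k phi (u k j * p.1) *: u i k * p.2 * x)).
  under eq_bigr => k _.
    rewrite mulr_sumr mulr_suml; under eq_bigr do rewrite -scalerAr -scalerAl.
    rewrite w_sum; over.
  rewrite exchange_big /=; apply: eq_bigr => p _.
  under [in RHS]eq_bigr do rewrite -!scalerAl.
  by rewrite w_sum.
rewrite big_seq [RHS]big_seq; apply: eq_bigr => p ps.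
rewrite -!mulr_suml -(inner p ps) !mulr_suml.
under eq_bigr do rewrite -!scalerAl.
by rewrite w_sum; apply: eq_bigr => q _; rewrite mulrC.
Qed.

Lemma ad_spec_ex w a x : matA a -> bfl w -> exists g, ad_spec w (fun y => phi (a * y)) x g.
Proof.
move=> + hw; move: a.
apply: (@lspan_induct R A _ (fun a => exists g, ad_spec w (fun y => phi (a * y)) x g)).
  exists (fun=> 0); split.
    by exists 0; [exact: lspan0|move=> y; rewrite mul0r (phi0 hphi)].
  move=> c s r _ _ _; rewrite big1 // => p _; rewrite big1 // => q _.
  by rewrite mul0r (phi0 hphi) mulr0.
move=> c _ y [n [u [i [j [hu ->]]]]] hy [g hg].
have := ad_spec_lin c (ad_spec_irr i j x hu hw) hg => h.
eexists; suff <- : (fun y' => c * phi (u i j * y') + phi (y * y')) =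
  (fun y' => phi ((c *: u i j + y) * y')) by exact: h.
by apply/funext => z; rewrite mulrDl -scalerAl (phi_scalar hphi).
Qed.
End Antipode.

(** * Unitary corepresentations *)

Section CompactRank1.
Variables (R : realType) (H : hilbertType R).

(** The image of the unit ball consists of multiples of x with coefficient in a square of side 2
    |y|. Compactness is needed because the corepresentation condition is tested on A (x) K(H). *)
Lemma rank1_compact (x y : H) : compact_op (rank1 x y).
Proof.
split; first exact: bop_bounded.
pose f (p : R * R) : H := (p.1 +i* p.2) *: x.
pose K := f @` (`[- nr y, nr y]%classic `*` `[- nr y, nr y]%classic).
have fc : continuous f.
  move=> q; apply/cvgrPdist_le => e /posC[d d0 ->].
  have n1 : 0 < nr x + 1 by rewrite ltr_wpDl // nr_ge0.
  have d' : 0 < d / (nr x + 1) / 2 by rewrite !divr_gt0.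
  have h1 : \forall p \near q, `|q.1 - p.1| <= d / (nr x + 1) / 2.
    have c1 : p.1 @[p --> q] --> q.1 by exact: cvg_fst.
    by have /cvgrPdist_le/(_ _ d') := c1.
  have h2 : \forall p \near q, `|q.2 - p.2| <= d / (nr x + 1) / 2.
    have c2 : p.2 @[p --> q] --> q.2 by exact: cvg_snd.
    by have /cvgrPdist_le/(_ _ d') := c2.
  near=> p; rewrite nrE lecR /f -scalerBl nrZ.
  have hc : cabs ((q.1 +i* q.2) - (p.1 +i* p.2)) <= d / (nr x + 1).
    rewrite (le_trans (cabs_ReIm _)) //= (splitr (d / _)) lerD //.
      by near: p; exact: h1.
    by near: p; exact: h2.
  rewrite (le_trans (ler_wpM2r (nr_ge0 _) hc)) // mulrAC -mulrA -[leRHS]mulr1.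
  by rewrite ler_wpM2l ?(ltW d0) // ler_pdivrMr // mul1r lerDl.
have Kc : compact K.
  apply: continuous_compact; first exact: continuous_subspaceT.
  by apply: compact_setX; exact: segment_compact.
apply: (subclosed_compact _ Kc); first exact: closed_closure.
have Kcl : closed K by apply: compact_closed => //; exact: norm_hausdorff.
rewrite closureE => z; apply; split=> // _ [v /= v1 <-].
have v1' : nr v <= 1 by rewrite -lecR -nrE.
have hb : cabs [<v, y>] <= nr y.
  by rewrite (le_trans (CS _ _)) // -[leRHS]mul1r ler_wpM2r ?nr_ge0.
exists (complex.Re [<v, y>], complex.Im [<v, y>]); last first.
  by rewrite /f /=; case: [<v, y>].
split; rewrite /= in_itv /= -ler_norml.
  exact: le_trans (Re_cabs _) hb.
exact: le_trans (Im_cabs _) hb.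
Unshelve. all: by end_near. Qed.
End CompactRank1.

(** * Columns over a C*-algebra and their norms *)

Section Complete.
Variables (R : realType).
Implicit Types (M N H P K L : hilbertType R).

Lemma bop_complete M (u : nat -> bop M) :
  (forall e : R, 0 < e -> exists n, forall p q, (n <= p)%N -> (n <= q)%N -> bdd (u p - u q) e) ->
  exists V : bop M, forall e : R, 0 < e -> exists n, forall p, (n <= p)%N -> bdd (V - u p) e.
Proof.
move=> hu.
have /choice[V hV] (x : M) : exists z, cvn (fun n => u n x) z.
  apply: complete_cvn => e e0; have n1 : 0 < nr x + 1 by rewrite ltr_wpDl // nr_ge0.
  have [|n hn] := hu (e / (nr x + 1)); first by rewrite divr_gt0.
  exists n => p q hp hq; rewrite -bBE (le_trans ((hn p q hp hq).2 x)) // mulrAC -mulrA.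
  by rewrite -[leRHS]mulr1 ler_wpM2l ?(ltW e0) // ler_pdivrMr // mul1r lerDl.
have near (e : R) : 0 < e -> exists n, forall p x, (n <= p)%N -> nr (V x - u p x) <= e * nr x.
  move=> e0; have [n hn] := hu e e0; exists n => p x hp.
  apply/ler_addgt0Pl => d d0; have [m hm] := hV x d d0.
  have h1 := hm (maxn n m) (leq_maxr _ _); have h2 := (hn _ p (leq_maxl n m) hp).2 x.
  rewrite -(subrKA (u (maxn n m) x)) (le_trans (nrD _ _)) // nrB; apply: lerD => //.
  by rewrite -bBE.
have Vl : linear V.
  move=> c x y; apply: (cvn_uniq (hV (c *: x + y))) => e e0.
  have n1 : 0 < cabs c + 1 by rewrite ltr_wpDl // cabs_ge0.
  have e2 : 0 < e / 2 by rewrite divr_gt0.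
  have [|n hn] := hV x (e / 2 / (cabs c + 1)); first by rewrite divr_gt0.
  have [m hm] := hV y _ e2; exists (maxn n m) => p; rewrite geq_max => /andP[hp hq].
  rewrite blinear opprD addrACA -scalerBr (le_trans (nrD _ _)) // nrZ (splitr e) lerD //.
    rewrite (le_trans (ler_wpM2l (cabs_ge0 _) (hn p hp))) // mulrCA -[leRHS]mulr1.
    by rewrite ler_wpM2l ?(ltW e2) // ler_pdivrMr // mul1r lerDl.
  exact: hm.
have [n0 h0] := near 1 ltr01; have [C hC] := bbdd (u n0).
have Vb : bounded_op V.
  apply/bounded_opP; split=> //; exists (1 + C); split=> [|x]; first by rewrite addr_ge0 // hC.1.
  rewrite -[V x](subrK (u n0 x)) (le_trans (nrD _ _)) // mulrDl lerD ?h0 //; exact: hC.2.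
exists (Bop V Vb) => e e0; have [n hn] := near e e0; exists n => p hp; split=> [|x]; first exact: ltW.
by rewrite bBE; exact: hn.
Qed.

Lemma tensor_slice_vec N H P (t : N -> H -> P) (ht : tensor_map t) l0 :
  exists E : P -> N, [/\ linear E, bdd E (nr l0) & forall x k, [<E x, k>] = [<x, t k l0>]].
Proof.
have [tl tr ti ta] := ht.
apply: (@form_op R P N (fun x k => [<x, t k l0>])); first exact: nr_ge0.
- by move=> c x y z; rewrite innerDl innerZl.
- by move=> c x y z; rewrite tl innerDr innerZr.
- move=> x k; rewrite (le_trans (CS _ _)) // (nr_tensor ht).
  by have -> : nr l0 * nr x * nr k = nr x * (nr k * nr l0) by ring.
Qed.

Section Column.
Variables (A : cstarAlgType R) (H : hilbertType R) (l0 : H).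
Hypothesis l01 : nr l0 = 1.

(** For the column T, the sum of the a (x) |l><l0|, this is the element with T^* T = gram (x)
    |l0><l0|; it determines the norm of T inside A. *)
Definition gram (s : seq (A * H)) : A :=
  \sum_(p <- s) \sum_(q <- s) [<p.2, q.2>] *: (star q.1 * p.1).

Lemma gram_sa s : star (gram s) = gram s.
Proof.
rewrite star_sum /gram exchange_big; apply: eq_bigr => p _; rewrite star_sum.
by apply: eq_bigr => q _; rewrite starZ starM starK -inner_conj.
Qed.

Variables (N P : hilbertType R) (t : N -> H -> P) (ht : tensor_map t).
Variables (psi : A -> bop N) (hp : star_hom psi).

Lemma column_norm s (E : P -> N) x : (forall x k, [<E x, k>] = [<x, t k l0>]) ->
  nr ((\sum_(p <- s) tn ht (psi p.1) (rank1 p.2 l0)) x) ^+ 2 =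
  complex.Re [<psi (gram s) (E x), E x>].
Proof.
move=> hE; have [tl tr ti ta] := ht; have [pl p1 pM ps] := hp.
have tE (p : A * H) : tn ht (psi p.1) (rank1 p.2 l0) x = t (psi p.1 (E x)) p.2.
  apply: (tensor_vec_ext ht) => k l; rewrite ti adjP adj_tn tnE.
  have -> : adj (rank1 p.2 l0) = rank1 l0 p.2.
    apply: adj_uniq => y z; rewrite !rank1E innerZl innerZr -inner_conj.
    by rewrite mulrC.
  rewrite rank1E (linZ (tr _)) innerZr -hE [in RHS]adjP mulrC -inner_conj //.
rewrite bsumE; under eq_bigr do rewrite tE.
rewrite nr_sq inner_suml /gram (lin_sum pl) bsumE inner_suml; congr complex.Re.
apply: eq_bigr => p _; rewrite inner_sumr (lin_sum pl) bsumE inner_suml.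
apply: eq_bigr => q _; rewrite ti (linZ pl) bZE innerZl pM bME ps adjP'.
by rewrite mulrC.
Qed.
End Column.

Lemma sa_form_real (A : cstarAlgType R) N (psi : A -> bop N) a v : star_hom psi -> star a = a ->
  [<psi a v, v>] = (complex.Re [<psi a v, v>])%:C.
Proof.
move=> [_ _ _ ps] sa; have : Num.conj [<psi a v, v>] = [<psi a v, v>].
  by rewrite -inner_conj -adjP' -ps sa.
case: [<_, _>] => x y; rewrite conjE /= => -[] /eqP; rewrite eq_sym -subr_eq0 opprK.
by rewrite -mulr2n mulrn_eq0 /= => /eqP ->.
Qed.

(* The only case of the functoriality of the minimal tensor norm that is needed. *)
Lemma column_le (A : repCStar R) H (l0 : H) M (t : rc_space A -> H -> M) (ht : tensor_map t)
    N P (t' : N -> H -> P) (ht' : tensor_map t') (psi : A -> bop N) (s : seq (A * H)) C :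
  nr l0 = 1 -> star_hom psi ->
  bdd (\sum_(p <- s) tn ht (brep p.1) (rank1 p.2 l0)) C ->
  bdd (\sum_(p <- s) tn ht' (psi p.1) (rank1 p.2 l0)) C.
Proof.
move=> l01 hp [C0 hC]; split=> // x.
have [E0 [_ _ hE0]] := tensor_slice_vec ht l0.
have [E1 [_ [_ E1b] hE1]] := tensor_slice_vec ht' l0.
have [pl p1 pM ps] := hp.
(* The bound in the faithful representation makes y positive, hence a square in A; this algebraic
   fact survives [psi] and gives back the same bound. *)
pose y := (C ^+ 2)%:C *: 1 - gram s.
have ys : star y = y by rewrite starB starZ star1 conj_real gram_sa.
have yE N' (chi : A -> bop N') w : star_hom chi ->
    complex.Re [<chi y w, w>] = C ^+ 2 * nr w ^+ 2 - complex.Re [<chi (gram s) w, w>].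
  move=> [cl c1 _ _]; rewrite /y (linB cl) (linZ cl) c1 bBE bZE b1E innerBl innerZl.
  by rewrite ReD ReN ReCM -nr_sq.
have [v|g [gs gg _]] := positive_square (brep_hom A) (@brep_inj _ A) ys.
  rewrite (sa_form_real _ (brep_hom A) ys) lecR yE; last exact: brep_hom.
  have [tl tr ti ta] := ht.
  have E0v : E0 (t v l0) = v.
    by apply: inner_inj => k; rewrite hE0 ti inner_nr l01 expr1n mulr1.
  have := column_norm ht (brep_hom A) s (t v l0) hE0.
  rewrite E0v => <-; rewrite subr_ge0 -exprMn ler_pXn2r ?nnegrE ?mulr_ge0 ?nr_ge0 //.
  by rewrite (le_trans (hC _)) // (nr_tensor ht) l01 mulr1.
rewrite -(@ler_pXn2r _ 2) ?nnegrE ?mulr_ge0 ?nr_ge0 // (column_norm ht' hp s x hE1).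
rewrite exprMn (@le_trans _ _ (C ^+ 2 * nr (E1 x) ^+ 2)) //.
  rewrite -subr_ge0 -yE // -gg pM bME -{1}gs ps adjP' -nr_sq; exact: sqr_ge0.
rewrite ler_wpM2l ?sqr_ge0 // ler_pXn2r ?nnegrE ?nr_ge0 // (le_trans (E1b x)) //.
by rewrite l01 mul1r.
Qed.
End Complete.

Lemma small_eq (R : realType) (z z' : R[i]) (C : R) : 0 <= C ->
  (forall e, 0 < e -> cabs (z - z') <= C * e) -> z = z'.
Proof.
move=> C0 h; apply/eqP; rewrite -subr_eq0; apply/eqP/cabs_eq0/eqP.
rewrite eq_le cabs_ge0 andbT; apply/ler_addgt0Pl => e e0; rewrite addr0.
have C1 : 0 < C + 1 by rewrite ltr_wpDl.
apply: le_trans (h (e / (C + 1)) _) _; first by rewrite divr_gt0.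
by rewrite mulrCA -[leRHS]mulr1 ler_wpM2l ?(ltW e0) // ler_pdivrMr // mul1r lerDl.
Qed.

Section ApproxCoef.
Variables (R : realType) (C : repCStar R) (L M N M' : hilbertType R).
Variables (t : rc_space C -> L -> M) (t' : N -> L -> M') (psi : C -> bop N).
Hypotheses (ht : tensor_map t) (ht' : tensor_map t') (hpsi : star_hom psi).

(** T' stands for (psi (x) iota)(T), known only through simultaneous approximations. Both sides
    depend continuously on them. It is used for Delta, and with flipped legs for alpha. *)
Lemma approx_coef (T : bop M) (T' : bop M') :
  (forall e : R, 0 < e -> exists s : seq (C * bop L),
     bdd (T - \sum_(p <- s) tn ht (brep p.1) p.2) e /\
     bdd (T' - \sum_(p <- s) tn ht' (psi p.1) p.2) e) ->
  aop t T /\ forall z z' l l',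
    [<T' (t' z l), t' z' l'>] = [<psi (coefg t T l l') z, z'>].
Proof.
have [pl _ _ _] := hpsi; move=> h.
have aT : aop t T.
  apply: (aop_lim ht) => e /h[s [hs _]]; eexists; split; last exact: hs.
  by apply: aop_sum => p; exact: aop_tn.
split=> // z z' l l'; apply: (@small_eq _ _ _ (2 * (nr l * nr l' * nr z * nr z'))).
  by rewrite !mulr_ge0 ?nr_ge0.
move=> e /h[s [h1 h2]].
set Ts := \sum_(p <- s) _ in h1; set Ts' := \sum_(p <- s) _ in h2.
have cs : has_coef t Ts l l' (\sum_(p <- s) [<p.2 l, l'>] *: p.1).
  by apply: has_coef_sum => p; exact: has_coef_tn.
set c := coefg _ _ _ _; set d := \sum_(p <- s) _ in cs.
have cd : cnorm (c - d) <= e * nr l * nr l'.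
  by apply: (cnorm_coef ht) h1; apply: has_coefB => //; exact: coefgE.
have Ts'E : [<Ts' (t' z l), t' z' l'>] = [<psi d z, z'>].
  rewrite bsumE inner_suml (lin_sum pl) bsumE inner_suml; apply: eq_bigr => p _.
  by rewrite inner_tn (linZ pl) bZE innerZl mulrC.
have -> : [<T' (t' z l), t' z' l'>] - [<psi c z, z'>] =
    [<(T' - Ts') (t' z l), t' z' l'>] - [<psi (c - d) z, z'>].
  by rewrite bBE (linB pl) bBE !innerBl Ts'E opprB addrA subrK.
rewrite (le_trans (cabsD _ _)) // cabsN.
rewrite [_ * e]mulrC (_ : e * (2 * _) = e * nr l * nr l' * nr z * nr z' +
   e * nr l * nr l' * nr z * nr z'); last by ring.
apply: lerD; rewrite (le_trans (CS _ _)) //.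
  rewrite (le_trans (ler_wpM2r (nr_ge0 _) (h2.2 _))) // !(nr_tensor ht') le_eqVlt.
  by apply/orP; left; apply/eqP; ring.
rewrite ler_wpM2r ?nr_ge0 // (le_trans ((hom_contractive hpsi _).2 _)) //.
by rewrite ler_wpM2r ?nr_ge0.
Qed.
End ApproxCoef.

(** * The extension Delta (x) iota and the legs of operators *)

Section DeltaIota.
Variables (R : realType) (A : repCStar R) (AA : tensC A A) (Delta : A -> AA -> AA).
Hypothesis hD : unital_star_hom Delta.
Variables (L : hilbertType R) (AL : hilbertTensor (rc_space A) L) (AAL : hilbertTensor AA L).
Local Notation hl := (hilbertTensor_map AL).
Local Notation hal := (hilbertTensor_map AAL).

Lemma seq_bop (Y : set (L -> L)) (s : seq (A * (L -> L))) :
  (forall S, Y S -> bounded_op S) -> (forall p, p \in s -> Y p.2) ->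
  exists s' : seq (A * bop L), [/\ forall p, p \in s' -> Y p.2,
    \sum_(p <- s) op_tens AL (rep p.1) p.2 = bfun (\sum_(p <- s') tn hl (brep p.1) p.2) &
    \sum_(p <- s) op_tens AAL (Delta p.1) p.2 =
      bfun (\sum_(p <- s') tn hal (dB hD p.1) p.2)].
Proof.
move=> Yb; elim: s => [|p s IH] sY; first by exists [::]; rewrite !big_nil.
have [|s' [s'Y h1 h2]] := IH; first by move=> q qs; apply: sY; rewrite inE qs orbT.
have Yp : Y p.2 by apply: sY; rewrite mem_head.
exists ((p.1, Bop p.2 (Yb _ Yp)) :: s'); rewrite !big_cons /=; split.
- by move=> q; rewrite inE => /orP[/eqP->|/s'Y].
- by rewrite h1 -(op_tensE AL (brep p.1) (Bop p.2 (Yb _ Yp))).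
- by rewrite h2 -(op_tensE AAL (dB hD p.1) (Bop p.2 (Yb _ Yp))).
Qed.

Lemma Delta_iota_coef Y (T : bop AL) (T' : bop AAL) : (forall S, Y S -> bounded_op S) ->
  Delta_iota Delta Y T T' -> aop (tens AL) T /\ forall z z' l l',
    [<T' (tens AAL z l), tens AAL z' l'>] = [<dB hD (coefg (tens AL) T l l') z, z'>].
Proof.
move=> Yb [_ h].
apply: (approx_coef (ht := hl) (ht' := hal) (dB_hom hD)) => e e0.
have eC : 0 < e%:C :> R[i] by rewrite ltcR.
have [s [sY h1 h2]] := h _ eC; have [s' [_ E1 E2]] := seq_bop Yb sY.
exists s'; split; (split=> [|x]; [exact: ltW|]).
  by have := h1 x; rewrite E1 bBE !nrE -CM lecR.
by have := h2 x; rewrite E2 bBE !nrE -CM lecR.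
Qed.
End DeltaIota.

Section Triple.
Variables (R : realType) (K1 K2 L P Q M : hilbertType R).
Variables (a : K1 -> K2 -> P) (b : P -> L -> M) (c : K2 -> L -> Q) (J : K1 -> Q -> M).
Hypotheses (hc : tensor_map c) (hJ : tensor_map J).
Hypothesis JE : forall k1 k2 l, J k1 (c k2 l) = b (a k1 k2) l.

Lemma tensor_rslice (x : M) (k : K1) : exists y : Q, forall z, [<x, J k z>] = [<y, z>].
Proof.
have [Jl Jr Ji Ja] := hJ.
have [||y hy] := @riesz R Q (fun z => [<J k z, x>]) (nr k * nr x).
- by move=> d u v; rewrite Jr innerDl innerZl.
- move=> z; rewrite (le_trans (CS _ _)) // (nr_tensor hJ).
  by rewrite mulrAC.
by exists y => z; rewrite inner_conj hy -inner_conj.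
Qed.

Lemma triple_total (x : M) : (forall k1 k2 l, [<x, b (a k1 k2) l>] = 0) -> x = 0.
Proof.
move=> h; apply: (tensor_total hJ) => k z; have [y hy] := tensor_rslice x k.
rewrite hy (tensor_total hc (x := y)) ?inner0l // => k2 l.
by rewrite -hy JE.
Qed.

(** Totality of the simple threefold tensors is used twice, for the values of f - g and for those of
    its adjoint. *)
Lemma triple_bop_eq (f g : bop M) :
  (forall k1 k2 l k1' k2' l', [<f (b (a k1 k2) l), b (a k1' k2') l'>] =
     [<g (b (a k1 k2) l), b (a k1' k2') l'>]) -> f = g.
Proof.
move=> h; apply/eqP; rewrite -subr_eq0; apply/eqP.
apply: bopP => x; rewrite b0E; apply: triple_total => k1 k2 l.
rewrite adjP (_ : adj (f - g) (b (a k1 k2) l) = 0) ?inner0r //.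
apply: triple_total => k1' k2' l'; rewrite adjP' inner_conj bBE innerBl h subrr conj0 //.
Qed.
End Triple.

Section Legs.
Variables (R : realType) (K1 K2 L : hilbertType R).
Variables (KK : hilbertTensor K1 K2) (KKL : hilbertTensor KK L).
Local Notation hK := (hilbertTensor_map KK).
Local Notation hKL := (hilbertTensor_map KKL).

Lemma leg1_23E (K2L : hilbertTensor K2 L) (J : K1 -> K2L -> KKL) (hJ : tensor_map J)
    (T : bop K1) (V : bop K2L) :
  (forall k1 k2 l, J k1 (tens K2L k2 l) = tens KKL (tens KK k1 k2) l) ->
  leg1_23 KKL T V = tn hJ T V.
Proof.
move=> JE; apply: xget_unique.
  split; first exact: bop_bounded.
  by move=> *; rewrite -!JE inner_tn.
move=> W [Wb WE]; suff -> : tn hJ T V = Bop W Wb by [].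
apply: (triple_bop_eq (hilbertTensor_map K2L) hJ JE) => *.
by rewrite -!JE inner_tn !JE /= WE.
Qed.

(** Once K2 is brought to the front by the flipped product of K1 and K2, the leg V_13 becomes 1 (x)
    V. *)
Lemma leg13E (K1L : hilbertTensor K1 L) (J : K2 -> K1L -> KKL) (hJ : tensor_map J)
    (V : bop K1L) :
  (forall k2 k1 l, J k2 (tens K1L k1 l) = tens KKL (tens KK k1 k2) l) ->
  leg13 KKL V = tn hJ 1 V.
Proof.
move=> JE; apply: xget_unique.
  split; first exact: bop_bounded.
  by move=> *; rewrite -!JE inner_tn mulrC.
move=> W [Wb WE]; suff -> : tn hJ 1 V = Bop W Wb by [].
apply: (triple_bop_eq (a := fun k2 k1 => tens KK k1 k2) (hilbertTensor_map K1L) hJ JE) => *.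
by rewrite -!JE inner_tn !JE /= WE mulrC.
Qed.
End Legs.

Section Corep.
Variables (R : realType) (A : repCStar R) (AA : tensC A A) (Delta : A -> AA -> AA).
Hypothesis hD : unital_star_hom Delta.
Variables (H : hilbertType R) (AH : hilbertTensor (rc_space A) H) (AAH : hilbertTensor AA H).
Variable U : AH -> AH.
Hypothesis hU : unitary_corep Delta AAH U.
Local Notation hl := (hilbertTensor_map AH).
Local Notation hal := (hilbertTensor_map AAH).
Local Notation haa := (hilbertTensor_map AA).

Lemma U_bounded : bounded_op U. Proof. by case: hU => -[]. Qed.
Definition Ub := Bop U U_bounded.
Lemma compact_bounded (S : H -> H) : compact_op S -> bounded_op S. Proof. by case. Qed.

Lemma A_compacts_tn (x y : H) : A_compacts (tn hl 1 (rank1 x y)).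
Proof.
split; first exact: bop_bounded.
move=> e e0; exists (tn hl 1 (rank1 x y)); last first.
  by move=> v; rewrite subrr normr0 mulr_ge0 // ltW.
apply: lspan_gen; exists idfun, (rank1 x y); split.
- by exists 1 => //; exact: rep1.
- exact: rank1_compact.
- by rewrite -op_tensE.
Qed.

Lemma A_compacts_U (x y : H) : A_compacts (Ub * tn hl 1 (rank1 x y)).
Proof. by case: hU => _ [_ /(_ _ (A_compacts_tn x y))[]]. Qed.

(** The multiplier U times 1 (x) |l0><l0| lies in A (x) K(H), so its slices are in A; the slice of U
    at l is a multiple of the one at the unit vector l0. *)
Lemma U_aop : aop (tens AH) Ub.
Proof.
have [tl tr ti ta] := hl.
move=> l l'; have [u0|u1] := unitv01 l.
  exists 0 => k k'; rewrite (unitvK l) u0 scaler0 (lin0 (tr k)) (lin0 (blinear Ub)).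
  by rewrite -[rep 0 k]/(brep 0 k) brep0 b0E !inner0l.
set l0 := unitv l in u1.
have := spatial_aop compact_bounded (A_compacts_U l0 l0).
move=> /(_ l0 l')[a ha].
exists ([<l, l0>] *: a) => k k'.
rewrite -[rep _ k]/(brep _ k) brepZ bZE innerZl ha bME tnE b1E rank1E inner_nr u1 expr1n scale1r.
by rewrite -innerZl -(linZ (blinear Ub)) -(linZ (tr k)) -unitvK.
Qed.

(* (omega_{k,k'} (x) iota)(U) *)
Lemma vslice_ex k k' : exists V : bop H,
  forall l l', [<V l, l'>] = [<Ub (tens AH k l), tens AH k' l'>].
Proof.
have [tl tr ti ta] := hl; have [C [C0 hC]] := bbdd Ub.
have [||||V [Vl Vb VE]] := @form_op R H H
   (fun l l' => [<Ub (tens AH k l), tens AH k' l'>]) (C * nr k * nr k').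
- by rewrite !mulr_ge0 ?nr_ge0.
- by move=> c x y z; rewrite tr (blinear Ub) innerDl innerZl.
- by move=> c x y z; rewrite tr innerDr innerZr.
- move=> l l'; rewrite (le_trans (CS _ _)) //.
  rewrite (le_trans (ler_wpM2r (nr_ge0 _) (hC _))) // !(nr_tensor hl).
  by have -> : C * (nr k * nr l) * (nr k' * nr l') = C * nr k * nr k' * nr l * nr l' by ring.
have Vo : bounded_op V by apply/bounded_opP; split=> //; eexists; exact: Vb.
by exists (Bop V Vo).
Qed.
Definition vslice k k' : bop H := projT1 (cid (vslice_ex k k')).
Lemma vsliceE k k' l l' : [<vslice k k' l, l'>] = [<Ub (tens AH k l), tens AH k' l'>].
Proof. by rewrite /vslice; case: cid. Qed.

(** The condition on U is an implication about pairs related by [Delta_iota], so a partner of U (1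
    (x) |l><l0|) has to be produced. It is approximated by columns, and [column_le] shows that their
    images under Delta (x) iota form a Cauchy sequence. *)
Lemma corep_limit (l l0 : H) : nr l0 = 1 -> exists Y' : bop AAH,
  Delta_iota Delta (@compact_op R H) (Ub * tn hl 1 (rank1 l l0)) Y'.
Proof.
move=> l01; set Z := Ub * _.
(* Approximants of Z have arbitrary compact second legs; multiplication by 1 (x) |l0><l0|, which
   fixes Z, turns them into columns. *)
have Zq : Z * tn hl 1 (rank1 l0 l0) = Z.
  rewrite /Z -mulrA tnM mulr1 rank1Ml rank1E inner_nr l01 expr1n scale1r //.
have approx (e : R) : 0 < e -> exists s : seq (A * H),
    bdd (Z - \sum_(p <- s) tn hl (brep p.1) (rank1 p.2 l0)) e.
  move=> e0; have [C hC] := bbdd (tn hl 1 (rank1 l0 l0)).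
  have C1 : 0 < C + 1 by rewrite ltr_wpDl // hC.1.
  have [Zb ZE h] := spatial_approx compact_bounded (A_compacts_U l l0).
  have ZZ : Z = Zb by apply: bopP => x; rewrite ZE.
  have [|s [_ hs]] := h (e / (C + 1)); first by rewrite divr_gt0.
  exists [seq (p.1, p.2 l0) | p : A * bop H <- s].
  rewrite (_ : \sum_(p <- _) _ = (\sum_(p <- s) tn hl (brep p.1) p.2) * tn hl 1 (rank1 l0 l0)).
    2: by rewrite big_map mulr_suml; apply: eq_bigr => p _; rewrite tnM mulr1 rank1Ml.
  rewrite -{1}Zq -mulrBl ZZ; apply: bdd_le (bddbM hs hC).
  by rewrite mulrAC -mulrA -[leRHS]mulr1 ler_wpM2l ?(ltW e0) // ler_pdivrMr // mul1r lerDl.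
have /choice[s hs] (n : nat) : exists s : seq (A * H),
    bdd (Z - \sum_(p <- s) tn hl (brep p.1) (rank1 p.2 l0)) n.+1%:R^-1.
  by apply: approx; rewrite invr_gt0.
pose T n := \sum_(p <- s n) tn hl (brep p.1) (rank1 p.2 l0).
pose T' n := \sum_(p <- s n) tn hal (dB hD p.1) (rank1 p.2 l0).
have diff p q C : bdd (T p - T q) C -> bdd (T' p - T' q) C.
  pose r := s p ++ [seq (- x.1, x.2) | x <- s q].
  have -> : T p - T q = \sum_(x <- r) tn hl (brep x.1) (rank1 x.2 l0).
    rewrite /r big_cat big_map /=; congr (_ + _); rewrite -sumrN; apply: eq_bigr => x _.
    by rewrite -scaleN1r -tnZl -brepZ scaleN1r.
  have -> : T' p - T' q = \sum_(x <- r) tn hal (dB hD x.1) (rank1 x.2 l0).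
    rewrite /r big_cat big_map /=; congr (_ + _); rewrite -sumrN; apply: eq_bigr => x _.
    by rewrite -scaleN1r -tnZl -(linZ (dBL hD)) scaleN1r.
  by apply: column_le => //; exact: dB_hom.
have [e e0|Y' hY] := @bop_complete R AAH T'.
  have e2 : 0 < e / 2 by rewrite divr_gt0.
  have [n hn] := invn_small e2; exists n => p q hp hq; apply: diff.
  have -> : T p - T q = - (Z - T p) + (Z - T q) by rewrite opprB subrKA.
  rewrite (splitr e); apply: bddbD; first apply: bddN.
    exact: bdd_le (hn p hp) (hs p).
  exact: bdd_le (hn q hq) (hs q).
exists Y'; split; first exact: bop_bounded.
move=> _ /posC[e e0 ->]; have [n1 h1] := hY e e0; have [n2 h2] := invn_small e0.
pose n := maxn n1 n2; have {}h1 := h1 n (leq_maxl _ _); have {}h2 := h2 n (leq_maxr _ _).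
exists [seq (p.1, bfun (rank1 p.2 l0)) | p <- s n]; split.
- by move=> p /mapP[q _ ->]; exact: rank1_compact.
- move=> x; rewrite big_map /=.
  have -> : \sum_(p <- s n) op_tens AH (rep p.1) (rank1 p.2 l0) = bfun (T n).
    by rewrite bsum_fun; apply: eq_bigr => p _; rewrite -op_tensE.
  rewrite !nrE -CM lecR; have := (bdd_le h2 (hs n)).2 x; rewrite bBE; exact.
- move=> x; rewrite big_map /=.
  have -> : \sum_(p <- s n) op_tens AAH (Delta p.1) (rank1 p.2 l0) = bfun (T' n).
    by rewrite bsum_fun; apply: eq_bigr => p _; rewrite -op_tensE.
  rewrite !nrE -CM lecR; have := h1.2 x; rewrite bBE; exact.
Qed.

Lemma corep_tn (l l0 : H) : Delta_iota Delta (@compact_op R H)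
  (tn hl 1 (rank1 l l0)) (tn hal 1 (rank1 l l0)).
Proof.
split; first exact: bop_bounded.
move=> e e0; exists [:: (1, bfun (rank1 l l0))]; split.
- by move=> p; rewrite inE => /eqP ->; exact: rank1_compact.
- move=> x; rewrite big_seq1.
  have -> : op_tens AH (rep (1, rank1 l l0).1) (rank1 l l0) = tn hl 1 (rank1 l l0).
    by rewrite -(brep1 A) -op_tensE.
  by rewrite subrr normr0 mulr_ge0 // ltW.
- move=> x; rewrite big_seq1.
  have -> : op_tens AAH (Delta (1, rank1 l l0).1) (rank1 l l0) = tn hal 1 (rank1 l l0).
    by rewrite -(dB1 hD) -op_tensE.
  by rewrite subrr normr0 mulr_ge0 // ltW.
Qed.

(* <Delta(u_ll') (k1 (x) k2), k1' (x) k2'> = <V_{k1 k1'} V_{k2 k2'} l, l'> *)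
Lemma corep_coef l l' k1 k2 k1' k2' :
  [<dB hD (coefg (tens AH) Ub l l') (tens AA k1 k2), tens AA k1' k2'>] =
  [<vslice k1 k1' (vslice k2 k2' l), l'>].
Proof.
have [tl tr ti ta] := hl.
have [u0|u1] := unitv01 l.
  have l0 : l = 0 by rewrite (unitvK l) u0 scaler0.
  have -> : coefg (tens AH) Ub l l' = 0.
    apply: coefgP => k k'; rewrite l0 (lin0 (tr k)) (lin0 (blinear Ub)).
    by rewrite -[rep 0 k]/(brep 0 k) brep0 b0E !inner0l.
  by rewrite (lin0 (dBL hD)) b0E inner0l l0 !(lin0 (blinear _)) inner0l.
set l0 := unitv l in u1.
have [Y' hY'] := corep_limit l u1.
have [_ hcoef] := Delta_iota_coef hD compact_bounded hY'.
have {hcoef} := hcoef (tens AA k1 k2) (tens AA k1' k2') l0 l'.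
have -> : coefg (tens AH) (Ub * tn hl 1 (rank1 l l0)) l0 l' = coefg (tens AH) Ub l l'.
  apply: coefgP => k k'; rewrite bME tnE b1E rank1E inner_nr u1 expr1n scale1r.
  exact: coefgE U_aop _ _.
move=> <-.
have [JA [hJA JAE]] := tensor_assoc haa hal hl.
have [JB [hJB JBE]] := tensor_assoc (tensor_map_flip haa) hal hl.
(* The corepresentation condition identifies Y' with U_13 U_23 (1 (x) |l><l0|), which is evaluated
   at k1 (x) k2 (x) l0; pairing the second leg with k2' then leaves a slice of U acting on l. *)
have [_ _ /(_ _ _ _ (A_compacts_tn l l0) (corep_tn l l0) hY')] := hU.
rewrite (leg1_23E hJA 1 Ub JAE : leg1_23 AAH idfun U = _) (leg13E hJB Ub JBE : leg13 AAH U = _) => ->.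
rewrite /= tnE b1E rank1E inner_nr u1 expr1n scale1r -JAE tnE b1E.
rewrite -[tens AAH (tens AA k1' k2') l']JBE.
set xi := Ub (tens AH k2 l).
rewrite -[X in [<X, _>]]/(tn hJB 1 Ub (JA k1 xi)) adjP adj_tn tnE adj1 b1E.
have [y hy] := tensor_rslice hJB (JA k1 xi) k2'.
rewrite hy.
have -> : y = tens AH k1 (vslice k2 k2' l).
  apply: (tensor_vec_ext hl) => ka l2.
  rewrite -hy JBE -JAE.
  have [_ _ jai _] := hJA; rewrite jai ti vsliceE //.
by rewrite -adjP -vsliceE.
Qed.
End Corep.

Section CorepStrong.
Variables (R : realType) (A : repCStar R) (AA : tensC A A) (Delta : A -> AA -> AA).
Variables (phi : A -> R[i]) (S : A -> A).
Hypotheses (hD : unital_star_hom Delta) (hphi : haar_state Delta phi).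
Hypothesis hS : antipode Delta S.
Variables (H : hilbertType R) (AH : hilbertTensor (rc_space A) H) (AAH : hilbertTensor AA H).
Variable U : AH -> AH.
Hypothesis hU : unitary_corep Delta AAH U.
Local Notation hl := (hilbertTensor_map AH).
Local Notation UU := (Ub hU).
Local Notation sU w := (sl (tens AH) w UU).
Local Notation V := (vslice hU).
Variables (n : nat) (u : 'M[A]_n).
Hypothesis hu : irr_corep Delta u.

Let w_bfl i j : bfl (fun x => phi (u i j * x)).
Proof. exact: bflMl (phi_bfl hphi). Qed.

Lemma vslice_coef k k' l l' : [<V k k' l, l'>] = [<brep (coefg (tens AH) UU l l') k, k'>].
Proof. by rewrite vsliceE -(coefgE _ _ (U_aop hU)). Qed.

(** This is [strong_right] for c the coefficient of U at l, l': by [corep_coef] the coefficients of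
    Delta(c) are those of products of slices of U. *)
Lemma corep_strong_right i j : UU * tn hl 1 (sU (fun x => phi (u i j * x))) =
  \sum_k tn hl (brep (star (u k i))) (sU (fun x => phi (u k j * x))).
Proof.
apply: (tensor_bop_eq hl) => k l k' l'; rewrite bME tnE b1E -vsliceE adjP.
rewrite (slE hl _ _ (U_aop hU) (w_bfl _ _)).
rewrite (_ : coefg _ _ l _ =
  coefg (fun l k => tens AA k l) (dB hD (coefg (tens AH) UU l l')) k k').
  rewrite strong_right // bsumE inner_suml; apply: eq_bigr => m _.
  by rewrite inner_tn (slE hl _ _ (U_aop hU) (w_bfl _ _)) mulrC.
symmetry; apply: coefgP => x x'.
by rewrite (corep_coef hD hU) adjP vslice_coef.
Qed.

Lemma corep_strong_left i j : tn hl 1 (sU (fun x => phi (u i j * x))) * UU =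
  \sum_k tn hl (brep (zz S u k j)) (sU (fun x => phi (u i k * x))).
Proof.
apply: (tensor_bop_eq hl) => k l k' l'.
rewrite bME adjP adj_tn adj1 tnE b1E -vsliceE -adjP.
rewrite (slE hl _ _ (U_aop hU) (w_bfl _ _)).
rewrite (_ : coefg _ _ _ l' = coefg (tens AA) (dB hD (coefg (tens AH) UU l l')) k k').
  rewrite (strong_left hD hphi hS) // bsumE inner_suml; apply: eq_bigr => m _.
  by rewrite inner_tn (slE hl _ _ (U_aop hU) (w_bfl _ _)) [RHS]mulrC.
symmetry; apply: coefgP => x x'.
by rewrite (corep_coef hD hU) vslice_coef.
Qed.
End CorepStrong.

(** * Coactions *)

Section Coaction.
Variables (R : realType) (A : repCStar R) (AA : tensC A A) (Delta : A -> AA -> AA).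
Variables (phi : A -> R[i]) (S : A -> A).
Hypotheses (hD : unital_star_hom Delta) (hphi : haar_state Delta phi).
Hypothesis hS : antipode Delta S.
Variables (B : repCStar R) (AB : tensC A B) (AAB : hilbertTensor AA (rc_space B)).
Variable alpha : B -> AB -> AB.
Hypothesis ha : coaction Delta AAB alpha.
Let hal : unital_star_hom alpha. Proof. by case: ha. Qed.
Local Notation hb := (hilbertTensor_map AB).
Local Notation hbf := (tensor_map_flip hb).
Local Notation tf := (fun l k => tens AB k l).
Local Notation calB := (calB Delta phi alpha).
Local Notation matA := (matA Delta).
Local Notation act := (act alpha).

(** The slice of alpha(b) lies in B: alpha(b) is a norm limit of finite sums, whose slices are in B,
    and slicing by w is bounded. *)
Lemma act_rep w b : bfl w -> brep (act b w) = sl (tens AB) w (dB hal b).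
Proof.
move=> hw; have [c hc] : exists c, brep c = sl (tens AB) w (dB hal b).
  apply: (hom_closed (brep_hom B) (@brep_inj _ B)) => e e0.
  have [wl [C C0 wC]] := hw.
  have C1 : 0 < C + 1 by rewrite ltr_wpDl.
  have [s hs] := dB_approx hal b (divr_gt0 e0 C1).
  exists (\sum_(p <- s) w p.1 *: p.2).
  set T := \sum_(p <- s) tn _ _ _ in hs.
  have aT : aop (tens AB) T by apply: aop_sum => p; exact: aop_tn.
  have -> : brep (\sum_(p <- s) w p.1 *: p.2) = sl (tens AB) w T.
    apply/esym/(sl_uniq hb aT hw) => l l' a hT.
    rewrite -(coefgP hT) (coefg_sum_tn hb) brep_sum bsumE inner_suml (lin_sum wl).
    by apply: eq_bigr => p _; rewrite brepZ bZE innerZl (linZ wl) mulrC.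
  have -> : sl (tens AB) w (dB hal b) - sl (tens AB) w T = sl (tens AB) w (dB hal b - T).
    apply/esym/(sl_uniq hb _ hw) => [|l l' a hT]; first by apply: aopB => //; exact: dB_aop.
    rewrite bBE innerBl !(slE hb _ _ _ hw) //; last exact: dB_aop.
    by rewrite -(linB wl) -(coefgP hT); congr w; apply/esym/coefgP/has_coefB;
      apply: coefgE => //; exact: dB_aop.
  have hb1 := sl_bdd hb (aopB (dB_aop hal b) aT) hw C0 wC hs.
  apply: bdd_le hb1.
  by rewrite mulrCA -[leRHS]mulr1 ler_wpM2l ?(ltW e0) // ler_pdivrMr // mul1r lerDl.
have -> // : act b w = c.
apply: xget_unique => [|d hd].
  by rewrite slice_sl -hc.
by apply: brep_inj; rewrite hc; apply: bopP => x; rewrite -[brep d x]/(rep d x) hd slice_sl.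
Qed.

(** The value of w (x) psi at T in either order: clear for finite sums and stable under norm
    limits. *)
Lemma fubini (T : bop AB) (w : A -> R[i]) (psi : B -> R[i]) a c : bfl w -> bfl psi ->
  (forall e : R, 0 < e -> exists s : seq (A * B),
     bdd (T - \sum_(p <- s) tn hb (brep p.1) (brep p.2)) e) ->
  brep c = sl (tens AB) w T ->
  (forall k k', [<rep a k, k'>] = psi (coefg tf T k k')) -> psi c = w a.
Proof.
move=> hw hpsi h hc ha'; have [wl [C C0 wC]] := hw; have [pl [D D0 pD]] := hpsi.
have aT : aop (tens AB) T.
  apply: (aop_lim hb) => e /h[s hs]; eexists; split; last exact: hs.
  by apply: aop_sum => p; exact: aop_tn.
have aTr : aop tf T.
  apply: (aop_lim hbf) => e /h[s hs]; eexists; split; last exact: hs.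
  by apply: aop_sum => p; rewrite -(tn_flip hb); exact: aop_tn.
apply: (@small_eq _ _ _ (2 * (C * D))); first by rewrite !mulr_ge0.
move=> e e0; have [s hs] := h _ e0; set Ts := \sum_(p <- s) _ in hs.
have aTs : aop (tens AB) Ts by apply: aop_sum => p; exact: aop_tn.
pose cs := \sum_(p <- s) w p.1 *: p.2; pose as_ := \sum_(p <- s) psi p.2 *: p.1.
have csE : psi cs = w as_.
  rewrite (lin_sum pl) (lin_sum wl); apply: eq_bigr => p _.
  by rewrite (linZ pl) (linZ wl); exact: mulrC.
have h1 : cnorm (c - cs) <= C * e.
  apply: (hom_isometric (brep_hom B) (@brep_inj _ B)).
  rewrite (linB (@brepL _ B)) hc.
  rewrite (_ : _ - _ = sl (tens AB) w (T - Ts)); first exact: (sl_bdd hb (aopB aT aTs) hw C0 wC hs).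
  apply/esym/(sl_uniq hb _ hw) => [|l l' x hT]; first exact: aopB.
  rewrite bBE innerBl (slE hb _ _ _ hw) // brep_sum bsumE inner_suml.
  rewrite -(coefgP hT) (coefgP (has_coefB (coefgE l l' aT) (coefgE l l' aTs))) (linB wl).
  rewrite (coefg_sum_tn hb) (lin_sum wl); congr (_ - _); apply: eq_bigr => p _.
  by rewrite brepZ bZE innerZl (linZ wl) mulrC.
have h2 : cnorm (a - as_) <= D * e.
  apply: (hom_isometric (brep_hom A) (@brep_inj _ A)); split=> [|k].
    by rewrite mulr_ge0 // ltW.
  apply: nr_le_inner; first by rewrite !mulr_ge0 ?nr_ge0 // ltW.
  move=> k'; rewrite (linB (@brepL _ A)) bBE innerBl -[brep a k]/(rep a k) ha'.
  have hc' : has_coef tf Ts k k' (\sum_(p <- s) [<brep p.1 k, k'>] *: p.2).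
    rewrite (_ : Ts = \sum_(p <- s) tn hbf (brep p.2) (brep p.1)).
      by apply: has_coef_sum => p; exact: has_coef_tn.
    by apply: eq_bigr => p _; rewrite tn_flip.
  rewrite (_ : [<brep as_ k, k'>] = psi (\sum_(p <- s) [<brep p.1 k, k'>] *: p.2)).
    rewrite -(linB pl) (le_trans (pD _)) // -!mulrA ler_wpM2l //.
    by rewrite !mulrA; apply: (cnorm_coef hbf) hs; apply: has_coefB => //; exact: coefgE.
  rewrite brep_sum bsumE inner_suml (lin_sum pl); apply: eq_bigr => p _.
  by rewrite brepZ bZE innerZl (linZ pl) mulrC.
have -> : psi c - w a = psi (c - cs) - w (a - as_).
  by rewrite (linB pl) (linB wl) csE; ring.
rewrite (le_trans (cabsD _ _)) // cabsN.
rewrite (_ : 2 * (C * D) * e = D * (C * e) + C * (D * e)); last by ring.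
by apply: lerD; [rewrite (le_trans (pD _))|rewrite (le_trans (wC _))] => //; rewrite ler_wpM2l.
Qed.

Lemma iota_alpha_coef (J : rc_space A -> AB -> AAB) (hJ : tensor_map J)
    (T : bop AB) (T' : bop AAB) :
  (forall k1 k2 l, J k1 (tens AB k2 l) = tens AAB (tens AA k1 k2) l) ->
  iota_alpha alpha T T' -> forall k k' z z',
    [<T' (J k z), J k' z'>] = [<dB hal (coefg tf T k k') z, z'>].
Proof.
move=> JE [_ h] k k' z z'.
have [|_ ->//] := @approx_coef _ _ _ _ _ _ _ _ _ hbf (tensor_map_flip hJ) (dB_hom hal) T T'.
move=> e e0; have eC : 0 < e%:C :> R[i] by rewrite ltcR.
have [s [h1 h2]] := h _ eC; exists [seq (p.2, brep p.1) | p <- s].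
rewrite !big_map; split; (split=> [|x]; [exact: ltW|]).
  have := h1 x; rewrite decompE -[X in `|X|]bBE !nrE -CM lecR.
  rewrite (_ : \sum_(p <- s) tn hb _ _ = \sum_(p <- s) tn hbf (brep p.2) (brep p.1)) //.
  by apply: eq_bigr => p _; rewrite tn_flip.
have := h2 x.
rewrite (_ : \sum_(p <- s) leg1_23 _ _ _ =
    bfun (\sum_(p <- s) tn (tensor_map_flip hJ) (dB hal p.2) (brep p.1))).
  by rewrite -[X in `|X|]bBE !nrE -CM lecR.
rewrite bsum_fun; apply: eq_bigr => p _.
by rewrite tn_flip -(leg1_23E hJ (brep p.1) (dB hal p.2) JE).
Qed.

Section Irr.
Variables (n : nat) (u : 'M[A]_n).
Hypothesis hu : irr_corep Delta u.
Local Notation w i j := (fun x => phi (u i j * x)).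

(** The coaction identity turns alpha (b <| w) into (w (x) iota (x) iota)(Delta (x) iota) alpha(b),
    where [strong_left] applies to the first two legs. *)
Lemma act_coact i j b : dB hal (act b (w i j)) =
  \sum_k tn hb (brep (zz S u k j)) (brep (act b (w i k))).
Proof.
have wb k l : bfl (w k l) by exact: bflMl (phi_bfl hphi).
have [T [hT1 hT2]] := ha.2 b.
have [T'b _] := hT1; pose T' := Bop T T'b.
have [_ c1] := Delta_iota_coef (T := dB hal b) (T' := T') hD (@rep_range_bounded _ B) hT1.
have [J [hJ JE]] := tensor_assoc (hilbertTensor_map AA) (hilbertTensor_map AAB) hb.
have c2 := iota_alpha_coef (T := dB hal b) (T' := T') hJ JE hT2.
apply: (tensor_bop_eq hb) => k l k' l'.
pose psi c := [<dB hal c (tens AB k l), tens AB k' l'>].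
have psib : bfl psi.
  split=> [c x y|]; first by rewrite /psi dBL bDE bZE innerDl innerZl.
  exists (nr (tens AB k l) * nr (tens AB k' l')); first by rewrite mulr_ge0 ?nr_ge0.
  move=> x; rewrite (le_trans (CS _ _)) // mulrAC ler_wpM2r ?nr_ge0 //.
  by rewrite mulrC (le_trans ((hom_contractive (dB_hom hal) _).2 _)).
rewrite -[LHS]/(psi (act b (w i j))).
rewrite (fubini (T := dB hal b) (w := w i j)
  (a := coefg (tens AA) (dB hD (coefg (tens AB) (dB hal b) l l')) k k')) //.
- rewrite (strong_left hD hphi hS) // bsumE inner_suml; apply: eq_bigr => m _.
  rewrite inner_tn (act_rep _ (wb i m)) (slE hb _ _ (dB_aop hal b) (wb i m)); exact: mulrC.
- exact: dB_approx.
- exact: act_rep.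
- move=> x x'; rewrite -[rep _ x]/(brep _ x) (coefgE _ _ (dB_aop hD _)) -c1 -!JE c2 //.
Qed.
End Irr.

(** The default in [coact_dec] is never met on [calB]: for b <| phi(u_ij .) the formula [act_coact]
    is a decomposition, and decompositions combine linearly. *)
Lemma coact_decP b : calB b -> decomposes matA calB (alpha b) (coact_dec Delta phi alpha b).
Proof.
suff h : calB b -> exists s, decomposes matA calB (alpha b) s.
  by move=> /h[s hs]; exact: (xgetPex [::] (ex_intro _ s hs)).
have nil : decomposes matA calB (alpha 0) [::].
  refine (bop_decomposes (hd := hal) _ _) => //.
  by rewrite big_nil (lin0 (dBL hal)).
move: b; apply: (@lspan_induct R B _ (fun b => exists s, decomposes matA calB (alpha b) s)).
  by exists [::].
move=> c _ y [b [w [[a aA wE] ->]]] _ [s' hs'].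
suff [s hs] : exists s, decomposes matA calB (alpha (act b w)) s.
  by eexists; refine (decomposes_lin hal _ hs hs').
have -> : w = fun x => phi (a * x) by exact/funext.
have wb a' : bfl (fun x => phi (a' * x)) by exact: bflMl (phi_bfl hphi).
move: a aA {wE}.
apply: (@lspan_induct R A _ (fun a => exists s,
  decomposes matA calB (alpha (act b (fun x => phi (a * x)))) s)).
  exists [::]; rewrite (_ : act _ _ = 0) //; apply: brep_inj.
  rewrite act_rep // brep0; apply: bop_eqP => l l'.
  by rewrite (slE hb _ _ (dB_aop hal b)) // mul0r (phi0 hphi) b0E inner0l.
move=> d _ a' [n [u [i [j [hu ->]]]]] _ [s2 hs2].
rewrite (_ : act _ _ = d *: act b (fun x => phi (u i j * x)) + act b (fun x => phi (a' * x))).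
  pose s1 := [seq (zz S u k j, act b (fun x => phi (u i k * x))) | k <- index_enum 'I_n].
  eexists; refine (decomposes_lin hal d (_ : decomposes _ _ _ s1) hs2).
  refine (bop_decomposes (hd := hal) _ _); last by rewrite act_coact // big_map.
  move=> p /mapP[k _ ->]; split=> /=.
    by rewrite -[zz S u k j]starK; apply/(matA_star hS)/matA_zz.
  apply: lspan_gen; exists b, (fun x => phi (u i k * x)); split=> //.
  by exists (u i k) => //; exact: matA_irr.
apply: brep_inj; rewrite brepD brepZ !act_rep //; apply: bop_eqP => l l'.
rewrite bDE bZE innerDl innerZl !(slE hb _ _ (dB_aop hal b)) // mulrDl -scalerAl.
by rewrite (phiD hphi) (phiZ hphi).
Qed.
End Coaction.

(** Distributivity when the index type of each sum depends on the factor; tagging the indices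
    reduces it to a single index type. *)
Lemma prod_sum_dffun (R : pzSemiRingType) (I : finType) (T_ : I -> finType)
    (P_ : forall i, T_ i -> R) :
  \sum_(J : {dffun forall i : I, T_ i}) \prod_i P_ i (J i) = \prod_i \sum_q P_ i q.
Proof.
pose P' i := [ffun q => P_ i q].
transitivity (\sum_(t : fprod T_) \prod_(i in I) P' i (t i)).
  rewrite (reindex (@dffun_of_fprod I T_)); last exact/onW_bij/dffun_of_fprod_bij.
  by apply: eq_bigr => J _; apply: eq_bigr => i _; rewrite !ffunE.
rewrite big_fprod -(bigA_distr_big_dep (fun i => tagged_with T_ i)
  (fun i j => untag 0 (P' i) j)).
apply: eq_bigr => i _; transitivity (\sum_q P' i q).
  exact: esym (big_tag (fun i => P' i) i).
by apply: eq_bigr => q _; rewrite ffunE.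
Qed.

(** * Slices of sums and products *)

Section Slice.
Variables (R : realType) (A : repCStar R) (L M : hilbertType R).
Variable t : rc_space A -> L -> M.
Hypothesis ht : tensor_map t.
Implicit Types (T : bop M) (S : bop L) (a : A) (w : A -> R[i]).

Lemma sl_tn w a S : bfl w -> sl t w (tn ht (brep a) S) = w a *: S.
Proof.
move=> hw; apply: (sl_uniq ht (aop_tn _ _ _) hw) => l l' b hb.
rewrite -(coefgP hb) (coefgP (has_coef_tn _ _ _ _ _)) bZE innerZl mulrC.
by case: hw => wl _; exact: esym (linZ wl _ _).
Qed.

Lemma sl_mulr w T b S : aop t T -> bfl w ->
  sl t w (T * tn ht (brep b) S) = sl t (fun x => w (x * b)) T * S.
Proof.
move=> hT hw; apply: (sl_uniq ht _ hw); first exact: aop_mulr.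
move=> l l' a ha; rewrite bME (slE ht _ _ hT) ?bflM //; last exact: bflM.
congr w; rewrite -(coefgP ha); apply/esym/coefgP/has_coef_mulr; exact: coefgE.
Qed.

Lemma sl_mull w T b S : aop t T -> bfl w ->
  sl t w (tn ht (brep b) S * T) = S * sl t (fun x => w (b * x)) T.
Proof.
move=> hT hw; apply: (sl_uniq ht _ hw); first exact: aop_mull.
move=> l l' a ha; rewrite bME adjP (slE ht _ _ hT); last exact: bflMl.
congr w; rewrite -(coefgP ha); apply/esym/coefgP/has_coef_mull; exact: coefgE.
Qed.

Lemma sl_sum w (I : Type) (s : seq I) (T : I -> bop M) : (forall i, aop t (T i)) -> bfl w ->
  sl t w (\sum_(i <- s) T i) = \sum_(i <- s) sl t w (T i).
Proof.
move=> hT hw; apply: (sl_uniq ht _ hw); first exact: aop_sum.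
move=> l l' a ha; rewrite bsumE inner_suml.
rewrite -(coefgP ha) (coefgP (has_coef_sum _ (fun i => coefgE l l' (hT i)))).
case: (hw) => wl _; rewrite (lin_sum wl).
by apply: eq_bigr => i _; rewrite (slE ht _ _ (hT i)).
Qed.

Lemma sl_linl c w w' T : aop t T -> bfl w -> bfl w' ->
  sl t (fun x => c * w x + w' x) T = c *: sl t w T + sl t w' T.
Proof.
move=> hT hw hw'; apply: (sl_uniq ht hT) => [|l l' a ha].
  have [[wl [C C0 wC]] [wl' [C' C0' wC']]] := (hw, hw'); split=> [d x y|].
    by rewrite wl wl' /= !mulrDr addrACA mulrCA -mulrDr.
  exists (cabs c * C + C'); first by rewrite addr_ge0 ?mulr_ge0 ?cabs_ge0.
  move=> x; rewrite (le_trans (cabsD _ _)) // mulrDl lerD // cabsM -mulrA.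
  by rewrite ler_wpM2l ?cabs_ge0.
by rewrite bDE bZE innerDl innerZl !(slE ht _ _ hT) // (coefgP ha).
Qed.
End Slice.

(** * Trace class operators *)

Section Trace.
Variables (R : realType) (H : hilbertType R).
Implicit Types X Y : bop H.
Definition trc X := exists t : R[i], has_trace X t.

Lemma trcZ c X : trc X -> trc (c *: X).
Proof. by move=> [t ht]; eexists; exact: has_traceZ ht. Qed.
Lemma TrZ c X : trc X -> Tr (c *: X) = c * Tr X :> R[i].
Proof. by move=> [t ht]; rewrite (has_trace_Tr ht); exact/has_trace_Tr/has_traceZ. Qed.
Lemma TrD X Y : trc X -> trc Y -> Tr (X + Y) = Tr X + Tr Y :> R[i].
Proof.
move=> [t ht] [t' ht']; rewrite (has_trace_Tr ht) (has_trace_Tr ht').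
exact/has_trace_Tr/has_traceD.
Qed.
Lemma TrN X : trc X -> Tr (- X) = - Tr X :> R[i].
Proof. by move=> hX; rewrite -scaleN1r TrZ // mulN1r. Qed.
Lemma trcD X Y : trc X -> trc Y -> trc (X + Y).
Proof. by move=> [t ht] [t' ht']; eexists; exact: has_traceD ht ht'. Qed.
Lemma trc_sum (I : eqType) (s : seq I) (X : I -> bop H) : (forall i, i \in s -> trc (X i)) ->
  trc (\sum_(i <- s) X i) /\ Tr (\sum_(i <- s) X i) = \sum_(i <- s) Tr (X i) :> R[i].
Proof.
elim: s => [|i s IH] h; first by rewrite !big_nil; split;
  [by exists 0; exact: has_trace0|exact/has_trace_Tr/has_trace0].
have [|h1 h2] := IH; first by move=> j js; apply: h; rewrite inE js orbT.
have hi : trc (X i) by apply: h; rewrite mem_head.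
by rewrite !big_cons TrD // h2; split=> //; exact: trcD.
Qed.
Lemma Tr_sum (I : eqType) (s : seq I) (X : I -> bop H) : (forall i, i \in s -> trc (X i)) ->
  Tr (\sum_(i <- s) X i) = \sum_(i <- s) Tr (X i) :> R[i].
Proof. by case/trc_sum. Qed.

Variable p : nat.
Hypothesis p0 : (0 < p)%N.

Lemma trc_sch X : sch p p X -> trc X. Proof. exact: sch_trace. Qed.
Lemma sch_mul0l k X Y : sch p k Y -> sch p k (X * Y).
Proof. exact: sch_mul (sch0 p X). Qed.
Lemma sch_mul0r k X Y : sch p k X -> sch p k (X * Y).
Proof. by rewrite -{2}[k]addn0 => /sch_mul; apply; exact: sch0. Qed.
Lemma sch_prod (I : eqType) (s : seq I) (f : I -> bop H) : (forall i, i \in s -> sch p 1 (f i)) ->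
  sch p (size s) (\prod_(i <- s) f i).
Proof.
elim: s => [|i s IH] h; first by rewrite big_nil; exact: sch0.
rewrite big_cons; apply: (@sch_mul _ _ _ 1); first by apply: h; rewrite mem_head.
by apply: IH => j js; apply: h; rewrite inE js orbT.
Qed.
End Trace.

Lemma anti_prod (R : pzRingType) (I : eqType) (s : seq I) (f : I -> R) X :
  (forall i, i \in s -> X * f i = - (f i * X)) ->
  X * (\prod_(i <- s) f i) = (-1) ^+ size s * (\prod_(i <- s) f i * X).
Proof.
rewrite -signr_odd; elim: s => [|i s IH] h; first by rewrite !big_nil mulr1 !mul1r.
rewrite !big_cons mulrA h ?mem_head // mulNr -mulrA IH => [|j js]; last first.
  by apply: h; rewrite inE js orbT.
by rewrite /=; case: (odd _); rewrite ?expr1 ?expr0 ?mul1r ?mulN1r ?mulrN ?opprK !mulrA.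
Qed.

Section MkBop.
Variables (R : realType) (H : hilbertType R).
(** Total bundling, with value 0 on unbounded maps: nothing is known about rho(b) outside [calB],
    and F and gamma are given as bare functions. *)
Definition mkb (f : H -> H) : bop H :=
  if pselect (bounded_op f) is left h then Bop f h else 0.
Lemma mkbE f : bounded_op f -> bfun (mkb f) = f.
Proof. by rewrite /mkb; case: pselect. Qed.
Lemma bfun_inj (f g : bop H) : bfun f = bfun g -> f = g.
Proof. by move=> h; apply: bopP => x; rewrite h. Qed.
End MkBop.

(** * The Chern character *)

Section Chern.
Variables (R : realType) (A : repCStar R) (AA : tensC A A) (Delta : A -> AA -> AA).
Variables (phi : A -> R[i]) (S : A -> A).
Hypotheses (hD : unital_star_hom Delta) (hphi : haar_state Delta phi).
Hypotheses (hf : faithful_state phi) (hS : antipode Delta S).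
Variables (B : repCStar R) (AB : tensC A B) (AAB : hilbertTensor AA (rc_space B)).
Variable alpha : B -> AB -> AB.
Hypothesis ha : coaction Delta AAB alpha.
Variables (H : hilbertType R) (AH : hilbertTensor (rc_space A) H) (AAH : hilbertTensor AA H).
Variables (rho : B -> H -> H) (F gamma : H -> H) (U : AH -> AH) (n : nat).
Hypothesis hE : equivariant_even_fredholm_module Delta phi alpha AAH rho F gamma U.
Hypothesis hsum : schatten_summable Delta phi alpha rho F n.*2.+1.
Local Notation hl := (hilbertTensor_map AH).
Local Notation calB := (calB Delta phi alpha).
Local Notation matA := (matA Delta).
Local Notation hatA := (hatA Delta phi).
Local Notation dec := (coact_dec Delta phi alpha).
Local Notation p := n.*2.+1.

Let hmod := let: And5 h _ _ _ _ := hE in h.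
Let hrho := let: And5 h _ _ _ _ := hmod in h.
Let hU : unitary_corep Delta AAH U. Proof. by case: hE. Qed.
Local Notation UU := (Ub hU).
Local Notation g := (mkb gamma).
Local Notation f := (mkb F).
Local Notation r b := (mkb (rho b)).

Lemma gammaE : bfun g = gamma. Proof. by apply: mkbE; case: hmod => _ []. Qed.
Lemma FE : bfun f = F. Proof. by apply: mkbE; case: hmod => _ _ []. Qed.
Lemma rho_bounded b : calB b -> bounded_op (rho b).
Proof. by case: hrho => h _ _ _; exact: h. Qed.
Lemma rhoE b : calB b -> bfun (r b) = rho b.
Proof. by move=> hb; exact/mkbE/rho_bounded. Qed.

Lemma FF : f * f = 1.
Proof.
have [_ _ [_ _ h] _ _] := hmod; apply: bopP => x; rewrite bME FE b1E.
exact: (congr1 (fun k => k x) h).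
Qed.
Lemma Fg : f * g = - (g * f).
Proof.
have [_ _ _ h _] := hmod; apply: bopP => x; rewrite bNE !bME gammaE FE.
exact: (congr1 (fun k => k x) h).
Qed.
Lemma gr b : calB b -> g * r b = r b * g.
Proof.
move=> hb; have [_ _ _ _ /(_ b hb)[h _]] := hmod; apply: bopP => x.
by rewrite !bME gammaE rhoE //; rewrite -[RHS]/((rho b \o gamma) x) h.
Qed.
Lemma r_lin c a b : calB a -> calB b -> r (c *: a + b) = c *: r a + r b.
Proof.
move=> ha' hb; have [_ h _ _] := hrho; apply: bopP => x.
rewrite bDE bZE !rhoE //; last exact: lspan_lin.
exact: (congr1 (fun k => k x) (h c a b ha' hb)).
Qed.
(** Faces evaluate the cochain at products. Multiplicativity of rho on [calB] makes it bounded
    there, which is what [chernE] asks for. *)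
Lemma rhoM_bounded a b : calB a -> calB b -> bounded_op (rho (a * b)).
Proof.
move=> ha' hb; have [_ _ -> // _] := hrho.
by rewrite -(rhoE ha') -(rhoE hb); exact: (bop_bounded (r a * r b)).
Qed.
Lemma rM a b : calB a -> calB b -> r (a * b) = r a * r b.
Proof.
move=> ha' hb; apply: bopP => x; rewrite bME (rhoE ha') (rhoE hb) (mkbE (rhoM_bounded ha' hb)).
by have [_ _ -> // _] := hrho.
Qed.

Definition D b := f * r b - r b * f.
Lemma DE b : bounded_op (rho b) -> bfun (D b) = commutator F (rho b).
Proof. by move=> hb; apply/funext => x; rewrite bBE !bME FE mkbE. Qed.
Lemma D_lin c a b : calB a -> calB b -> D (c *: a + b) = c *: D a + D b.
Proof.
move=> ha' hb; rewrite /D r_lin // mulrDr mulrDl -bAr -bAl scalerBr.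
by rewrite opprD addrACA.
Qed.
Lemma DM a b : calB a -> calB b -> D (a * b) = D a * r b + r a * D b.
Proof. by move=> ha' hb; rewrite /D rM // mulrBl mulrBr !mulrA subrKA. Qed.
Lemma D_sch b : calB b -> sch p 1 (D b).
Proof. by move=> hb; apply: schatten_sch => //; rewrite DE; [exact: hsum|exact: rho_bounded]. Qed.
Lemma FD b : f * D b = - (D b * f).
Proof. by rewrite /D mulrBl mulrBr !mulrA FF mul1r -[r b * f * f]mulrA FF mulr1 opprB. Qed.
Lemma gD b : calB b -> g * D b = - (D b * g).
Proof.
have gf : g * f = - (f * g) by rewrite Fg opprK.
move=> hb.
have e1 : g * (f * r b) = - (f * r b * g) by rewrite mulrA gf mulNr -(mulrA f g) gr // mulrA.
have e2 : g * (r b * f) = - (r b * f * g) by rewrite mulrA gr // -(mulrA (r b)) gf mulrN mulrA.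
by rewrite /D mulrBr mulrBl e1 e2 opprD.
Qed.

Local Notation s w := (sl (tens AH) w UU).

Lemma U_comm_sl w (X : bop H) : bfl w -> U \o op_tens AH idfun X = op_tens AH idfun X \o U ->
  s w * X = X * s w.
Proof.
move=> hw h; have {}h : UU * tn hl 1 X = tn hl 1 X * UU.
  apply: bfun_inj; rewrite -[bfun (UU * _)]/(U \o _) -[bfun (_ * UU)]/(_ \o U).
  by rewrite -op_tensE.
have := congr1 (fun T : bop AH => sl (tens AH) w T) h.
rewrite -brep1 (sl_mulr hl _ _ (U_aop hU) hw) (sl_mull hl _ _ (U_aop hU) hw).
rewrite (_ : (fun x => w (x * 1)) = w); last by apply/funext => x; rewrite mulr1.
by rewrite (_ : (fun x => w (1 * x)) = w) //; apply/funext => x; rewrite mul1r.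
Qed.
Lemma sF w : bfl w -> s w * f = f * s w.
Proof. by move=> hw; apply: U_comm_sl => //; rewrite FE; case: hE. Qed.
Lemma sg w : bfl w -> s w * g = g * s w.
Proof. by move=> hw; apply: U_comm_sl => //; rewrite gammaE; case: hE. Qed.

Lemma decP b q : calB b -> q \in dec b -> calB q.2.
Proof. by move=> hb hq; have [/(_ q hq)[]] := coact_decP hD hphi hS ha hb. Qed.

Lemma U_rho b : calB b -> UU * (\sum_(q <- dec b) tn hl (brep q.1) (r q.2)) = tn hl 1 (r b) * UU.
Proof.
move=> hb; have [_ _ _ _ /(_ b _ hb (coact_decP hD hphi hS ha hb)) h] := hE.
apply: bfun_inj; rewrite -[bfun (UU * _)]/(U \o _) -[bfun (_ * UU)]/(_ \o U).
rewrite bsum_fun -op_tensE rhoE // -h; congr (_ \o _).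
by apply: eq_big_seq => q hq; rewrite -op_tensE rhoE //; exact: decP hq.
Qed.
Lemma U_F : UU * tn hl 1 f = tn hl 1 f * UU.
Proof.
apply: bfun_inj; rewrite -[bfun (UU * _)]/(U \o _) -[bfun (_ * UU)]/(_ \o U).
by rewrite -op_tensE FE; case: hE.
Qed.
(** U commutes with 1 (x) F, so equivariance passes from rho to the commutators. *)
Lemma U_D b : calB b -> UU * (\sum_(q <- dec b) tn hl (brep q.1) (D q.2)) = tn hl 1 (D b) * UU.
Proof.
move=> hb; have -> : \sum_(q <- dec b) tn hl (brep q.1) (D q.2) =
  tn hl 1 f * (\sum_(q <- dec b) tn hl (brep q.1) (r q.2)) -
  (\sum_(q <- dec b) tn hl (brep q.1) (r q.2)) * tn hl 1 f.
  rewrite mulr_sumr mulr_suml -sumrB; apply: eq_bigr => q _.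
  by rewrite tnBr !tnM mul1r mulr1.
rewrite mulrBr !mulrA U_F U_rho // -mulrA U_rho // -[_ * UU * _]mulrA U_F !mulrA -mulrBl.
by rewrite !tnM !mulr1 -tnBr.
Qed.

Lemma s_act b w (X : B -> bop H) : bfl w ->
  UU * (\sum_(q <- dec b) tn hl (brep q.1) (X q.2)) = tn hl 1 (X b) * UU ->
  \sum_(q <- dec b) s (fun x => w (x * q.1)) * X q.2 = X b * s w.
Proof.
move=> hw h; have := congr1 (fun T : bop AH => sl (tens AH) w T) h.
rewrite -(brep1 A) (sl_mull hl _ _ (U_aop hU) hw).
rewrite (_ : (fun x => w (1 * x)) = w); last by apply/funext => x; rewrite mul1r.
move=> <-; rewrite mulr_sumr (sl_sum hl) //; last by move=> q; apply: aop_mulr; exact: U_aop.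
by apply: eq_bigr => q _; rewrite (sl_mulr hl _ _ (U_aop hU) hw).
Qed.
Lemma s_rho b w : calB b -> bfl w ->
  \sum_(q <- dec b) s (fun x => w (x * q.1)) * r q.2 = r b * s w.
Proof. by move=> hb hw; apply: (s_act (X := fun b => r b)) => //; exact: U_rho. Qed.
Lemma s_D b w : calB b -> bfl w ->
  \sum_(q <- dec b) s (fun x => w (x * q.1)) * D q.2 = D b * s w.
Proof. by move=> hb hw; apply: s_act => //; exact: U_D. Qed.

Lemma chernE m w (b : 'I_m.+1 -> B) : (forall i, bounded_op (rho (b i))) ->
  chern_op rho F gamma U w b = bfun (g * s w * f * \prod_(i < m.+1) D (b i)).
Proof.
move=> hb; rewrite /chern_op.
have -> : \big[comp/idfun]_(i < m.+1) commutator F (rho (b i)) = bfun (\prod_(i < m.+1) D (b i)).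
  rewrite (big_morph (fun X : bop H => bfun X) (id1 := idfun) (op1 := comp)) //.
  by apply: eq_bigr => i _; rewrite DE.
by rewrite slice_sl -[bfun (_ * _)]/(bfun g \o s w \o bfun f \o _) gammaE FE.
Qed.

Local Notation K := ((-1) ^+ n / 2 : R[i]).
Local Notation Phi := (phi_F rho F gamma U n).

Lemma prod_sch m (b : 'I_m -> B) : (forall i, calB (b i)) -> sch p m (\prod_(i < m) D (b i)).
Proof.
move=> hb; have := @sch_prod R H p _ (index_enum 'I_m) (fun i => D (b i)).
have -> : size (index_enum 'I_m) = m by rewrite [index_enum _]unlock -enumT size_enum_ord.
by apply=> i _; exact: D_sch.
Qed.
Lemma prodn_sch i j (b : nat -> B) : (forall k, calB (b k)) ->
  sch p (j - i) (\prod_(i <= k < j) D (b k)).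
Proof.
move=> hb; have := @sch_prod R H p _ (index_iota i j) (fun i => D (b i)).
by rewrite size_iota; apply=> k _; exact: D_sch.
Qed.

Lemma cycle_trc w X : sch p p X -> trc (g * s w * f * X).
Proof. by move=> hX; apply: (trc_sch (ltn0Sn n.*2)); exact: sch_mul0l. Qed.

Lemma chern_trc w (b : 'I_p -> B) : (forall i, calB (b i)) ->
  exists t : R[i], has_trace (chern_op rho F gamma U w b) t.
Proof.
by move=> hb; rewrite chernE => [|i]; [exact/cycle_trc/prod_sch|exact: rho_bounded].
Qed.

Lemma phi_F_bounded w b : (forall i, bounded_op (rho (b i))) ->
  Phi w b = K * Tr (g * s w * f * \prod_(i < p) D (b i)).
Proof. by move=> hb; rewrite /phi_F chernE. Qed.
Lemma phi_FE w b : (forall i, calB (b i)) ->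
  Phi w b = K * Tr (g * s w * f * \prod_(i < p) D (b i)).
Proof. by move=> hb; apply: phi_F_bounded => i; exact: rho_bounded. Qed.

Lemma phi_F_linl c w w' b : (forall i, calB (b i)) -> bfl w -> bfl w' ->
  Phi (fun x => c * w x + w' x) b = c * Phi w b + Phi w' b.
Proof.
move=> hb hw hw'; rewrite !phi_FE // (sl_linl hl _ (U_aop hU) hw hw').
have ht w'' := cycle_trc w'' (prod_sch hb).
by rewrite mulrDr -bAr !mulrDl -!bAl TrD ?TrZ //; [ring|exact: trcZ].
Qed.

Lemma prod_lin (I : eqType) (t : seq I) (b : I -> B) i c u v : uniq t -> i \in t ->
  calB u -> calB v ->
  \prod_(j <- t) D (if j == i then c *: u + v else b j) =
  c *: \prod_(j <- t) D (if j == i then u else b j) + \prod_(j <- t) D (if j == i then v else b j).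
Proof.
move=> + + hu hv; elim: t => // j t IH /= /andP[jt ut].
rewrite inE !big_cons; case: eqVneq => [-> _|ij /IH -> //].
  have E x : \prod_(j0 <- t) D (if j0 == j then x else b j0) = \prod_(j0 <- t) D (b j0).
    by apply: eq_big_seq => k kt; rewrite ifN //; apply: contraNneq jt => <-.
  by rewrite !E D_lin // mulrDl bAl.
by rewrite mulrDr bAr.
Qed.

Lemma phi_F_linr c w (b : 'I_p -> B) i u v : bfl w -> (forall j, calB (b j)) ->
  calB u -> calB v -> Phi w [eta b with i |-> c *: u + v] =
    c * Phi w [eta b with i |-> u] + Phi w [eta b with i |-> v].
Proof.
move=> hw hb hu hv.
have hc x : calB x -> forall j, calB ([eta b with i |-> x] j).
  by move=> hx j /=; case: eqP.
rewrite !phi_FE; try (by apply: hc => //; exact: lspan_lin).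
rewrite [X in Tr (bfun (_ * X))](prod_lin b c (index_enum_uniq _) (mem_index_enum i) hu hv).
have ht x (hx : calB x) := cycle_trc w (prod_sch (hc x hx)).
by rewrite mulrDr -bAr TrD ?TrZ; [ring|exact: ht|apply/trcZ/ht|exact: ht].
Qed.

(* [s w] commutes with [F], while [F] and the grading both anticommute with
   [D b]: moving [D b] to the front costs two signs, which cancel. *)
Lemma rotate_D w b X : bfl w -> calB b -> sch p n.*2 X ->
  \sum_(q <- dec b) Tr (g * s (fun x => w (x * q.1)) * f * (D q.2 * X)) =
  Tr (g * s w * f * (X * D b)) :> R[i].
Proof.
move=> hw hb hX; rewrite -Tr_sum; last first.
  by move=> q /(decP hb) hq; apply/cycle_trc/(@sch_mul _ _ _ 1) => //; exact: D_sch.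
have -> : \sum_(q <- dec b) g * s (fun x => w (x * q.1)) * f * (D q.2 * X) =
    D b * (g * s w * f * X).
  transitivity (- (g * (\sum_(q <- dec b) s (fun x => w (x * q.1)) * D q.2) * f * X)).
    rewrite mulr_sumr !mulr_suml -sumrN; apply: eq_bigr => q _.
    by rewrite !mulrA -(mulrA _ f) FD mulrN !mulNr !mulrA.
  by rewrite s_D // !mulrA gD // !mulNr opprK.
by rewrite (sch_cyc (ltn0Sn _) (D_sch hb) (sch_mul0l _ hX)) ?mulrA // add1n.
Qed.

(** The analogue of [rotate_D] for rho itself. As F rho(b) = rho(b) F + [F, rho(b)], moving rho(b)
    across F leaves a second trace without the factor F, of the kind that [even_trace] kills. *)
Lemma rotate_rho w b X : bfl w -> calB b -> sch p p X ->
  \sum_(q <- dec b) Tr (g * s (fun x => w (x * q.1)) * f * (r q.2 * X)) =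
  Tr (g * s w * f * (X * r b)) - Tr (g * s w * (X * D b)) :> R[i].
Proof.
move=> hw hb hX; rewrite -Tr_sum; last first.
  by move=> q _; apply/cycle_trc/sch_mul0l.
have -> : \sum_(q <- dec b) g * s (fun x => w (x * q.1)) * f * (r q.2 * X) =
    r b * (g * s w * f * X) - D b * (g * s w * X).
  transitivity (g * (\sum_(q <- dec b) s (fun x => w (x * q.1)) * r q.2) * f * X +
     g * (\sum_(q <- dec b) s (fun x => w (x * q.1)) * D q.2) * X).
    rewrite !mulr_sumr !mulr_suml -big_split; apply: eq_bigr => q _ /=.
    by rewrite /D mulrBr !mulrBr !mulrBl !mulrA addrC subrK.
  by rewrite s_D // s_rho // !mulrA gD // gr // !mulNr.
have cyc (Y Z : bop H) : sch p p Z -> Tr (Y * Z) = Tr (Z * Y) :> R[i].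
  by move=> hZ; rewrite (sch_cyc (ltn0Sn _) (sch0 p Y) hZ).
have t2 (Y Z : bop H) : trc (Y * (Z * X)) by apply/(trc_sch (ltn0Sn n.*2)); do 2 apply: sch_mul0l.
rewrite TrD ?TrN //; last by rewrite -mulNr.
by rewrite (cyc (r b)) ?(cyc (D b)) ?mulrA //; apply: sch_mul0l.
Qed.

Lemma t_phi_F w b : bfl w -> (forall i, calB (b i)) ->
  t_op Delta phi alpha Phi w b = Phi w b.
Proof.
move=> hw hb; rewrite phi_FE // big_ord_recr /=.
rewrite -(rotate_D hw (hb _)); last by apply: prod_sch.
rewrite mulr_sumr; apply: eq_big_seq => q hq; rewrite phi_FE.
  congr (_ * Tr (bfun (_ * _))); rewrite big_ord_recl /=; congr (_ * _).
  apply: eq_bigr => i _; congr (D (b _)); apply: val_inj.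
  by rewrite /= add0n inordK // ltnS ltnW.
by move=> i; case: eqP => // _; exact: decP hq.
Qed.

(* F X F = X for an even product X, while F anticommutes with the grading, so
   that cyclicity makes the trace equal to its opposite. *)
Lemma even_trace w (b : nat -> B) : bfl w -> (forall k, calB (b k)) ->
  Tr (g * s w * \prod_(0 <= k < p.+1) D (b k)) = 0 :> R[i].
Proof.
move=> hw hb; set Q := \prod_(0 <= k < p.+1) _.
have fQ : f * Q = Q * f.
  rewrite anti_prod => [|k _]; last exact: FD.
  by rewrite size_iota subn0 -signr_odd /= negbK odd_double mul1r.
have hQ : sch p p Q.
  rewrite /Q big_nat_recr //=; apply: sch_mul0r.
  by have := @prodn_sch 0 p b hb; rewrite subn0.
have YQ : sch p p (g * s w * Q) by apply: sch_mul0l.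
suff : Tr (g * s w * Q) = - Tr (g * s w * Q) :> R[i].
  move/eqP; rewrite -addr_eq0 -mulr2n -mulr_natr mulf_eq0 pnatr_eq0 orbF => /eqP //.
rewrite -{1}[Q]mulr1 -FF !mulrA (sch_cyc (ltn0Sn _) (sch_mul0r f YQ) (sch0 p f)) ?addn0 //.
rewrite !mulrA Fg !mulNr TrN; last first.
  by rewrite -!mulrA; apply/(trc_sch (ltn0Sn n.*2)); do 3 apply: sch_mul0l; apply: sch_mul0r.
by rewrite -(mulrA g f) -sF // -!mulrA (mulrA f Q) fQ -!mulrA FF mulr1.
Qed.

(* By the Leibniz rule for [D] the i-th face contributes [P b i + P b i.+1], so
   that the alternating sum of the faces telescopes. *)
Let P (b : nat -> B) i :=
  \prod_(0 <= j < i) D (b j) * r (b i) * \prod_(i.+1 <= j < p.+1) D (b j).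
Let merge (b : nat -> B) i j :=
  if (j < i)%N then b j else if j == i then b j * b j.+1 else b j.+1.

Lemma P_sch b i : (forall k, calB (b k)) -> (i <= p)%N -> sch p p (P b i).
Proof.
move=> hb ip; rewrite -{2}(subnKC ip); apply: sch_mul.
  by apply: sch_mul0r; have := @prodn_sch 0 i b hb; rewrite subn0.
by have := @prodn_sch i.+1 p.+1 b hb; rewrite subSS.
Qed.

Lemma merge_bounded b i : (forall k, calB (b k)) -> forall j, bounded_op (rho (merge b i j)).
Proof.
move=> hb j; rewrite /merge; case: ifP => _; first exact: rho_bounded.
by case: ifP => _; [exact: rhoM_bounded|exact: rho_bounded].
Qed.

Lemma prod_merge b i : (forall k, calB (b k)) -> (i < p)%N ->
  \prod_(0 <= j < p) D (merge b i j) = P b i + P b i.+1.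
Proof.
move=> hb ip; rewrite (big_cat_nat (n := i)) // 1?ltnW //= [X in _ * X]big_ltn //.
rewrite (eq_big_nat _ _ (F2 := fun j => D (b j))); last first.
  by move=> j /andP[_ ji]; rewrite /merge ji.
rewrite [X in _ * (_ * X)](_ : _ = \prod_(i.+2 <= j < p.+1) D (b j)); last first.
  rewrite [RHS]big_add1; apply: eq_big_nat => j /andP[ij _].
  by rewrite /merge ltnNge (ltnW ij) /= gtn_eqF.
rewrite {1}/merge ltnn eqxx DM // /P (big_nat_recr i) //= [X in _ = _ * X + _]big_ltn //.
by rewrite addrC !(mulrDl, mulrDr) !mulrA.
Qed.

Lemma alt_sum (T : nat -> R[i]) m :
  \sum_(i < m) (-1) ^+ i * (T i + T i.+1) = T 0%N - (-1) ^+ m * T m.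
Proof.
elim: m => [|m IH]; first by rewrite big_ord0 mul1r subrr.
by rewrite big_ord_recr /= IH exprS; ring.
Qed.

(** Let T i be the trace in which the i-th entry enters through rho and the others through
    commutators. The untwisted faces telescope to T 0 + T p because p is odd; the twisted last face,
    with sign -1, is again T 0 + T p. *)
Lemma b_phi_F w b : bfl w -> (forall i, calB (b i)) -> b_op Delta phi alpha Phi w b = 0.
Proof.
move=> hw hb; pose c k := b (inord k); have hc k : calB (c k) by exact: hb.
pose T i := Tr (g * s w * f * P c i) : R[i].
have faceE i : (i < p)%N -> face i Phi w b = K * (T i + T i.+1).
  move=> ip; rewrite /face (phi_F_bounded w (b := fun j => merge c i j)).
    rewrite -(big_mkord xpredT (fun j => D (merge c i j))) prod_merge // mulrDr TrD //.
      by apply/cycle_trc/P_sch/ltnW.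
    exact/cycle_trc/P_sch.
  by move=> j; exact: merge_bounded.
rewrite /b_op.
have -> : \sum_(i < n.*2.+1) (-1) ^+ i * face i Phi w b = K * (T 0%N + T p).
  transitivity (K * (\sum_(i < n.*2.+1) (-1) ^+ i * (T i + T i.+1))).
    by rewrite mulr_sumr; apply: eq_bigr => i _; rewrite faceE // mulrCA.
  by rewrite alt_sum -[(-1) ^+ p]signr_odd /= odd_double expr1 mulN1r opprK.
rewrite -[(-1) ^+ n.*2.+1]signr_odd /= odd_double expr1 mulN1r.
apply/eqP; rewrite subr_eq0; apply/eqP.
pose X1 := r (c 0%N) * \prod_(1 <= j < p) D (c j).
pose X2 := \prod_(0 <= j < p) D (c j).
have hX2 : sch p p X2 by have := @prodn_sch 0 p c hc; rewrite subn0.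
have hX1 : sch p n.*2 X1.
  by apply: sch_mul0l; have := @prodn_sch 1 p c hc; rewrite subSS subn0.
have bE : b ord_max = c p.
  by rewrite /c; congr b; apply: val_inj; rewrite /= inordK.
(* The rotated entry is multiplied with the first one; the Leibniz rule splits this face into two
   terms, which [rotate_D] and [rotate_rho] bring back to T 0 and T p. *)
have -> : t_op Delta phi alpha (face 0 Phi) w b = \sum_(q <- dec (c p))
   K * (Tr (g * s (fun x => w (x * q.1)) * f * (D q.2 * X1)) +
    Tr (g * s (fun x => w (x * q.1)) * f * (r q.2 * X2))).
  rewrite /t_op bE; apply: eq_big_seq => q /(decP (hc p)) hq.
  pose c' k := if k is k'.+1 then c k' else q.2.
  have hc' k : calB (c' k) by case: k.
  rewrite /face (_ : (fun j : 'I_p => _) = fun j : 'I_p => merge c' 0 j); last first.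
    apply/funext => j; rewrite /merge /=.
    have E k : (k < p.+1)%N -> (if (inord k : 'I_p.+1) == ord0 then q.2 else
       b (inord (inord k : 'I_p.+1).-1)) = c' k.
      by move=> kp; rewrite -val_eqE /= inordK //; case: k kp.
    have j1 : (j < p.+1)%N := ltnW (ltn_ord j); have j2 : (j.+1 < p.+1)%N := ltn_ord j.
    by rewrite !(E _ j1) !(E _ j2).
  rewrite (phi_F_bounded _ (b := fun j => merge c' 0 j)).
    rewrite -(big_mkord xpredT (fun j => D (merge c' 0 j))) prod_merge // mulrDr TrD //.
    - congr (_ * _); rewrite addrC; congr (_ + _); congr (Tr (bfun (_ * _))).
        rewrite /P big_nat1 /X1 -mulrA; congr (_ * (_ * _)); exact: big_add1.
      rewrite /P big_geq // mul1r; congr (_ * _); exact: big_add1.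
    - exact/cycle_trc/P_sch.
    - exact/cycle_trc/P_sch.
  by move=> j; exact: merge_bounded.
rewrite -mulr_sumr.
rewrite big_split.
rewrite (rotate_D hw (hc p) hX1).
rewrite (rotate_rho hw (hc p) hX2).
have X2D : Tr (g * s w * (X2 * D (c p))) = 0 :> R[i].
  by rewrite -(even_trace hw hc) [in RHS]big_nat_recr.
rewrite X2D subr0; congr (_ * (_ + _)); congr (Tr (bfun (_ * _))).
  by rewrite /P big_geq // mul1r /X1 -mulrA; congr (_ * _); rewrite big_nat_recr.
by rewrite /P [X in _ * X]big_geq ?mulr1.
Qed.

Lemma tn_prod (I : Type) (t : seq I) (x : I -> A) (X : I -> bop H) :
  tn hl (brep (\prod_(i <- t) x i)) (\prod_(i <- t) X i) = \prod_(i <- t) tn hl (brep (x i)) (X i).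
Proof.
elim: t => [|i t IH]; first by rewrite !big_nil brep1 tn11.
by rewrite !big_cons brepM -tnM IH.
Qed.

Lemma U_prod (I : Type) (t : seq I) (b : I -> B) : (forall i, calB (b i)) ->
  UU * (\prod_(i <- t) \sum_(q <- dec (b i)) tn hl (brep q.1) (D q.2)) =
  tn hl 1 (\prod_(i <- t) D (b i)) * UU.
Proof.
move=> hb; elim: t => [|i t IH]; first by rewrite !big_nil tn11 mul1r mulr1.
by rewrite !big_cons mulrA U_D // -mulrA IH mulrA tnM mulr1.
Qed.

Section Irr.
Variables (m : nat) (u : 'M[A]_m) (i j : 'I_m).
Hypothesis hu : irr_corep Delta u.
Local Notation v k l := (fun y => phi (u k l * y)).

Let v_bfl k l : bfl (v k l). Proof. exact: bflMl (phi_bfl hphi). Qed.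

(** Slicing [corep_strong_right] by w(u_ik .) produces the values of w at u_ik u_lk^*, and u u^* = 1
    leaves only l = i after summation over k. *)
Lemma slice_uustar w : bfl w ->
  \sum_k s (fun x => w (u i k * x)) * s (v k j) = w 1 *: s (v i j).
Proof.
move=> hw; have wk k : bfl (fun x => w (u i k * x)) by exact: bflMl.
have h k : s (fun x => w (u i k * x)) * s (v k j) =
    \sum_l w (u i k * star (u l k)) *: s (v l j).
  have := congr1 (fun T : bop AH => sl (tens AH) (fun x => w (u i k * x)) T)
    (corep_strong_right hD hphi hU hu k j).
  rewrite -(brep1 A) (sl_mulr hl _ _ (U_aop hU) (wk k)) (sl_sum hl) // => [|l]; last exact: aop_tn.
  rewrite (_ : (fun x => w (u i k * (x * 1))) = fun x => w (u i k * x)).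
    by move=> ->; apply: eq_bigr => l _; rewrite sl_tn.
  by apply/funext => x; rewrite mulr1.
under eq_bigr => k _ do rewrite h.
have [wl _] := hw.
have E l : \sum_k w (u i k * star (u l k)) *: s (v l j) = w (i == l)%:R *: s (v l j).
  by rewrite -scaler_suml -(lin_sum wl) (irr_uustar hu).
rewrite exchange_big; under eq_bigr => l _ do rewrite E.
rewrite (bigD1 i) // eqxx big1; first exact: addr0.
by move=> l li; rewrite eq_sym (negPf li) (lin0 wl) scale0r.
Qed.

Lemma slice_ad w x : bfl w ->
  s (fun y => \sum_k \sum_l w (u i k * zz S u l j * x) * phi (u k l * y)) =
  \sum_k \sum_l w (u i k * zz S u l j * x) *: s (v k l).
Proof.
move=> hw; apply: (sl_uniq hl (U_aop hU)) => [|l l' a ha'].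
  by have [/(hatA_bfl hphi)] := ad_spec_irr hD hphi hS i j x hu hw.
rewrite bsumE inner_suml; apply: eq_bigr => k _.
rewrite bsumE inner_suml; apply: eq_bigr => k' _.
by rewrite bZE innerZl (slE hl _ _ (U_aop hU) (v_bfl k k')) (coefgP ha').
Qed.

(* Equivariance moves U through the product of the dual coactions; by
   [corep_strong_left] a second U absorbs the coefficients [zz], so that after
   slicing only the factor [w (u i k * _)] on the right survives. *)
Lemma slice_conj w (I : Type) (t : seq I) (b : I -> B) (J : finType)
    (x : J -> A) (X : J -> bop H) : bfl w -> (forall i, calB (b i)) ->
  \sum_q tn hl (brep (x q)) (X q) = \prod_(i <- t) \sum_(q <- dec (b i)) tn hl (brep q.1) (D q.2) ->
  \sum_q s (fun y => \sum_k \sum_l w (u i k * zz S u l j * x q) * phi (u k l * y)) * f * X q =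
  \sum_k s (v k j) * f * \prod_(i <- t) D (b i) * s (fun x => w (u i k * x)).
Proof.
move=> hw hb hx.
(* Expanded into simple tensors, M slices to the left side; with U pulled out on the right by
   equivariance and [corep_strong_left], it slices to the right side. *)
pose M := \sum_k tn hl (brep (u i k)) 1 *
  ((\sum_l tn hl (brep (zz S u l j)) (s (v k l))) * (tn hl 1 f * \sum_q tn hl (brep (x q)) (X q))).
transitivity (sl (tens AH) w M).
  rewrite (_ : M = \sum_k \sum_l \sum_q tn hl (brep (u i k * zz S u l j * x q)) (s (v k l) * f * X q)).
    have aM k l q : aop (tens AH) (tn hl (brep (u i k * zz S u l j * x q)) (s (v k l) * f * X q)).
      exact: aop_tn.
    rewrite (sl_sum hl) // => [|k]; last by apply: aop_sum => l; exact: aop_sum.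
    under [RHS]eq_bigr => k _.
      rewrite (sl_sum hl) // => [|l]; last exact: aop_sum.
      under eq_bigr => l _.
        rewrite (sl_sum hl) //; under eq_bigr => q _ do rewrite sl_tn //.
        over.
      over.
    under [RHS]eq_bigr => k _ do rewrite exchange_big.
    rewrite [RHS]exchange_big; apply: eq_bigr => q _.
    rewrite slice_ad // !mulr_suml; apply: eq_bigr => k _; rewrite !mulr_suml; apply: eq_bigr => l _.
    by rewrite -!bAl.
  apply: eq_bigr => k _; rewrite mulr_suml mulr_sumr; apply: eq_bigr => l _.
  rewrite !mulr_sumr; apply: eq_bigr => q _.
  by rewrite !tnM !mul1r -!brepM !mulrA.
have -> : M = \sum_k tn hl (brep (u i k)) (s (v k j) * f * \prod_(i <- t) D (b i)) * UU.
  apply: eq_bigr => k _; rewrite -(corep_strong_left hD hphi hS hU hu) -mulrA.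
  rewrite (mulrA UU) U_F -mulrA hx U_prod // !mulrA !tnM !mulr1 !mul1r //.
rewrite (sl_sum hl) // => [|k]; last by apply: aop_mull; exact: U_aop.
by apply: eq_bigr => k _; rewrite (sl_mull hl _ _ (U_aop hU) hw).
Qed.

(** After [slice_conj] the slice of U by w(u_ik .) stands at the end of each trace; cyclicity
    carries it to the front and past the grading, next to the slice by phi(u_kj .), and
    [slice_uustar] sums the products to the factor w(1). *)
Lemma invariant_irr w (b : 'I_p -> B) : bfl w -> (forall i, calB (b i)) ->
  \sum_(J : {dffun forall i : 'I_p, 'I_(size (dec (b i)))})
    (let q i := tnth (in_tuple (dec (b i))) (J i) in
     Phi (ad_dual Delta phi S w (v i j) (\prod_i (q i).1)) (fun i => (q i).2)) =
  w 1 * Phi (v i j) b.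
Proof.
move=> hw hb; pose G : finType := {dffun forall i : 'I_p, 'I_(size (dec (b i)))}.
pose q (J : G) i := tnth (in_tuple (dec (b i))) (J i).
have hq J i' : calB (q J i').2 by apply: (decP (hb i')); exact: mem_tnth.
pose x J := \prod_i (q J i).1; pose X J := \prod_i D (q J i).2.
pose ad J y := \sum_k \sum_l w (u i k * zz S u l j * x J) * phi (u k l * y).
have hX J : sch p p (X J) by exact: (prod_sch (hq J)).
have hZ := prod_sch hb.
have hx : \sum_J tn hl (brep (x J)) (X J) =
    \prod_(i < p) \sum_(q <- dec (b i)) tn hl (brep q.1) (D q.2).
  under eq_bigr => J _ do rewrite tn_prod.
  rewrite (prod_sum_dffun (fun i' k => tn hl (brep (tnth (in_tuple (dec (b i'))) k).1)
    (D (tnth (in_tuple (dec (b i'))) k).2))).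
  by apply: eq_bigr => i' _; rewrite [RHS]big_tnth.
transitivity (K * Tr (\sum_J g * s (ad J) * f * X J)).
  rewrite Tr_sum => [|J _]; last exact: cycle_trc.
  rewrite mulr_sumr; apply: eq_bigr => J _ /=; rewrite phi_FE; last exact: hq.
  by rewrite (ad_dualE hD hphi hf hS (ad_spec_irr hD hphi hS i j (x J) hu hw)).
rewrite phi_FE // mulrCA; congr (_ * _).
have -> : \sum_J g * s (ad J) * f * X J = g * \sum_J s (ad J) * f * X J.
  by rewrite mulr_sumr; apply: eq_bigr => J _; rewrite !mulrA.
rewrite (slice_conj hw hb hx) mulr_sumr Tr_sum => [|k _]; last first.
  by apply/(trc_sch (ltn0Sn n.*2))/sch_mul0l/sch_mul0r/sch_mul0l.
pose om k := s (fun x => w (u i k * x)).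
transitivity (\sum_k Tr (g * (om k * s (v k j)) * (f * \prod_(i < p) D (b i))) : R[i]).
  apply: eq_bigr => k _; rewrite -/(om k) !mulrA.
  have hk : sch p p (g * s (v k j) * f * \prod_(i < p) D (b i)) by exact: sch_mul0l.
  rewrite (sch_cyc (ltn0Sn n.*2) hk (sch0 p (om k))) ?addn0 // !mulrA sg //.
  exact: bflMl.
rewrite -Tr_sum => [|k _]; last by apply/(trc_sch (ltn0Sn n.*2))/sch_mul0l/sch_mul0l.
rewrite -mulr_suml -mulr_sumr slice_uustar // -bAr -bAl TrZ ?mulrA //.
exact: cycle_trc.
Qed.
End Irr.

(** For eta = phi(a .) both sides of the invariance are linear in a, so it suffices to take for a
    the coefficients of irreducible corepresentations. *)
Lemma invariant_phi_F : invariant_cochain Delta phi S alpha Phi.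
Proof.
split.
  split=> [c w eta b hw heta hb|c w b i x y hw hb hx hy].
    by apply: phi_F_linl => //; exact: (hatA_bfl hphi).
  by apply: phi_F_linr => //; exact: (hatA_bfl hphi hw).
move=> w eta b /(hatA_bfl hphi) hw [a aA etaE] hb.
have -> : eta = fun y => phi (a * y) by exact/funext.
have wb a' : bfl (fun y => phi (a' * y)) by exact: bflMl (phi_bfl hphi).
pose T eta' := \sum_(J : {dffun forall i : 'I_p, 'I_(size (dec (b i)))})
    (let q i := tnth (in_tuple (dec (b i))) (J i) in
     Phi (ad_dual Delta phi S w eta' (\prod_i (q i).1)) (fun i => (q i).2)).
(* Linearity of [ad_dual] in eta comes from uniqueness: a combination of two solutions solves the
   specification of the combined functional. *)
have T_lin c x y : matA x -> matA y ->
    T (fun z => phi ((c *: x + y) * z)) = c * T (fun z => phi (x * z)) + T (fun z => phi (y * z)).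
  move=> hx hy; rewrite /T mulr_sumr -big_split; apply: eq_bigr => J _ /=.
  set X := \prod_i _.
  have [e1 h1] := ad_spec_ex hD hphi hS X hx hw; have [e2 h2] := ad_spec_ex hD hphi hS X hy hw.
  have := ad_spec_lin hphi c h1 h2.
  rewrite (_ : (fun z => c * phi (x * z) + phi (y * z)) = fun z => phi ((c *: x + y) * z)).
    move=> h3; rewrite !(ad_dualE hD hphi hf hS h1, ad_dualE hD hphi hf hS h2, ad_dualE hD hphi hf hS h3).
    apply: phi_F_linl; first by move=> i; apply: (decP (hb i)); exact: mem_tnth.
      by case: h1 => /(hatA_bfl hphi).
    by case: h2 => /(hatA_bfl hphi).
  by apply/funext => z; rewrite mulrDl -scalerAl (phiD hphi) (phiZ hphi).
have Phi_lin c x y : Phi (fun z => phi ((c *: x + y) * z)) b =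
    c * Phi (fun z => phi (x * z)) b + Phi (fun z => phi (y * z)) b.
  rewrite -phi_F_linl //; congr (Phi _ b); apply/funext => z.
  by rewrite mulrDl -scalerAl (phiD hphi) (phiZ hphi).
rewrite -/(T _); move: a aA {etaE}.
apply: (@lspan_induct R A _ (fun a => T (fun y => phi (a * y)) = w 1 * Phi (fun y => phi (a * y)) b)).
  have := T_lin (-1) 0 0 (lspan0 _) (lspan0 _); rewrite scaler0 addr0 mulN1r addNr => ->.
  by have := Phi_lin (-1) 0 0; rewrite scaler0 addr0 mulN1r addNr => ->; rewrite mulr0.
move=> c x y [m [u [i [j [hu ->]]]]] hy IH.
rewrite T_lin ?Phi_lin ?IH //; last exact: matA_irr.
by rewrite [T _](invariant_irr i j hu hw hb); ring.
Qed.
End Chern.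

Theorem mainTheorem2 (R : realType)
  (A : repCStar R) (AA : tensC A A) (AAA : hilbertTensor AA (rc_space A))
  (Delta : A -> AA -> AA) (phi : A -> R[i]) (S : A -> A)
  (B : repCStar R) (AB : tensC A B) (AAB : hilbertTensor AA (rc_space B))
  (alpha : B -> AB -> AB)
  (H : hilbertType R) (AH : hilbertTensor (rc_space A) H)
  (AAH : hilbertTensor AA H)
  (rho : B -> H -> H) (F gamma : H -> H) (U : AH -> AH) (n : nat) :
  compact_quantum_group Delta AAA ->
  haar_state Delta phi -> faithful_state phi ->
  antipode Delta S ->
  coaction Delta AAB alpha -> nondegenerate_coaction alpha ->
  equivariant_even_fredholm_module Delta phi alpha AAH rho F gamma U ->
  schatten_summable Delta phi alpha rho F n.*2.+1 ->
  [/\ (forall w (b : 'I_n.*2.+1 -> B),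
         hatA Delta phi w -> (forall i, calB Delta phi alpha (b i)) ->
         exists t, has_trace (chern_op rho F gamma U w b) t),
      invariant_cochain Delta phi S alpha (phi_F rho F gamma U n),
      cochain_eq Delta phi alpha (t_op Delta phi alpha (phi_F rho F gamma U n))
        (phi_F rho F gamma U n),
      cochain_eq Delta phi alpha (b_op Delta phi alpha (phi_F rho F gamma U n))
        (fun _ _ => 0) &
      HC Delta phi S alpha (HC_class Delta phi S alpha (phi_F rho F gamma U n))].
Proof.
move=> [[hD _] _ _] hphi hf hS ha _ hE hsum.
have hb := b_phi_F hD hphi hS ha hE hsum.
have ht := t_phi_F hD hphi hS ha hE hsum.
have hinv := invariant_phi_F hD hphi hf hS ha hE hsum.
have hat w : hatA Delta phi w -> bfl w := hatA_bfl hphi (w := w).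
have tE : cochain_eq Delta phi alpha (t_op Delta phi alpha (phi_F rho F gamma U n))
    (phi_F rho F gamma U n) by move=> w b /hat hw hB; exact: ht.
have bE : cochain_eq Delta phi alpha (b_op Delta phi alpha (phi_F rho F gamma U n))
    (fun _ _ => 0) by move=> w b /hat hw hB; exact: hb.
split=> // [w b _ hB|].
  by apply: (chern_trc hE hsum).
(* In even degree lambda coincides with t, so that invariance under t is cyclicity. *)
exists (phi_F rho F gamma U n) => //; split=> //; split=> // w b hw hB.
by rewrite /lambda_op -signr_odd odd_double mul1r tE.
Qed.
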